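(* Let $\mathcal{G}$ be a finitely generated group with a minimal expansive action by homeomorphisms on the Cantor space $Z$, and set $f(n)=\mathrm{vol}_{\mathcal{G},Z}(n)$. Let $G=\mathsf{A}(\mathcal{G})$ be the alternating full group of the action (it is finitely generated and belongs to $\mathcal{C}(f)$). Then for every non-trivial finitely generated group $H$, the group $G\ast H$ has a Schreier growth gap $n f(n)$.
   Context: Growth of actions. Let $G$ be a finitely generated group with a finite symmetric generating set $S$, and let $B_G(n)$ be the ball of radius $n$ around the identity for the word metric of $S$. For a $G$-set $X$ (not assumed transitive), put $\mathrm{vol}_{G,X}(n)=\max_{x\in X}|B_G(n)\cdot x|$. For functions $f_1,f_2$, write $f_1(n)\preccurlyeq f_2(n)$ (equivalently $f_2\succcurlyeq f_1$) if there is a positive integer $C$ such that $f_1(n)\le C f_2(Cn)$ for all $n\ge 1$. Up to the associated equivalence relation, $\mathrm{vol}_{G,X}$ does not depend on $S$. $\mathcal{C}(f)$ is the class of finitely generated groups admitting a faithful $G$-set $X$ with $\mathrm{vol}_{G,X}(n)\preccurlyeq f(n)$. A finitely generated group $L$ has a Schreier growth gap $f(n)$ if every faithful $L$-set $X$ satisfies $\mathrm{vol}_{L,X}(n)\succcurlyeq f(n)$. An action of $\mathcal{G}$ on $Z$ is minimal if all its orbits are dense. An action of a finitely generated group $\mathcal{G}$ on the Cantor space is expansive if and only if it is topologically conjugate to a subshift, i.e. to a closed $\mathcal{G}$-invariant subset of $\{1,\dots,d\}^{\mathcal{G}}$ for some $d\ge 2$. The topological full group $\mathsf{F}(\mathcal{G})$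 is the group of all homeomorphisms $h$ of $Z$ such that for every $z\in Z$ there exist a clopen neighbourhood $U$ of $z$ and $g\in\mathcal{G}$ with $h|_U=g|_U$. An element $g\in\mathsf{F}(\mathcal{G})$ is a 3-cycle if $g^3=1$ and its support $\{z: g(z)\ne z\}$ is clopen and can be partitioned into three clopen subsets $U_1,U_2,U_3$ with $g(U_i)=U_{i+1}$ (indices mod 3). The alternating full group $\mathsf{A}(\mathcal{G})$ is the subgroup of $\mathsf{F}(\mathcal{G})$ generated by the 3-cycles. *)

(* Defs.v *)
From HB Require Import structures.
From mathcomp Require Import all_boot finmap.
From mathcomp Require Import boolp classical_sets functions cardinality.
From mathcomp Require Import topology cantor.

Set Implicit Arguments.
Unset Strict Implicit.
Unset Printing Implicit Defensive.

Local Open Scope classical_set_scope.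
Local Open Scope group_scope.

Section Subgroups.
Variable G : groupType.

Definition is_subgroup (K : set G) : Prop :=
  [/\ K 1, forall x y, K x -> K y -> K (x * y) & forall x, K x -> K x^-1].

Definition subgroup_generated (E : set G) : set G := smallest is_subgroup E.

Lemma subgroup_generatedP (E : set G) : is_subgroup (subgroup_generated E).
Proof.
split=> [K [[]]//|x y Ex Ey K KE|x Ex K KE].
  by have [[_ KM _] _] := KE; apply: KM; [exact: Ex | exact: Ey].
by have [[_ _ KV] _] := KE; apply: KV; exact: Ex.
Qed.

Definition symmetric_generating_set (S : seq G) : Prop :=
  (forall s, s \in S -> s^-1 \in S) /\ subgroup_generated [set` S] = setT.

Definition finitely_generated : Prop :=
  exists S : seq G, symmetric_generating_set S.

(* For S symmetric and generating: the elements of word length at most n. *)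
Definition ball (S : seq G) (n : nat) : set G :=
  [set g | exists w : seq G,
    [/\ size w <= n, {subset w <= S} & g = \prod_(s <- w) s]].

End Subgroups.

Record action (G : groupType) (X : Type) := Action {
  act :> G -> X -> X;
  act1 : forall x, act 1 x = x;
  actM : forall g h x, act (g * h) x = act g (act h x)
}.

Definition faithful (G : groupType) (X : Type) (a : action G X) : Prop :=
  forall g, (forall x, a g x = x) -> g = 1.

(* Cardinality of a finite set; 0 by convention on infinite sets. *)
Definition ncard (T : Type) (A : set T) : nat :=
  #|` fset_set (A : set {classic T})|.

(* The maximum exists as soon as X is nonempty (see volP); 0 by convention
   on the empty G-set. *)
Definition vol (G : groupType) (S : seq G) (X : Type) (a : action G X)
    (n : nat) : nat :=
  let card_ball x := ncard [set a g x | g in ball S n] in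
  xget 0 [set m | (exists x, m = card_ball x) /\ forall x, card_ball x <= m].

Section VolMax.
Variables (G : groupType) (S : seq G) (X : Type) (a : action G X) (n : nat).

Lemma ball_finite : finite_set (ball S n).
Proof.
pose T := {k : 'I_n.+1 & {ffun 'I_k -> seq_sub S}}.
pose F (t : T) : G := \prod_(i < tag t) ssval (tagged t i).
apply: (@sub_finite_set _ _ (F @` setT)); last first.
  by apply: finite_image; exact: finite_finset.
move=> g [w [sw wS ->]].
have wiS (i : 'I_(size w)) : nth 1 w i \in S by apply: wS; rewrite mem_nth.
have sw' : size w < n.+1 by [].
exists (@Tagged 'I_n.+1 (Ordinal sw') (fun k : 'I_n.+1 => {ffun 'I_k -> seq_sub S})
   [ffun i : 'I_(size w) => SeqSub (wiS i)]) => //.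
rewrite /F /= [RHS](big_nth 1) big_mkord.
by apply: eq_bigr => i _; rewrite ffunE.
Qed.

Lemma volP : (exists x : X, True) ->
  (exists x, vol S a n = ncard [set a g x | g in ball S n]) /\
  (forall x, ncard [set a g x | g in ball S n] <= vol S a n).
Proof.
move=> [x0 _]; rewrite /vol.
pose c x := ncard [set a g x | g in ball S n].
have cb x : c x <= ncard (ball S n).
  have -> : c x = #|` fset_set ((fun g => a g x : {classic X}) @`
                     (ball S n : set {classic G}))|%N by [].
  by rewrite fset_set_image ?leq_card_fset //; [exact: leq_imfset_card | exact: ball_finite].
pose P m := `[< exists x, m = c x >].
have exP : exists m, P m by exists (c x0); apply/asboolP; exists x0.
have ubP m : P m -> m <= ncard (ball S n) by move=> /asboolP[x ->].
case: (ex_maxnP exP ubP) => m /asboolP[x mx] mmax.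
apply: (@xgetPex _ 0 [set m | (exists x, m = c x) /\ forall x, c x <= m]).
by exists m; split; [exists x | move=> y; apply: mmax; apply/asboolP; exists y].
Qed.

End VolMax.

Definition growth_le (f1 f2 : nat -> nat) : Prop :=
  exists C : nat, (0 < C)%N /\ forall n, (1 <= n)%N -> (f1 n <= C * f2 (C * n))%N.

(* As vol does not depend, up to equivalence, on the generating set, the
   conditions below are imposed for all symmetric generating sets. *)
Definition growth_class (f : nat -> nat) (G : groupType) : Prop :=
  finitely_generated G /\
  exists (X : Type) (a : action G X), faithful a /\
    forall S : seq G, symmetric_generating_set S -> growth_le (vol S a) f.

Definition Schreier_growth_gap (L : groupType) (f : nat -> nat) : Prop :=
  finitely_generated L /\
  forall (X : Type) (a : action L X), faithful a ->
    forall S : seq L, symmetric_generating_set S -> growth_le f (vol S a).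

Definition homeomorphic (X Y : topologicalType) : Prop :=
  exists (f : X -> Y) (g : Y -> X),
    [/\ continuous f, continuous g, cancel f g & cancel g f].

Section HomeoGroup.
Variable Z : topologicalType.

Definition is_homeo (f : Z -> Z) : Prop :=
  continuous f /\ exists g : Z -> Z, [/\ continuous g, cancel f g & cancel g f].

Record homeo := Homeo { homeo_fun :> Z -> Z; homeoP : `[< is_homeo homeo_fun >] }.

HB.instance Definition _ := [isSub for homeo_fun].
HB.instance Definition _ := [Choice of homeo by <:].

Lemma homeo_continuous (f : homeo) : continuous f.
Proof. by case: f => f /= /asboolP[]. Qed.

Lemma homeo1_subproof : `[< is_homeo id >].
Proof. by apply/asboolP; split; [|exists id; split]; move=> //= x. Qed.

Definition homeo1 : homeo := Homeo homeo1_subproof.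

Lemma homeoM_subproof (f g : homeo) : `[< is_homeo (f \o g) >].
Proof.
case: f g => [f /= /asboolP[cf [f' [cf' fK f'K]]]].
case=> [g /= /asboolP[cg [g' [cg' gK g'K]]]]; apply/asboolP; split.
  by move=> x; apply: continuous_comp; [exact: cg | exact: cf].
exists (g' \o f'); split; last 2 first.
- exact: can_comp.
- exact: can_comp.
by move=> x; apply: continuous_comp; [exact: cf' | exact: cg'].
Qed.

(* The product is composition, (f * g) z = f (g z). *)
Definition homeoM (f g : homeo) : homeo := Homeo (homeoM_subproof f g).

Lemma homeoV_exists (f : homeo) : exists g : homeo, cancel f g /\ cancel g f.
Proof.
case: f => f /= /asboolP[cf [g [cg fK gK]]].
have Pg : `[< is_homeo g >] by apply/asboolP; split=> //; exists f.
by exists (Homeo Pg).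
Qed.

Definition homeoV (f : homeo) : homeo := projT1 (cid (homeoV_exists f)).

Lemma homeoK (f : homeo) : cancel f (homeoV f).
Proof. by rewrite /homeoV; case: cid => g []. Qed.

Lemma homeoVK (f : homeo) : cancel (homeoV f) f.
Proof. by rewrite /homeoV; case: cid => g []. Qed.

Lemma homeoMA : associative homeoM.
Proof. by move=> f g h; apply: val_inj. Qed.

Lemma homeo1M : left_id homeo1 homeoM.
Proof. by move=> f; apply: val_inj. Qed.

Lemma homeoM1 : right_id homeo1 homeoM.
Proof. by move=> f; apply: val_inj. Qed.

Lemma homeoVM : left_inverse homeo1 homeoV homeoM.
Proof. by move=> f; apply: val_inj; apply/funext=> z; exact: homeoK. Qed.

Lemma homeoMV : right_inverse homeo1 homeoV homeoM.
Proof. by move=> f; apply: val_inj; apply/funext=> z; exact: homeoVK. Qed.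

HB.instance Definition _ :=
  isGroup.Build homeo homeoMA homeo1M homeoM1 homeoVM homeoMV.

End HomeoGroup.

Section TopologicalActions.
Variables (G : groupType) (Z : topologicalType) (a : action G Z).

Definition by_homeomorphisms : Prop := forall g, is_homeo (a g).

Definition minimal_action : Prop :=
  forall z : Z, dense [set a g z | g in [set: G]].

(* {0, ..., d-1}^G with the product of the discrete topologies. *)
Definition full_shift (d : nat) : topologicalType :=
  {ptws G -> discrete_topology 'I_d}.

Definition shift (d : nat) (g : G) (x : full_shift d) : full_shift d :=
  fun h => x (g^-1 * h).

Definition is_subshift (d : nat) (Y : set (full_shift d)) : Prop :=
  closed Y /\ forall g x, Y x -> Y (shift g x).

(* phi is a homeomorphism onto Y for the subspace topology, with inverse the
   restriction of psi to Y. *)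
Definition conjugate_to_subshift (d : nat) (Y : set (full_shift d)) : Prop :=
  exists (phi : Z -> full_shift d) (psi : full_shift d -> Z),
    [/\ continuous phi /\ {within Y, continuous psi},
        (forall z, Y (phi z)),
        cancel phi psi /\ {in Y, cancel psi phi} &
        forall g z, phi (a g z) = shift g (phi z)].

Definition expansive_action : Prop :=
  exists (d : nat) (Y : set (full_shift d)),
    [/\ 2 <= d, is_subshift Y & conjugate_to_subshift Y].

Definition topological_full_group : set (homeo Z) :=
  [set h | forall z : Z, exists (U : set Z) (g : G),
    [/\ clopen U, U z & forall y, U y -> h y = a g y]].

Definition support (h : homeo Z) : set Z := [set z | h z <> z].

(* ordS is the cyclic successor on 'I_3. *)
Definition three_cycle (h : homeo Z) : Prop :=
  [/\ topological_full_group h, h ^+ 3 = 1, clopen (support h) &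
    exists U : 'I_3 -> set Z,
      [/\ forall i, clopen (U i),
          trivIset setT U,
          \bigcup_i U i = support h &
          forall i, h @` U i = U (ordS i)]].

Definition alternating_full_set : set (homeo Z) :=
  subgroup_generated [set h | three_cycle h].

Record alternating_full_group := AlternatingFullGroup {
  alternating_val :> homeo Z;
  alternating_valP : `[< alternating_full_set alternating_val >]
}.

HB.instance Definition _ := [isSub for alternating_val].
HB.instance Definition _ := [Choice of alternating_full_group by <:].

Lemma alternating_closed :
  group_closed (fun h : homeo Z => `[< alternating_full_set h >]).
Proof.
have [A1 AM AV] := subgroup_generatedP [set h | three_cycle h].
split=> [|x y]; first exact/asboolP.
move=> /asboolP Ax /asboolP Ay; apply/asboolP.
by apply: AM => //; exact: AV.
Qed.

HB.instance Definition _ :=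
  SubChoice_isSubGroup.Build _ _ alternating_full_group alternating_closed.

End TopologicalActions.

(* The free product of G and H, realized as the set of reduced words: the
   words in the nontrivial elements of G and H whose letters alternate between
   the two factors, multiplied by concatenation followed by reduction. *)
Section FreeProduct.
Variables G H : groupType.

Local Notation letter := (G + H)%type.

Definition trivial_letter (l : letter) : bool :=
  match l with inl g => g == 1 | inr h => h == 1 end.

Definition in_left (l : letter) : bool := if l is inl _ then true else false.

Definition reduced (w : seq letter) : bool :=
  all (predC trivial_letter) w &&
  sorted (fun l m => in_left l != in_left m) w.

Record free_product := FreeProduct {
  fp_word :> seq letter;
  fp_reduced : reduced fp_word
}.

HB.instance Definition _ := [isSub for fp_word].
HB.instance Definition _ := [Choice of free_product by <:].

Definition cons_nontrivial (l : letter) (w : seq letter) : seq letter :=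
  if trivial_letter l then w else l :: w.

(* The reduced form of l :: w when w is reduced. *)
Definition reduced_cons (l : letter) (w : seq letter) : seq letter :=
  match l, w with
  | inl g, inl g' :: w' => cons_nontrivial (inl (g * g')) w'
  | inr h, inr h' :: w' => cons_nontrivial (inr (h * h')) w'
  | _, _ => cons_nontrivial l w
  end.

Definition invl (l : letter) : letter :=
  match l with inl g => inl g^-1 | inr h => inr h^-1 end.

Lemma reduced_tl l w : reduced (l :: w) -> reduced w.
Proof. by move=> /andP[/= /andP[_ ?] /path_sorted ?]; apply/andP. Qed.

Lemma reduced_hd l w : reduced (l :: w) -> ~~ trivial_letter l.
Proof. by move=> /andP[/= /andP[]]. Qed.

Lemma reduced_same l l' w :
  in_left l' = in_left l -> ~~ trivial_letter l' ->
  reduced (l :: w) -> reduced (l' :: w).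
Proof.
move=> ll' tl /andP[/= /andP[_ aw]]; rewrite /reduced /= tl aw /=.
by case: w {aw} => //= m w; rewrite ll'.
Qed.

Lemma reduced_diff l m w : in_left l != in_left m -> ~~ trivial_letter l ->
  reduced (m :: w) -> reduced (l :: m :: w).
Proof. by move=> lm tl /andP[/= aw sw]; rewrite /reduced /= tl lm aw. Qed.

Lemma reduced_consP l w : reduced w -> reduced (reduced_cons l w).
Proof.
rewrite /reduced_cons /cons_nontrivial.
case: l w => [g|h] [|[g'|h'] w] rw //; case: ifPn => // tl.
- by rewrite /reduced /= tl.
- exact: reduced_tl rw.
- exact: reduced_same rw.
- exact: reduced_diff.
- by rewrite /reduced /= tl.
- exact: reduced_diff.
- exact: reduced_tl rw.
- exact: reduced_same rw.
Qed.

Lemma reduced_cons_reduced l w : reduced (l :: w) -> reduced_cons l w = l :: w.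
Proof.
move=> rw; have := reduced_hd rw; rewrite /reduced_cons /cons_nontrivial.
move: rw; case: l w => [g|h] [|[g'|h'] w] /andP[_ /= sw] //;
  by move=> /negbTE; rewrite ?mul1g /= => ->.
Qed.

Lemma reduced_cons_trivial l w :
  trivial_letter l -> reduced w -> reduced_cons l w = w.
Proof.
rewrite /reduced_cons /cons_nontrivial.
case: l w => [g|h] [|[g'|h'] w] /= tl rw; rewrite ?tl //.
- by rewrite (eqP tl) mul1g; move: (reduced_hd rw) => /= /negbTE ->.
- by rewrite (eqP tl) mul1g; move: (reduced_hd rw) => /= /negbTE ->.
Qed.

Lemma reduced_consMl g g' w : reduced w ->
  reduced_cons (inl g) (reduced_cons (inl g') w) = reduced_cons (inl (g * g')) w.
Proof.
rewrite /reduced_cons /cons_nontrivial.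
case: w => [|[k|k] w] rw /=.
- by case: eqP => [->|_] /=; rewrite ?mulg1.
- case: eqP => [e|_] /=; last by rewrite mulgA.
  rewrite -mulgA e mulg1.
  by case: w rw => [|[k'|k'] w] // /andP[_] /=.
- by case: eqP => [->|_] /=; rewrite ?mulg1.
Qed.

Lemma reduced_consMr h h' w : reduced w ->
  reduced_cons (inr h) (reduced_cons (inr h') w) = reduced_cons (inr (h * h')) w.
Proof.
rewrite /reduced_cons /cons_nontrivial.
case: w => [|[k|k] w] rw /=.
- by case: eqP => [->|_] /=; rewrite ?mulg1.
- by case: eqP => [->|_] /=; rewrite ?mulg1.
- case: eqP => [e|_] /=; last by rewrite mulgA.
  rewrite -mulgA e mulg1.
  by case: w rw => [|[k'|k'] w] // /andP[_] /=.
Qed.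

Lemma reduced_foldr v w : reduced w -> reduced (foldr reduced_cons w v).
Proof. by move=> rw; elim: v => //= l v; exact: reduced_consP. Qed.

Lemma foldr_reduced_cons l v w : reduced v -> reduced w ->
  foldr reduced_cons w (reduced_cons l v) =
  reduced_cons l (foldr reduced_cons w v).
Proof.
move=> rv rw.
have [tl|ntl] := boolP (trivial_letter l).
  by rewrite !reduced_cons_trivial ?reduced_foldr.
have aux m u : reduced u ->
    foldr reduced_cons w (cons_nontrivial m u) =
    reduced_cons m (foldr reduced_cons w u).
  move=> ru; rewrite /cons_nontrivial; case: ifPn => // tm.
  by rewrite reduced_cons_trivial ?reduced_foldr.
have rt m u : reduced (m :: u) -> reduced u by exact: reduced_tl.
case: l v rv ntl => [g|h] [|[g'|h'] v] rv ntl; try exact: aux.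
- by rewrite [LHS]aux ?(rt _ _ rv) // -reduced_consMl // reduced_foldr.
- by rewrite [LHS]aux ?(rt _ _ rv) // -reduced_consMr // reduced_foldr.
Qed.

Definition fp1 : free_product := FreeProduct (isT : reduced [::]).

Definition fpM (u v : free_product) : free_product :=
  FreeProduct (reduced_foldr u (fp_reduced v)).

Lemma fpV_subproof (u : free_product) : reduced (rev (map invl u)).
Proof.
case: u => u /= /andP[au su].
have tV l : trivial_letter (invl l) = trivial_letter l.
  by case: l => x /=; rewrite invg_eq1.
have lV l : in_left (invl l) = in_left l by case: l.
rewrite /reduced all_rev all_map rev_sorted sorted_map; apply/andP; split.
  by apply: sub_all au => l /=; rewrite tV.
by apply: sub_sorted su => l m /=; rewrite !lV eq_sym.
Qed.

Definition fpV (u : free_product) : free_product :=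
  FreeProduct (fpV_subproof u).

Lemma fpMA : associative fpM.
Proof.
move=> [u ru] [v rv] [w rw]; apply: val_inj => /=.
elim: u {ru} => //= l u ->.
by rewrite foldr_reduced_cons // reduced_foldr.
Qed.

Lemma fp1M : left_id fp1 fpM.
Proof. by move=> u; apply: val_inj. Qed.

Lemma fpM1 : right_id fp1 fpM.
Proof.
move=> [u ru]; apply: val_inj => /=.
elim: u ru => //= l u IH ru.
by rewrite IH ?(reduced_tl ru) // reduced_cons_reduced.
Qed.

Lemma fpVM : left_inverse fp1 fpV fpM.
Proof.
move=> [u ru]; apply: val_inj => /=.
rewrite -(foldl_rev (fun v l => reduced_cons l v)) revK.
elim: u ru => //= l u IH ru.
rewrite -[RHS](IH (reduced_tl ru)); congr foldl.
by case: l {IH ru} => x; rewrite /reduced_cons /= mulVg /cons_nontrivial /= eqxx.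
Qed.

Lemma fpMV : right_inverse fp1 fpV fpM.
Proof.
move=> u; rewrite -{1}[u](_ : fpV (fpV u) = u) ?fpVM //; apply: val_inj => /=.
rewrite map_rev revK -map_comp map_id_in // => l _ /=.
by case: l => x /=; rewrite invgK.
Qed.

HB.instance Definition _ :=
  isGroup.Build free_product fpMA fp1M fpM1 fpVM fpMV.

End FreeProduct.

(* Main.v *)
Require Import Defs.
From mathcomp Require Import all_boot.
From mathcomp Require Import boolp classical_sets cardinality finmap topology cantor.

Set Implicit Arguments.
Unset Strict Implicit.
Unset Printing Implicit Defensive.

(** Write A for the alternating full group, f(n) for the largest number of points
    of a ball of radius n in Z, and (a b c)_Y for the 3-cycle that maps a(Y) to
    b(Y), b(Y) to c(Y) and c(Y) to a(Y); this is cyc a b c Y.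

    Finite generation of A. There is a finite subset E of the acting group that
    moves every point to many places, and, as the action is expansive, a finite
    partition of Z into clopen sets W_i whose translates separate points and which
    are so small that E moves each of them to several disjoint places. The
    commutator of two 3-cycles that share one leg is a 3-cycle over the
    intersection of their bases (cyc_commutator), and conjugation moves legs
    (cyc_replace). Hence the group generated by the 3-cycles with bounded legs
    over the sets W_i `&` s^-1 W_j contains, for every clopen Y such that it
    contains the 3-cycles with legs in E over the sets Y `&` W_i, also those for
    the translates of Y (good_image). It follows that it contains them for all
    clopen Y (clopen_good), and then, moving legs along words, all 3-cycles.

    Growth. An element of A acts at each point as one of finitely many elements of
    the acting group, so A acts on Z with growth at most f. Conversely a finite
    part of A realizes the generators of the acting group at each point, so words
    of length n in it take each point to all points of its ball of radius n
    (realize_words).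

    The gap. Let A * H act faithfully on X, and say that a clopen subset V of Z
    moves a point y of X when some 3-cycle supported in V does.

    Suppose first that some y is moved by two disjoint sets. Since A moves small
    sets anywhere, the orbit of y then contains, for any two nonempty clopen sets,
    a point moved by both (moves_place). Take one of them near a point of Z where
    f(n) is attained, the other in a disjoint region where a fixed finite subset
    of A has an infinite orbit, and let r run over f(n) words of length O(n) that
    separate the first set, q over n words that separate the second. The points
    r q y are distinct if y avoids the fixed points of finitely many elements, and
    this can be achieved by applying to y elements supported in the two sets
    (avoid_fixed_points): the group generated by the 3-cycles supported in a
    clopen set is infinite and simple, so it has no proper subgroup of finite
    index and is not covered by finitely many cosets of proper subgroups. Thus A alone has n f(n)
    points within distance O(n) (incoherent_growth).

    Suppose now that no point is moved by two disjoint sets. Let f(n) be attained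
    at z, let V be a small neighbourhood of z, and let t = (1 g g')_V and
    u = t h^-1 t h with h nontrivial in H. As u has infinite order and the action
    is faithful, u has an orbit with more than 6 n points. The element t may be a
    very long word, but at each point of X it acts either trivially or as
    (1 g g')_W, where W contains V and belongs to a fixed finite family: the
    quotient of the two is disjoint from t, so it fixes the points that t moves.
    Hence consecutive points of the orbit of u are at bounded distance. At n of
    these points, up to a bounded correction, V moves the point; and the images of
    these n points under f(n) words that separate the translates of V are
    distinct, because a coincidence would give a point that two disjoint
    translates of V move (coherent_growth). *)

(** * Words and balls *)
Section FiniteCombinatorics.

Lemma pigeonhole (T : eqType) (U : finType) (f : T -> U) (l : seq T) :
  uniq l -> #|U| < size l ->
  exists x y, [/\ x \in l, y \in l, x <> y & f x = f y].
Proof.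
move=> ul sl; apply: contrapT => H.
have fi : {in l &, injective f}.
  move=> x y xl yl fxy; apply: contrapT => xy; apply: H.
  by exists x, y.
have ulf : uniq (map f l) by rewrite map_inj_in_uniq.
have := max_card [in map f l]; rewrite (card_uniqP ulf) size_map.
by rewrite leqNgt sl.
Qed.

End FiniteCombinatorics.

Section Groups.
Local Notation ball := Defs.ball.
Local Open Scope classical_set_scope.
Local Open Scope group_scope.

Section Balls.
Variable G : groupType.
Implicit Types (S : seq G) (g h : G) (N : set G).

Lemma ball1 S n : ball S n 1.
Proof. by exists [::]; rewrite big_nil; split. Qed.

Lemma ball0 S g : ball S 0 g -> g = 1.
Proof. by case=> [[|s w] [sw _ ->]] //; rewrite big_nil. Qed.

Lemma ball_mem S s n : s \in S -> 0 < n -> ball S n s.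
Proof.
move=> sS n0; exists [:: s]; rewrite big_seq1; split=> //.
by move=> x; rewrite inE => /eqP ->.
Qed.

Lemma ballM S m n g h : ball S m g -> ball S n h -> ball S (m + n) (g * h).
Proof.
move=> [v [sv vS ->]] [w [sw wS ->]]; exists (v ++ w).
rewrite size_cat leq_add // big_cat; split=> // x.
by rewrite mem_cat => /orP[/vS|/wS].
Qed.

Lemma ball_le S m n : m <= n -> ball S m `<=` ball S n.
Proof. by move=> mn g [w [sw wS ->]]; exists w; split=> //; exact: leq_trans mn. Qed.

Lemma ballS S n g : ball S n.+1 g ->
  ball S n g \/ exists s h, [/\ s \in S, ball S n h & g = s * h].
Proof.
move=> [[|s w] [sw wS ->]]; first by left; rewrite big_nil; exact: ball1.
right; exists s, (\prod_(x <- w) x); rewrite big_cons; split=> //.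
  by apply: wS; rewrite mem_head.
by exists w; split=> // x xw; apply: wS; rewrite inE xw orbT.
Qed.

Lemma subgroup_generated_min (E N : set G) : is_subgroup N -> E `<=` N ->
  subgroup_generated E `<=` N.
Proof. by move=> sN EN x; apply; split. Qed.

Lemma sub_subgroup_generated (E : set G) : E `<=` subgroup_generated E.
Proof. by move=> x Ex N [_]; apply. Qed.

Lemma gen_ball S : symmetric_generating_set S -> forall g, exists n, ball S n g.
Proof.
move=> [symS genS] g.
have : subgroup_generated [set` S] g by rewrite genS.
apply: (subgroup_generated_min (N := [set h | exists n, ball S n h])); last first.
  by move=> s sS; exists 1%N; exact: ball_mem.
split=> [|x y [m mx] [n ny]|x [n [w [sw wS ->]]]].
- by exists 0%N; exact: ball1.
- by exists (m + n); exact: ballM.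
- exists n, (rev (map (fun s => s^-1) w)); split.
  + by rewrite size_rev size_map.
  + by move=> s; rewrite mem_rev => /mapP[t /wS tS ->]; exact: symS.
  + elim: w {sw wS} => [|s w IH]; first by rewrite !big_nil invg1.
    by rewrite big_cons /= rev_cons -cats1 big_cat big_seq1 invgM IH.
Qed.

Lemma gen_ball_seq S (l : seq G) : symmetric_generating_set S ->
  exists n, forall g, g \in l -> ball S n g.
Proof.
move=> gS; elim: l => [|g l [n nl]]; first by exists 0%N.
have [m mg] := gen_ball gS g; exists (m + n) => h.
rewrite inE => /predU1P[->|/nl].
- by apply: ball_le mg; exact: leq_addr.
- by apply: ball_le; exact: leq_addl.
Qed.

End Balls.

Section Actions.
Variables (G : groupType) (X : Type) (a : action G X).

Lemma actK g x : a g^-1 (a g x) = x.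
Proof. by rewrite -actM mulVg act1. Qed.

Lemma actVK g x : a g (a g^-1 x) = x.
Proof. by rewrite -actM mulgV act1. Qed.

Lemma act_inj g : injective (a g).
Proof. by move=> x y e; rewrite -(actK g x) e actK. Qed.

End Actions.

(** * Coset covers and fixed points *)
Definition finite_index (G : groupType) (B N : set G) : Prop :=
  exists C : seq G, forall x, B x -> exists2 c, c \in C & N (c^-1 * x).

(** B. H. Neumann's lemma, by induction on the number of subgroups of the
    cover: one of infinite index can be dropped, since the others then cover a
    whole coset of it, and so, after translation, every coset. *)
Lemma finite_index_of_coset_cover (G : groupType) (B : set G)
    (P : set G -> Prop) : is_subgroup B ->
  (forall N, P N -> is_subgroup N /\ N `<=` B) ->
  forall l : seq (seq G * set G), (forall e, e \in l -> P e.2) ->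
  (forall x, B x ->
    exists2 e, e \in l & exists2 c, c \in e.1 & e.2 (c^-1 * x)) ->
  exists N, P N /\ finite_index B N.
Proof.
move=> [B1 BM BV] PB l.
have [k] := ubnP (size l); elim: k l => // k IH [|[C N] l] /= sl Pl cov.
  by have [] := cov _ B1.
have PN : P N by apply: (Pl (C, N)); rewrite mem_head.
have [[N1 NM NV] NB] := PB _ PN.
have [fi|nfi] := pselect (finite_index B N); first by exists N.
have [g Bg gC] : exists2 g, B g & forall c, c \in C -> ~ N (c^-1 * g).
  apply: contrapT => H; apply: nfi; exists C => x Bx; apply: contrapT => H2.
  by apply: H; exists x => // c cC Ncx; apply: H2; exists c.
(* The coset g N avoids the cosets of N in the cover, so it is covered by the
   cosets of the other subgroups; so is every translate of it. *)
pose add (e : seq G * set G) := (e.1 ++ [seq c * g^-1 * d | c <- C, d <- e.1], e.2).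
apply: (IH (map add l)) => [|e /mapP[e' e'l ->]|x Bx].
- by rewrite size_map.
- by apply: (Pl e'); rewrite inE e'l orbT.
have [e0] := cov _ Bx; rewrite inE => /predU1P[->/=|el] [c cC Nc]; last first.
  exists (add e0); first exact: map_f.
  by exists c => //=; rewrite mem_cat cC.
have [e] : exists2 e, e \in (C, N) :: l &
    exists2 d, d \in e.1 & e.2 (d^-1 * (g * (c^-1 * x))).
  by apply: cov; apply: (BM _ _) => //; exact: NB.
rewrite inE => /predU1P[->/=|el] [d dC Nd].
  case: (gC d dC).
  have -> : d^-1 * g = d^-1 * (g * (c^-1 * x)) * (c^-1 * x)^-1.
    by rewrite [in RHS](mulgA d^-1) mulgK.
  by apply: (NM _ _) => //; exact: NV.
exists (add e); first exact: map_f.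
exists (c * g^-1 * d); first last.
  by rewrite /= !invgM invgK -!mulgA.
rewrite /= mem_cat; apply/orP; right; apply/allpairsP; by exists (c, d).
Qed.

(** B is an infinite, simple and nonabelian subgroup; all three properties are
    stated inside the ambient group. *)
Section Avoidance.
Variables (G : groupType) (B : set G).
Hypotheses (sB : is_subgroup B)
  (infB : forall l : seq G, exists2 b, B b & b \notin l)
  (simB : forall N, is_subgroup N -> N `<=` B ->
    (forall c n, B c -> N n -> N (c * n * c^-1)) ->
    (exists2 q, N q & q <> 1) -> B `<=` N)
  (nabB : exists x y, [/\ B x, B y & x * y <> y * x]).

Lemma infinite_uniq_seq m :
  exists l : seq G, [/\ uniq l, size l = m & forall x, x \in l -> B x].
Proof.
elim: m => [|m [l [ul sl lB]]]; first by exists [::].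
have [b Bb bl] := infB l; exists (b :: l); rewrite /= bl sl; split=> // x.
by rewrite inE => /predU1P[->|/lB].
Qed.

(** Two elements of the infinite group B permute the finitely many cosets of N
    in the same way, so that their quotient lies in the normal core of N. *)
Lemma finite_index_full N : is_subgroup N -> N `<=` B -> finite_index B N ->
  B `<=` N.
Proof.
move=> [N1 NM NV] NB [C0 covC0]; have [B1 BM BV] := sB.
pose C := [seq c <- C0 | `[< B c >]].
have covC x : B x -> exists2 c, c \in C & N (c^-1 * x).
  move=> Bx; have [c cC Nc] := covC0 _ Bx; exists c => //.
  rewrite mem_filter cC andbT; apply/asboolP.
  by rewrite -[c](mulgK (c^-1 * x)) mulVKg; apply: (BM _ _) => //; apply/BV/NB.
pose idx x := find (fun c => `[< N (c^-1 * x) >]) C.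
pose f u := [ffun i : 'I_(size C) => inord (idx (u * nth 1 C i)) : 'I_(size C).+1].
have [l [ul sl lB]] := infinite_uniq_seq #|{ffun 'I_(size C) -> 'I_(size C).+1}|.+1.
have [|u [v [ul' vl uv fuv]]] := @pigeonhole _ _ f _ ul; first by rewrite sl.
pose w := u^-1 * v.
have Bu := lB _ ul'; have Bv := lB _ vl.
have wC c : c \in C -> N (c^-1 * w * c).
  move=> cC; have Bc : B c by move: cC; rewrite mem_filter => /andP[/asboolP].
  have ci : index c C < size C by rewrite index_mem.
  have /ffunP/(_ (Ordinal ci)) := fuv; rewrite !ffunE /= nth_index //.
  have hasC x : B x -> has (fun c => `[< N (c^-1 * x) >]) C.
    by move=> /covC[d dC Nd]; apply/hasP; exists d => //; exact/asboolP.
  move=> /(congr1 val); rewrite /= !inordK ?ltnS ?find_size // => e.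
  have := nth_find 1 (hasC _ (BM _ _ Bu Bc)).
  have := nth_find 1 (hasC _ (BM _ _ Bv Bc)).
  rewrite -/(idx _) -/(idx _) e => /asboolP N2 /asboolP N3.
  have := NM _ _ (NV _ N3) N2.
  by rewrite /w !invgM !invgK !mulgA mulgK.
pose K := [set x | B x /\ forall b, B b -> N (b^-1 * x * b)].
suff BK : B `<=` K by move=> x /BK[_ /(_ _ B1)]; rewrite invg1 mul1g mulg1.
apply: simB.
- split.
  + by split=> // b Bb; rewrite mulg1 mulVg.
  + move=> x y [Bx Kx] [By Ky]; split; first exact: BM.
    move=> b Bb; have := NM _ _ (Kx _ Bb) (Ky _ Bb).
    by rewrite -!mulgA mulVKg.
  + move=> x [Bx Kx]; split; first exact: BV.
    by move=> b Bb; have := NV _ (Kx _ Bb); rewrite !invgM invgK !mulgA.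
- by move=> x [].
- move=> c n Bc [Bn Kn]; split; first by apply: (BM _ _); [exact: BM | exact: BV].
  move=> b Bb; have := Kn (c^-1 * b) (BM _ _ (BV _ Bc) Bb).
  by rewrite invgM invgK !mulgA.
- exists w; last by move=> w1; apply: uv; rewrite -[u]mulg1 -w1 mulVKg.
  split; first by apply: (BM _ _) => //; exact: BV.
  move=> b Bb; have [c cC Nc] := covC _ Bb.
  have -> : b^-1 * w * b = (c^-1 * b)^-1 * (c^-1 * w * c) * (c^-1 * b).
    by rewrite invgM invgK !mulgA !mulgK.
  by apply: (NM _ _ _ Nc); apply: (NM _ _ (NV _ Nc)); exact: wC.
Qed.

(** Suppose that every translate of y by B is fixed by some p in P. For x in B
    two of the points x a y, with a in a list longer than P, are fixed by the
    same p; call them x a y and x b y. For fixed a, b and p, such x lie in one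
    coset of the group N of those u in B that agree at a y and at b y with the
    inverse of an element of p B p^-1: indeed x^-1 p x and x'^-1 p x' fix a y
    and b y, and their quotient is x^-1 x' times an element of p B p^-1. By
    Neumann's lemma some N is all of B. But then [u, a b^-1] fixes a y for all
    u in B, these commutators generate B, and B fixes y. *)
Lemma avoid_fixed_points (X : Type) (act : action G X) (y : X) (P : seq G) :
  (forall p b c, p \in P -> B b -> B c ->
    b * (p * c * p^-1) = (p * c * p^-1) * b) ->
  (exists2 b, B b & act b y <> y) ->
  exists2 s, B s & forall p, p \in P -> act p (act s y) <> act s y.
Proof.
move=> PB [b0 Bb0 b0y]; have [B1 BM BV] := sB; apply: contrapT => noS.
have {noS} allbad s : B s -> exists2 p, p \in P & act p (act s y) = act s y.
  move=> Bs; apply: contrapT => H; apply: noS; exists s => // p pP e.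
  by apply: H; exists p.
have [l [ul sl lB]] := infinite_uniq_seq (size P).+2.
pose V p := [set v | exists2 c, B c & v = p * c * p^-1].
pose N a b p := [set u | B u /\ exists v,
  [/\ V p v, act (u * v) (act a y) = act a y & act (u * v) (act b y) = act b y]].
have comm p u v : p \in P -> B u -> V p v -> u * v = v * u.
  by move=> pP Bu [c Bc ->]; exact: PB.
(* N a b p is a group because B and p B p^-1 commute. *)
have Nsub a b p : p \in P -> is_subgroup (N a b p).
  move=> pP; split.
  - split=> //; exists 1; rewrite mulg1 !act1; split=> //.
    by exists 1 => //; rewrite mulg1 mulgV.
  - move=> u u' [Bu [v [Vv ea eb]]] [Bu' [v' [Vv' ea' eb']]].
    split; first exact: BM.
    exists (v * v').
    have -> : u * u' * (v * v') = (u * v) * (u' * v').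
      by rewrite !mulgA -[u * u' * v]mulgA (comm p u' v) // !mulgA.
    rewrite !(actM _ (u * v)) ea' eb' ea eb; split=> //.
    case: Vv Vv' => [c Bc ->] [c' Bc' ->]; exists (c * c'); first exact: BM.
    by rewrite -!mulgA mulKg.
  - move=> u [Bu [v [Vv ea eb]]]; split; first exact: BV.
    exists v^-1; rewrite -invgM -(comm p) //.
    rewrite -{1}ea -{1}eb !actK; split=> //.
    case: Vv => [c Bc ->]; exists c^-1; first exact: BV.
    by rewrite !invgM invgK mulgA.
have Nnot a b p : p \in P -> a \in l -> b \in l -> a <> b -> ~ B `<=` N a b p.
  move=> pP al bl ab BN; have Ba := lB _ al; have Bb := lB _ bl.
  have [q qE] : exists q, q = a * b^-1 by exists (a * b^-1).
  have q1 : q <> 1 by move=> q1; apply: ab; rewrite -[a](mulgVK b) -qE q1 mul1g.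
  have Bq : B q by rewrite qE; apply: (BM _ _) => //; exact: BV.
  pose fix_ay u := act u (act a y) = act a y.
  have fixq u : B u -> fix_ay (u * q * u^-1 * q^-1).
    move=> Bu; have [_ [v [Vv ea eb]]] := BN _ Bu.
    have e1 : act (a^-1 * u * a * v) y = y.
      have -> : a^-1 * u * a * v = a^-1 * (u * v * a).
        by rewrite -mulgA (comm p a v) // !mulgA.
      by rewrite actM (actM _ (u * v)) ea actK.
    have e2 : act (b^-1 * u * b * v) y = y.
      have -> : b^-1 * u * b * v = b^-1 * (u * v * b).
        by rewrite -mulgA (comm p b v) // !mulgA.
      by rewrite actM (actM _ (u * v)) eb actK.
    have e3 : act ((a^-1 * u * a * v) * (b^-1 * u * b * v)^-1) y = y.
      by rewrite actM -{1}e2 actK.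
    rewrite /fix_ay -actM.
    have -> : u * q * u^-1 * q^-1 * a =
              a * ((a^-1 * u * a * v) * (b^-1 * u * b * v)^-1).
      by rewrite qE !invgM !invgK !mulgA mulgV mul1g mulgK mulgVK.
    by rewrite actM e3.
  pose M := [set m | B m /\ forall c, B c -> fix_ay (c * m * c^-1)].
  have fixM x z : fix_ay x -> fix_ay z -> fix_ay (x * z).
    by rewrite /fix_ay actM => ? ->.
  have fixV x : fix_ay x -> fix_ay x^-1 by rewrite /fix_ay => {1}<-; rewrite actK.
  suff BM' : B `<=` M.
    have H c : B c -> fix_ay c.
      by move=> /BM'[_ /(_ _ B1)]; rewrite mul1g invg1 mulg1.
    apply: b0y; apply: (act_inj (a := act) (g := a)).
    rewrite -actM -[a * b0](mulgVK a) actM.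
    by apply: H; apply: (BM _ _); [exact: BM | exact: BV].
  apply: simB.
  - split.
    + by split=> // c Bc; rewrite mulg1 mulgV /fix_ay act1.
    + move=> x z [Bx Mx] [Bz Mz]; split; first exact: BM.
      by move=> c Bc; have := fixM _ _ (Mx _ Bc) (Mz _ Bc); rewrite -!mulgA mulKg.
    + move=> x [Bx Mx]; split; first exact: BV.
      by move=> c Bc; have := fixV _ (Mx _ Bc); rewrite !invgM invgK !mulgA.
  - by move=> x [].
  - move=> c n Bc [Bn Mn]; split; first by apply: (BM _ _); [exact: BM | exact: BV].
    by move=> d Bd; have := Mn _ (BM _ _ Bd Bc); rewrite invgM !mulgA.
  - have commM u : B u -> M (u * q * u^-1 * q^-1).
      move=> Bu; split.
        by apply: (BM _ _); [apply: (BM _ _); [exact: BM|exact: BV]|exact: BV].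
      move=> c Bc.
      have := fixM _ _ (fixq _ (BM _ _ Bc Bu)) (fixV _ (fixq _ Bc)).
      by rewrite !invgM !invgK !mulgA !mulgVK.
    have [u Bu uq] : exists2 u, B u & u * q <> q * u.
      apply: contrapT => H.
      have Hq u : B u -> u * q = q * u.
        by move=> Bu; apply: contrapT => uq; apply: H; exists u.
      have [x [z [Bx Bz]]] := nabB; apply.
      have cent : B `<=` [set u | B u /\ forall w, B w -> u * w = w * u].
        apply: simB.
        + split=> [|u v [Bu cu] [Bv cv]|u [Bu cu]].
          * by split=> // w _; rewrite mul1g mulg1.
          * split; first exact: BM.
            by move=> w Bw; rewrite -mulgA (cv _ Bw) mulgA (cu _ Bw) mulgA.
          * split; first exact: BV.
            move=> w Bw; apply: (mulgI u); rewrite mulVKg mulgA (cu _ Bw).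
            by rewrite mulgK.
        + by move=> u [].
        + by move=> c n Bc [Bn cn]; rewrite -(cn _ Bc) mulgK.
        + by exists q => //; split=> // w Bw; rewrite Hq.
      by have [_ ->] := cent _ Bx.
    exists (u * q * u^-1 * q^-1); first exact: commM.
    move=> e; apply: uq; apply: (mulIg u^-1); apply: (mulIg q^-1).
    by rewrite e mulgK mulgV.
pose Xs a b p := [set x | [/\ B x, act p (act (x * a) y) = act (x * a) y &
                              act p (act (x * b) y) = act (x * b) y]].
have XN a b p x x' : p \in P -> a \in l -> b \in l ->
    Xs a b p x -> Xs a b p x' -> N a b p (x^-1 * x').
  move=> pP al bl [Bx xa xb] [Bx' xa' xb'].
  split; first by apply: (BM _ _) => //; exact: BV.
  exists (p * (x * x'^-1) * p^-1); split.
  - by exists (x * x'^-1) => //; apply: (BM _ _) => //; exact: BV.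
  - have -> : x^-1 * x' * (p * (x * x'^-1) * p^-1) =
              (x^-1 * p * x) * (x'^-1 * p * x')^-1.
      rewrite -mulgA PB //; last by apply: (BM _ _) => //; exact: BV.
      by rewrite !invgM invgK !mulgA.
    have ex z : act p (act (z * a) y) = act (z * a) y ->
        act (z^-1 * p * z) (act a y) = act a y.
      by move=> e; rewrite -!actM -!mulgA 2!actM e -actM mulKg.
    by rewrite actM -{1}(ex _ xa') actK ex.
  - have -> : x^-1 * x' * (p * (x * x'^-1) * p^-1) =
              (x^-1 * p * x) * (x'^-1 * p * x')^-1.
      rewrite -mulgA PB //; last by apply: (BM _ _) => //; exact: BV.
      by rewrite !invgM invgK !mulgA.
    have ex z : act p (act (z * b) y) = act (z * b) y ->
        act (z^-1 * p * z) (act b y) = act b y.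
      by move=> e; rewrite -!actM -!mulgA 2!actM e -actM mulKg.
    by rewrite actM -{1}(ex _ xb') actK ex.
pose PN := [set M : set G | exists a b p,
  [/\ p \in P, a \in l, b \in l, a <> b & M = N a b p]].
pose ent (t : G * G * G) : seq G * set G :=
  ([:: xget 1 (Xs t.1.1 t.1.2 t.2)], N t.1.1 t.1.2 t.2).
pose idx := [seq (t, p) | t <- [seq ab <- [seq (a, b) | a <- l, b <- l] | ab.1 != ab.2],
  p <- P].
have [|e /mapP[[[a b] p] + ->]|x Bx|M [[a [b [p [pP al bl ab ->]]]] fi]] :=
    @finite_index_of_coset_cover G B PN sB _ (map ent idx).
- move=> M [a [b [p [pP al bl ab ->]]]]; split; first exact: Nsub.
  by move=> u [].
- move=> /allpairsP[[[a' b'] p'] /= []].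
  rewrite mem_filter => /andP[/= ab /allpairsP[[a2 b2] /= [al bl [e1 e2]]]] pP.
  case=> e3 e4 e5; subst; exists a2, b2, p'; split=> //; exact/eqP.
- have /choice[f fP] : forall a, exists p, a \in l ->
      p \in P /\ act p (act (x * a) y) = act (x * a) y.
    move=> a.
    have [al|] := boolP (a \in l); last by exists 1.
    by have [p pP e] := allbad _ (BM _ _ Bx (lB _ al)); exists p.
  have [|a [b [al bl ab fab]]] := @pigeonhole _ _
      (fun a => inord (index (f a) P) : 'I_(size P).+1) _ ul.
    by rewrite card_ord sl.
  have [fa ea] := fP _ al; have [fb eb] := fP _ bl.
  have {}fab : f a = f b.
    move/(congr1 val): fab; rewrite /= !inordK ?ltnS ?index_size // => e.
    by rewrite -(nth_index 1 fa) e nth_index.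
  have Xx : Xs a b (f a) x by split=> //; rewrite {1}fab.
  exists (ent (a, b, f a)).
    apply/map_f/allpairs_f => //; rewrite mem_filter /= allpairs_f // andbT.
    exact/eqP.
  exists (xget 1 (Xs a b (f a))); first by rewrite mem_head.
  by apply: XN => //; apply: xgetPex; exists x.
- apply: (Nnot a b p) => //; apply: finite_index_full => //; first exact: Nsub.
  by move=> u [].
Qed.

End Avoidance.
End Groups.

(** * Clopen sets of a compact zero-dimensional space *)
Section CompactZeroDimensional.
Local Open Scope classical_set_scope.
Variable Z : topologicalType.
Implicit Types (A B C K O U Y : set Z) (z : Z).

(** Compactness as an induction principle: a property of sets that is stable
    under unions and holds near each point holds for a cover. *)
Lemma finite_cover_ind K (P : set Z -> Prop) : compact K -> P set0 ->
  (forall A B, P A -> P B -> P (A `|` B)) ->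
  (forall z, K z -> exists O, [/\ open O, O z & P O]) ->
  exists C, P C /\ K `<=` C.
Proof.
move=> /compact_near_coveringP cK P0 PU loc.
pose F : set_system (set Z) := filter_from [set C | P C] (fun C => [set D | C `<=` D]).
have FF : Filter F.
  apply: filter_from_filter; first by exists set0.
  move=> A B PA PB; exists (A `|` B); first exact: PU.
  by move=> D ABD; split=> x Dx; apply: ABD; [left | right].
have [|C PC /(_ C (@subset_refl _ C)) KC] := cK _ F (fun C z => C z) FF.
  move=> z /loc[O [oO Oz PO]]; exists (O, [set D | O `<=` D]) => /=.
    split; first exact: open_nbhs_nbhs.
    by exists O.
  by move=> [x D] /= [Ox OD]; exact: OD.
by exists C.
Qed.

Hypothesis compactZ : compact [set: Z].
Hypothesis zdZ : zero_dimensional Z.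

Lemma clopen_nbhd O z : open O -> O z ->
  exists U, [/\ clopen U, U z & U `<=` O].
Proof.
move=> oO Oz.
have cK : compact (~` O).
  by apply: (subclosed_compact _ compactZ) => //; exact: open_closedC.
have [||x Ox|C [[U [cU Uz UC]] KC]] := @finite_cover_ind (~` O)
    (fun C => exists U, [/\ clopen U, U z & U `&` C = set0]) cK.
- by exists setT; split=> //; [exact: clopenT | rewrite setI0].
- move=> A B [U [cU Uz UA]] [V [cV Vz VB]]; exists (U `&` V); split=> //.
    exact: clopenI.
  by rewrite setIUr {1}[U `&` V]setIC -!setIA UA VB !setI0 setU0.
- have zx : z != x by apply/eqP => zx; apply: Ox; rewrite -zx.
  have [U [cU Uz Ux]] := zdZ zx.
  exists (~` U); split=> //; first by have [_] := cU; exact: closed_openC.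
  by exists U; split=> //; rewrite setICr.
exists U; split=> // x Ux; apply: contrapT => /KC Cx.
by have : set0 x by rewrite -UC.
Qed.

(** A local property of clopen sets that passes to disjoint unions is global:
    a finite cover by clopen sets can be made disjoint. *)
Lemma clopen_ind (P : set Z -> Prop) Y : P set0 ->
  (forall A B, clopen A -> clopen B -> A `<=` Y -> B `<=` Y ->
    A `&` B = set0 -> P A -> P B -> P (A `|` B)) ->
  (forall z, Y z -> exists O, [/\ open O, O z &
    forall A, clopen A -> A `<=` O -> A `<=` Y -> P A]) ->
  clopen Y -> P Y.
Proof.
move=> P0 PU loc cY.
have cK : compact Y.
  by have [_ clY] := cY; exact: (subclosed_compact clY compactZ).
have [||z Yz|C [[_ PC] YC]] := @finite_cover_ind Y (fun C => clopen C /\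
    forall A, clopen A -> A `<=` C -> A `<=` Y -> P A) cK.
- by split; [exact: clopen0 | move=> A _; rewrite subset0 => ->].
- move=> A B [cA PA] [cB PB]; split; first exact: clopenU.
  move=> D cD DAB DY.
  rewrite -(setUIDK D A); apply: PU.
  + exact: clopenI.
  + by apply: clopenI => //; exact: clopenC.
  + by move=> x [/DY].
  + by move=> x [/DY].
  + by rewrite setDE setIACA setICr setI0.
  + by apply: PA => [|x []//|x [/DY]//]; exact: clopenI.
  + apply: PB => [|x [Dx nAx]|x [/DY]//].
      by apply: clopenI => //; exact: clopenC.
    by case: (DAB _ Dx).
- have [O [oO Oz PO]] := loc _ Yz; have [U [cU Uz UO]] := clopen_nbhd oO Oz.
  exists U; split=> //; first by case: cU.
  by split=> // A cA AU; apply: PO => //; exact: subset_trans UO.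
exact: PC.
Qed.

(** The contrapositive of clopen_ind: a failure of the property concentrates at
    a point. *)
Lemma clopen_point (P : set Z -> Prop) Y : P set0 ->
  (forall A B, clopen A -> clopen B -> A `<=` Y -> B `<=` Y ->
    A `&` B = set0 -> P A -> P B -> P (A `|` B)) ->
  clopen Y -> ~ P Y ->
  exists2 z, Y z & forall O, open O -> O z ->
    exists A, [/\ clopen A, A `<=` O, A `<=` Y & ~ P A].
Proof.
move=> P0 PU cY nPY; apply: contrapT => H; apply: nPY.
apply: clopen_ind => // z Yz; apply: contrapT => H2; apply: H.
exists z => // O oO Oz; apply: contrapT => H3; apply: H2.
exists O; split=> // A cA AO AY; apply: contrapT => nPA; apply: H3.
by exists A.
Qed.

(** The partition is given by the map c that numbers its pieces. *)
Lemma finite_clopen_partition (P : set Z -> Prop) : P set0 ->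
  (forall z, exists O, [/\ open O, O z & forall A, clopen A -> A `<=` O -> P A]) ->
  exists k (c : Z -> nat), (forall z, c z < k)%N /\
    forall i, clopen (c @^-1` [set i]) /\ P (c @^-1` [set i]).
Proof.
move=> P0 loc.
suff [k [c [ck H]]] : exists k (c : Z -> nat), (forall z, c z < k)%N /\
    forall i, clopen ([set: Z] `&` c @^-1` [set i]) /\
      P ([set: Z] `&` c @^-1` [set i]).
  by exists k, c; split=> // i; rewrite -[_ @^-1` _]setTI.
apply: (@clopen_ind (fun Y => exists k (c : Z -> nat), (forall z, c z < k)%N /\
    forall i, clopen (Y `&` c @^-1` [set i]) /\ P (Y `&` c @^-1` [set i]))).
- exists 1%N, (fun=> 0%N); split=> // i; rewrite set0I; split=> //.
  exact: clopen0.
- move=> A B cA cB _ _ AB [k [c [ck Hc]]] [l [d [dl Hd]]].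
  exists (k + l)%N, (fun z => if `[< A z >] then c z else (k + d z)%N); split.
    move=> z; case: ifP => _; first by rewrite (leq_trans (ck z)) ?leq_addr.
    by rewrite ltn_add2l.
  move=> i; have [ik|ki] := ltnP i k.
    suff -> : (A `|` B) `&` (fun z => if `[< A z >] then c z else (k + d z)%N)
        @^-1` [set i] = A `&` c @^-1` [set i] by exact: Hc.
    apply/seteqP; split=> z /=.
      move=> [[Az|Bz]]; first by rewrite asboolT.
      have [Az|nAz] := asboolP (A z); first by [].
      by move=> e; move: ik; rewrite -e ltnNge leq_addr.
    by move=> [Az <-]; rewrite asboolT //; split=> //; left.
  suff -> : (A `|` B) `&` (fun z => if `[< A z >] then c z else (k + d z)%N)
      @^-1` [set i] = B `&` d @^-1` [set (i - k)%N] by exact: Hd.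
  apply/seteqP; split=> z /=.
    have [Az|nAz] := asboolP (A z).
      by move=> [_ e]; move: (ck z); rewrite e ltnNge ki.
    by move=> [[//|Bz]] <-; rewrite addKn.
  move=> [Bz dz]; split; first by right.
  rewrite asboolF; first by rewrite dz subnKC.
  by move=> Az; have : set0 z by rewrite -AB.
- move=> z _; have [O [oO Oz PO]] := loc z; exists O; split=> // A cA AO _.
  exists 1%N, (fun=> 0%N); split=> // -[|i].
    suff -> : A `&` (fun=> 0%N) @^-1` [set 0%N] = A by split=> //; exact: PO.
    by apply/seteqP; split=> x // [].
  suff -> : A `&` (fun=> 0%N) @^-1` [set i.+1] = set0.
    by split=> //; exact: clopen0.
  by rewrite -subset0 => x [].
- exact: clopenT.
Qed.

(** An algebra of clopen sets that separates points contains every clopen set, by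
    compactness of the set and of its complement. *)
Lemma clopen_algebra (P : set Z -> Prop) Y : P setT ->
  (forall A B, P A -> P B -> P (A `&` B)) -> (forall A, P A -> P (~` A)) ->
  (forall A, P A -> clopen A) ->
  (forall z z', z <> z' -> exists A, [/\ P A, A z & ~ A z']) ->
  clopen Y -> P Y.
Proof.
move=> PT PI PC Pcl sepP cY.
have PU A B : P A -> P B -> P (A `|` B).
  by move=> PA PB; rewrite -[_ `|` _]setCK setCU; apply/PC/PI; exact: PC.
have P0 : P set0 by rewrite -setCT; exact: PC.
have cK : compact Y.
  by have [_ clY] := cY; exact: (subclosed_compact clY compactZ).
have cK' : compact (~` Y).
  by have [+ _] := cY => /open_closedC cl; exact: (subclosed_compact cl compactZ).
have loc z : Y z -> exists A, [/\ P A, A z & A `<=` Y].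
  move=> Yz.
  have [||z' nYz'|C [[A [PA Az AC]] YC]] := @finite_cover_ind (~` Y)
      (fun C => exists A, [/\ P A, A z & A `&` C = set0]) cK'.
  - by exists setT; rewrite setI0.
  - move=> A B [U [cU Uz UA]] [V [cV Vz VB]]; exists (U `&` V); split=> //.
      exact: PI.
    by rewrite setIUr {1}[U `&` V]setIC -!setIA UA VB !setI0 setU0.
  - have [zz'|A [PA Az nAz']] := sepP z z'; first by apply: nYz'; rewrite -zz'.
    exists (~` A); split=> //; first by have [_] := Pcl _ PA; exact: closed_openC.
    by exists A; split=> //; rewrite setICr.
  exists A; split=> // x Ax; apply: contrapT => /YC Cx.
  by have : set0 x by rewrite -AC.
have [||z Yz|C [[PC' CY] YC]] := @finite_cover_ind Y (fun C => P C /\ C `<=` Y) cK.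
- by split.
- by move=> A B [PA AY] [PB BY]; split; [exact: PU | move=> x [/AY|/BY]].
- have [A [PA Az AY]] := loc _ Yz.
  by exists A; split=> //; case: (Pcl _ PA).
by have -> : Y = C by apply/seteqP.
Qed.

End CompactZeroDimensional.

(** * 3-cycles of homeomorphisms *)
Section Homeos.
Local Open Scope classical_set_scope.
Local Open Scope group_scope.
Variable Z : topologicalType.
Implicit Types (A B O U Y W : set Z) (z : Z) (f g h a b c d e k : homeo Z)
  (l : seq (homeo Z)).

Lemma homeoME f g z : (f * g) z = f (g z). Proof. by []. Qed.
Lemma homeo1E z : (1 : homeo Z) z = z. Proof. by []. Qed.
Lemma hK f z : f^-1 (f z) = z. Proof. exact: homeoK. Qed.
Lemma hVK f z : f (f^-1 z) = z. Proof. exact: homeoVK. Qed.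
Lemma homeo_inj f : injective f. Proof. exact: can_inj (homeoK f). Qed.

Lemma homeo_ext f g : (forall z, f z = g z) -> f = g.
Proof. by move=> e; apply: val_inj; apply/funext. Qed.

Lemma homeo_imageE f A : f @` A = (f^-1)%g @^-1` A.
Proof.
apply/seteqP; split=> z /=; first by move=> [x Ax <-]; rewrite hK.
by move=> Az; exists (f^-1 z) => //; rewrite hVK.
Qed.

Lemma open_preimage f A : open A -> open (f @^-1` A).
Proof. by move=> oA; have /continuousP := @homeo_continuous Z f; exact. Qed.

Lemma clopen_preimage f A : clopen A -> clopen (f @^-1` A).
Proof. by move=> cA; apply: preimage_clopen => //; exact: homeo_continuous. Qed.

Lemma clopen_image f A : clopen A -> clopen (f @` A).
Proof. by rewrite homeo_imageE; exact: clopen_preimage. Qed.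

Lemma image_homeoM f g A : (f * g)%g @` A = f @` (g @` A).
Proof. by rewrite image_comp. Qed.

(** What is left to check when homeomorphisms are pasted together: that the
    result, and its inverse, are locally given by homeomorphisms. *)
Lemma patch_homeo (f g : Z -> Z) : cancel f g -> cancel g f ->
  (forall z, exists O h, [/\ open O, O z & forall y, O y -> f y = h y]) ->
  (forall z, exists O h, [/\ open O, O z & forall y, O y -> g y = h y]) ->
  exists h, forall z, h z = f z.
Proof.
move=> fK gK locf locg.
have cont (u : Z -> Z) :
    (forall z, exists O h, [/\ open O, O z & forall y, O y -> u y = h y]) ->
    continuous u.
  move=> loc; apply/continuousP => A oA; rewrite openE => z Az.
  have [O [h [oO Oz uh]]] := loc z.
  apply: (@filterS _ _ _ (O `&` h @^-1` A)).
    by move=> y [Oy] /=; rewrite -uh.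
  apply: open_nbhs_nbhs; split; last by split=> //=; rewrite -uh.
  by apply: openI => //; exact: open_preimage.
have ph : `[< is_homeo f >].
  by apply/asboolP; split; [exact: cont | exists g; split=> //; exact: cont].
by exists (Homeo ph).
Qed.

Definition apart Y a b := forall y y', Y y -> Y y' -> a y <> b y'.
Fixpoint apart_from Y a l : Prop :=
  if l is b :: l' then apart Y a b /\ apart_from Y a l' else True.
Fixpoint scattered Y l : Prop :=
  if l is a :: l' then apart_from Y a l' /\ scattered Y l' else True.

Lemma apartS Y W a b : W `<=` Y -> apart Y a b -> apart W a b.
Proof. by move=> WY H y y' /WY Yy /WY Yy'; exact: H. Qed.

Lemma apart_sym Y a b : apart Y a b -> apart Y b a.
Proof. by move=> H y y' Yy Yy' /esym; exact: H. Qed.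

Lemma apart_from_sub Y W a l : W `<=` Y -> apart_from Y a l -> apart_from W a l.
Proof. by move=> WY; elim: l => //= b l IH [ab /IH]; split=> //; exact: apartS ab. Qed.

Lemma scattered_sub Y W l : W `<=` Y -> scattered Y l -> scattered W l.
Proof.
move=> WY; elim: l => //= a l IH [al /IH]; split=> //; exact: apart_from_sub al.
Qed.

Lemma apart_image Y a b k : apart (k @` Y) a b <-> apart Y (a * k) (b * k).
Proof.
split=> H; first by move=> y y' Yy Yy'; apply: H; [exists y | exists y'].
by move=> _ _ [y Yy <-] [y' Yy' <-]; exact: H.
Qed.

Lemma apart_left Y a b k : apart Y a b -> apart Y (k * a) (k * b).
Proof. by move=> H y y' Yy Yy' e; apply: (H y y') => //; exact: (@homeo_inj k). Qed.

Lemma eq_apart Y a b a' b' : (forall y, Y y -> a y = a' y) ->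
  (forall y, Y y -> b y = b' y) -> apart Y a b -> apart Y a' b'.
Proof. by move=> aa bb H y y' Yy Yy'; rewrite -aa // -bb //; exact: H. Qed.

Definition cycle_spec a b c Y h :=
  (forall y, Y y -> [/\ h (a y) = b y, h (b y) = c y & h (c y) = a y]) /\
  (forall z, (forall y, Y y -> [/\ z <> a y, z <> b y & z <> c y]) -> h z = z).

(** The 3-cycle with base Y and legs a, b and c. It depends only on the values of
    the legs on Y, and is the identity unless Y is clopen and its three
    translates are disjoint. *)
Definition cyc a b c Y : homeo Z :=
  xget 1 [set h | [/\ clopen Y, scattered Y [:: a; b; c] & cycle_spec a b c Y h]].

Lemma cycle_cases a b c Y z :
  (exists2 y, Y y & z = a y \/ z = b y \/ z = c y) \/
  (forall y, Y y -> [/\ z <> a y, z <> b y & z <> c y]).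
Proof.
have [|H] := pselect (exists2 y, Y y & z = a y \/ z = b y \/ z = c y).
  by left.
by right=> y Yy; split=> e; apply: H; exists y; auto.
Qed.

Lemma cycle_spec_uniq a b c Y h h' :
  cycle_spec a b c Y h -> cycle_spec a b c Y h' -> h = h'.
Proof.
move=> [hY hN] [hY' hN']; apply: homeo_ext => z.
have [[y Yy]|H] := cycle_cases a b c Y z; last by rewrite hN // hN'.
have [h1 h2 h3] := hY _ Yy; have [h1' h2' h3'] := hY' _ Yy.
by move=> [->|[->|->]]; congruence.
Qed.

Lemma cycle_spec_exists a b c Y : clopen Y -> scattered Y [:: a; b; c] ->
  exists h, cycle_spec a b c Y h.
Proof.
move=> cY [[ab [ac _]] [[bc _] _]].
pose F a b c z := if `[< Y (a^-1 z) >] then b (a^-1 z) else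
  if `[< Y (b^-1 z) >] then c (b^-1 z) else
  if `[< Y (c^-1 z) >] then a (c^-1 z) else z.
have FY a' b' c' y : apart Y a' b' -> apart Y a' c' -> apart Y b' c' -> Y y ->
    [/\ F a' b' c' (a' y) = b' y, F a' b' c' (b' y) = c' y &
        F a' b' c' (c' y) = a' y].
  move=> ab' ac' bc' Yy; rewrite /F; split.
  - by rewrite hK asboolT.
  - rewrite asboolF; last by move=> H; apply: (ab' _ y H Yy); rewrite hVK.
    by rewrite hK asboolT.
  - rewrite asboolF; last by move=> H; apply: (ac' _ y H Yy); rewrite hVK.
    rewrite asboolF; last by move=> H; apply: (bc' _ y H Yy); rewrite hVK.
    by rewrite hK asboolT.
have FN a' b' c' z : (forall y, Y y -> [/\ z <> a' y, z <> b' y & z <> c' y]) ->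
    F a' b' c' z = z.
  move=> H; rewrite /F !asboolF //.
  - by move=> /H[_ _]; rewrite hVK.
  - by move=> /H[_]; rewrite hVK.
  - by move=> /H[]; rewrite hVK.
have FK a' b' c' : apart Y a' b' -> apart Y a' c' -> apart Y b' c' ->
    cancel (F a' b' c') (F a' c' b').
  move=> ab' ac' bc' z.
  have cb' := apart_sym bc'.
  have [[y Yy]|H] := cycle_cases a' b' c' Y z.
    have [e1 e2 e3] := FY _ _ _ _ ab' ac' bc' Yy.
    have [e4 e5 e6] := FY _ _ _ _ ac' ab' cb' Yy.
    by move=> [->|[->|->]]; congruence.
  by rewrite (FN _ _ _ _ H) FN // => y /H[].
have loc a' b' c' z : exists O h, [/\ open O, O z & forall y, O y -> F a' b' c' y = h y].
  have op a'' := proj1 (clopen_image a'' cY).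
  have opC a'' := proj1 (clopenC set0 (clopen_image a'' cY)).
  have im a'' y : (a'' @` Y) y = Y (a''^-1 y) by rewrite homeo_imageE.
  have nim a'' y : ~ (a'' @` Y) y -> ~ Y (a''^-1 y) by rewrite im.
  have [Az|nAz] := pselect ((a' @` Y) z).
    exists (a' @` Y), (b' * a'^-1); split=> // y.
    by rewrite im /F => Yy; rewrite asboolT.
  have [Bz|nBz] := pselect ((b' @` Y) z).
    exists (~` (a' @` Y) `&` b' @` Y), (c' * b'^-1); split=> //.
      exact: openI.
    by move=> y [/nim nA]; rewrite im /F => Yy; rewrite asboolF // asboolT.
  have [Cz|nCz] := pselect ((c' @` Y) z).
    exists (~` (a' @` Y) `&` ~` (b' @` Y) `&` c' @` Y), (a' * c'^-1); split=> //.
      by apply: openI => //; exact: openI.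
    move=> y [[/nim nA /nim nB]]; rewrite im /F => Yy.
    by rewrite asboolF // asboolF // asboolT.
  exists (~` (a' @` Y) `&` ~` (b' @` Y) `&` ~` (c' @` Y)), 1; split=> //.
    by apply: openI => //; exact: openI.
  move=> y [[/nim nA /nim nB] /nim nC]; rewrite /F.
  by rewrite asboolF // asboolF // asboolF.
have [h hE] := patch_homeo (FK _ _ _ ab ac bc) (FK _ _ _ ac ab (apart_sym bc))
  (loc _ _ _) (loc _ _ _).
exists h; split=> [y Yy|z H]; last by rewrite hE FN.
by rewrite !hE; exact: FY.
Qed.

Lemma cycP a b c Y : clopen Y -> scattered Y [:: a; b; c] ->
  cycle_spec a b c Y (cyc a b c Y).
Proof.
move=> cY sY; have [h hs] := cycle_spec_exists cY sY.
have : [set h | [/\ clopen Y, scattered Y [:: a; b; c] & cycle_spec a b c Y h]]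
  (cyc a b c Y) by apply: xgetPex; exists h.
by case.
Qed.

Lemma cyc_junk a b c Y : ~ (clopen Y /\ scattered Y [:: a; b; c]) ->
  cyc a b c Y = 1.
Proof. by move=> H; rewrite /cyc xgetPN // => h [cY sY _]; apply: H. Qed.

Lemma cyc_eq a b c Y h : clopen Y -> scattered Y [:: a; b; c] ->
  cycle_spec a b c Y h -> h = cyc a b c Y.
Proof. by move=> cY sY /cycle_spec_uniq; apply; exact: cycP. Qed.

Section Spec.
Variables (a b c : homeo Z) (Y : set Z).
Hypotheses (cY : clopen Y) (sY : scattered Y [:: a; b; c]).

Lemma cyc_a y : Y y -> cyc a b c Y (a y) = b y.
Proof. by move=> Yy; have [/(_ _ Yy)[]] := cycP cY sY. Qed.
Lemma cyc_b y : Y y -> cyc a b c Y (b y) = c y.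
Proof. by move=> Yy; have [/(_ _ Yy)[]] := cycP cY sY. Qed.
Lemma cyc_c y : Y y -> cyc a b c Y (c y) = a y.
Proof. by move=> Yy; have [/(_ _ Yy)[]] := cycP cY sY. Qed.
Lemma cyc_out z : (forall y, Y y -> [/\ z <> a y, z <> b y & z <> c y]) ->
  cyc a b c Y z = z.
Proof. by have [_] := cycP cY sY; exact. Qed.

End Spec.

Lemma cyc0 a b c : cyc a b c set0 = 1.
Proof.
apply/esym/cyc_eq; [exact: clopen0 | by do !split=> //; move=> ? ? [] |].
by split=> // y [].
Qed.

Lemma cyc_rot a b c Y : clopen Y -> scattered Y [:: a; b; c] ->
  cyc b c a Y = cyc a b c Y.
Proof.
move=> cY sY; apply/esym/cyc_eq => //.
  move: sY => [[ab [ac _]] [[bc _] _]].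
  by do !split=> //; exact: apart_sym.
split=> [y Yy|z H]; first by rewrite cyc_a // cyc_b // cyc_c.
by rewrite cyc_out // => y /H[].
Qed.

Lemma cycV a b c Y : clopen Y -> scattered Y [:: a; b; c] ->
  (cyc a b c Y)^-1 = cyc a c b Y.
Proof.
move=> cY sY; apply: cyc_eq => //.
  move: sY => [[ab [ac _]] [[bc _] _]].
  by do !split=> //; exact: apart_sym.
have inv x x' : cyc a b c Y x = x' -> (cyc a b c Y)^-1 x' = x.
  by move=> <-; rewrite hK.
split=> [y Yy|z H]; last by apply/inv/cyc_out => // y /H[].
by split; apply: inv; [exact: cyc_c | exact: cyc_b | exact: cyc_a].
Qed.

(** With legs that are homeomorphisms, rather than three disjoint sets and maps
    between them, conjugation is multiplication of the legs. *)
Lemma cyc_conj k a b c Y : clopen Y -> scattered Y [:: a; b; c] ->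
  k * cyc a b c Y * k^-1 = cyc (k * a) (k * b) (k * c) Y.
Proof.
move=> cY sY; apply: cyc_eq => //.
  move: sY => [[ab [ac _]] [[bc _] _]].
  by do !split=> //; exact: apart_left.
split=> [y Yy|z H]; first by rewrite !homeoME !hK cyc_a // cyc_b // cyc_c.
rewrite !homeoME cyc_out ?hVK // => y /H[p q r].
by split=> e; [apply: p | apply: q | apply: r]; rewrite homeoME -e hVK.
Qed.

Lemma eq_cyc a b c a' b' c' Y : clopen Y -> scattered Y [:: a; b; c] ->
  (forall y, Y y -> a y = a' y) -> (forall y, Y y -> b y = b' y) ->
  (forall y, Y y -> c y = c' y) -> cyc a b c Y = cyc a' b' c' Y.
Proof.
move=> cY sY ea eb ec; apply: cyc_eq => //.
  move: sY => [[ab [ac _]] [[bc _] _]].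
  split; last by split=> //; split=> //; exact: eq_apart bc.
  by split; [exact: eq_apart ab | split=> //; exact: eq_apart ac].
split=> [y Yy|z H]; first by rewrite -ea // -eb // -ec // cyc_a // cyc_b // cyc_c.
by rewrite cyc_out // => y Yy; rewrite ea // eb // ec //; exact: H.
Qed.

Lemma cyc_image a b c k Y : clopen Y -> scattered (k @` Y) [:: a; b; c] ->
  cyc a b c (k @` Y) = cyc (a * k) (b * k) (c * k) Y.
Proof.
move=> cY sY; have ckY := clopen_image k cY.
apply: cyc_eq => //.
  move: sY => [[ab [ac _]] [[bc _] _]].
  by do !split=> //; exact/apart_image.
split=> [y Yy|z H].
  have kY : (k @` Y) (k y) by exists y.
  by rewrite !homeoME cyc_a // cyc_b // cyc_c.
by rewrite cyc_out // => _ [y Yy <-]; exact: H.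
Qed.

Lemma cyc_union a b c Y W : clopen Y -> clopen W -> Y `&` W = set0 ->
  scattered (Y `|` W) [:: a; b; c] ->
  cyc a b c (Y `|` W) = cyc a b c Y * cyc a b c W.
Proof.
move=> cY cW YW sYW.
have sY : scattered Y [:: a; b; c] by apply: scattered_sub sYW => y; left.
have sW : scattered W [:: a; b; c] by apply: scattered_sub sYW => y; right.
apply/esym/cyc_eq => //; first exact: clopenU.
have nYW y : Y y -> W y -> False by move=> Yy Wy; have : set0 y by rewrite -YW.
have out A B x : A `<=` Y `|` W -> B `<=` Y `|` W -> (forall y, A y -> B y -> False) ->
    A x -> clopen B -> scattered B [:: a; b; c] ->
    [/\ cyc a b c B (a x) = a x, cyc a b c B (b x) = b x & cyc a b c B (c x) = c x].
  move=> AYW BYW AB Ax cB sB.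
  move: sYW => [[ab [ac _]] [[bc _] _]].
  split; apply: cyc_out => // y By; split=> e.
  - by move: By; rewrite -(homeo_inj e); exact: AB.
  - by apply: (ab x y); auto.
  - by apply: (ac x y); auto.
  - by apply: (ab y x); auto.
  - by move: By; rewrite -(homeo_inj e); exact: AB.
  - by apply: (bc x y); auto.
  - by apply: (ac y x); auto.
  - by apply: (bc y x); auto.
  - by move: By; rewrite -(homeo_inj e); exact: AB.
have oY x : Y x -> _ := fun Yx => out Y W x (@subsetUl _ _ _) (@subsetUr _ _ _) nYW Yx cW sW.
have oW x : W x -> _ := fun Wx => out W Y x (@subsetUr _ _ _) (@subsetUl _ _ _)
  (fun y Wy Yy => nYW y Yy Wy) Wx cY sY.
split=> [y [Yy|Wy]|z H]; rewrite !homeoME.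
- have [-> -> ->] := oY _ Yy.
  by rewrite (cyc_a cY sY Yy) (cyc_b cY sY Yy) (cyc_c cY sY Yy).
- have [e1 e2 e3] := oW _ Wy.
  by rewrite (cyc_a cW sW Wy) (cyc_b cW sW Wy) (cyc_c cW sW Wy) e1 e2 e3.
- rewrite (cyc_out cW sW) ?(cyc_out cY sY) // => y Hy; apply: H; first by left.
  by right.
Qed.

(** Two 3-cycles that share the single leg a: as for permutations,
    [(a b d), (a c e)] = (a b c) over the points of both bases, whereas over the
    points of only one base the commutator cancels. This is how 3-cycles over
    smaller sets are produced. *)
Lemma cyc_commutator a b c d e Y W : clopen Y -> clopen W ->
  scattered (Y `|` W) [:: a; b; c; d; e] ->
  cyc a b d Y * cyc a c e W * (cyc a b d Y)^-1 * (cyc a c e W)^-1 =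
  cyc a b c (Y `&` W).
Proof.
move=> cY cW [[ab [ac [ad [ae _]]]] [[bc [bd [be _]]] [[cd [ce _]] [[de _] _]]]].
have YYW : Y `<=` Y `|` W by move=> y; left.
have WYW : W `<=` Y `|` W by move=> y; right.
have sY : scattered Y [:: a; b; d].
  by apply: (scattered_sub YYW); do !split.
have sW : scattered W [:: a; c; e].
  by apply: (scattered_sub WYW); do !split.
have := apart_sym ab; have := apart_sym ac; have := apart_sym ad.
have := apart_sym ae; have := apart_sym bc; have := apart_sym bd.
have := apart_sym be; have := apart_sym cd; have := apart_sym ce.
have := apart_sym de => ed ec dc eb db cb ea da ca ba.
rewrite !cycV //.
have sY' : scattered Y [:: a; d; b].
  by apply: (scattered_sub YYW); do !split.
have sW' : scattered W [:: a; e; c].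
  by apply: (scattered_sub WYW); do !split.
apply: cyc_eq; first exact: clopenI.
  by apply: (@scattered_sub (Y `|` W)) => [y [Yy _]|]; [left | do !split].
have tfix x : (forall y, Y y -> [/\ x <> a y, x <> b y & x <> d y]) ->
    cyc a b d Y x = x /\ cyc a d b Y x = x.
  by move=> H; split; apply: cyc_out => // y /H[].
have ufix x : (forall y, W y -> [/\ x <> a y, x <> c y & x <> e y]) ->
    cyc a c e W x = x /\ cyc a e c W x = x.
  by move=> H; split; apply: cyc_out => // y /H[].
have tc x : (Y `|` W) x -> cyc a b d Y (c x) = c x /\ cyc a d b Y (c x) = c x.
  by move=> YWx; apply: tfix => y /YYW Yy; split; [exact: ca | exact: cb | exact: cd].
have te x : (Y `|` W) x -> cyc a b d Y (e x) = e x /\ cyc a d b Y (e x) = e x.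
  by move=> YWx; apply: tfix => y /YYW Yy; split; [exact: ea | exact: eb | exact: ed].
have ub x : (Y `|` W) x -> cyc a c e W (b x) = b x /\ cyc a e c W (b x) = b x.
  by move=> YWx; apply: ufix => y /WYW Yy; split; [exact: ba | exact: bc | exact: be].
have ud x : (Y `|` W) x -> cyc a c e W (d x) = d x /\ cyc a e c W (d x) = d x.
  by move=> YWx; apply: ufix => y /WYW Yy; split; [exact: da | exact: dc | exact: de].
have ta x : W x -> ~ Y x -> cyc a b d Y (a x) = a x /\ cyc a d b Y (a x) = a x.
  move=> Wx nYx; have YWx := WYW _ Wx.
  apply: tfix => y Yy; have YWy := YYW _ Yy.
  by split; [move=> ee; apply: nYx; rewrite (homeo_inj ee) | exact: ab | exact: ad].
have ua x : Y x -> ~ W x -> cyc a c e W (a x) = a x /\ cyc a e c W (a x) = a x.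
  move=> Yx nWx; have YWx := YYW _ Yx.
  apply: ufix => y Wy; have YWy := WYW _ Wy.
  by split; [move=> ee; apply: nWx; rewrite (homeo_inj ee) | exact: ac | exact: ae].
have tE y : Y y -> _ := fun Yy => (cyc_a cY sY Yy, cyc_b cY sY Yy, cyc_c cY sY Yy,
  (cyc_a cY sY' Yy, cyc_b cY sY' Yy, cyc_c cY sY' Yy)).
have uE y : W y -> _ := fun Wy => (cyc_a cW sW Wy, cyc_b cW sW Wy, cyc_c cW sW Wy,
  (cyc_a cW sW' Wy, cyc_b cW sW' Wy, cyc_c cW sW' Wy)).
split=> [y [Yy Wy]|z H]; rewrite !homeoME.
  have YWy := YYW _ Yy.
  have [e1 e2] := te _ YWy; have [e3 e4] := tc _ YWy; have [e5 e6] := ub _ YWy.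
  have [e7 e8] := ud _ YWy.
  have t := tE _ Yy; have u := uE _ Wy.
  by rewrite !(u, t, e1, e2, e3, e4, e5, e6, e7, e8).
have fin x : (forall y, Y y -> [/\ x <> a y, x <> b y & x <> d y]) ->
  (forall y, W y -> [/\ x <> a y, x <> c y & x <> e y]) ->
  cyc a b d Y (cyc a c e W (cyc a d b Y (cyc a e c W x))) = x.
  by move=> /tfix[t1 t2] /ufix[u1 u2]; rewrite u2 t2 u1 t1.
have onY y : Y y -> ~ W y -> z = a y \/ z = b y \/ z = d y ->
  cyc a b d Y (cyc a c e W (cyc a d b Y (cyc a e c W z))) = z.
  move=> Yy nWy; have YWy := YYW _ Yy.
  have [e1 e2] := ua _ Yy nWy; have [e5 e6] := ub _ YWy.
  have [e7 e8] := ud _ YWy; have t := tE _ Yy.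
  by move=> [->|[->|->]]; rewrite !(t, e1, e2, e5, e6, e7, e8).
have onW y : W y -> ~ Y y -> z = a y \/ z = c y \/ z = e y ->
  cyc a b d Y (cyc a c e W (cyc a d b Y (cyc a e c W z))) = z.
  move=> Wy nYy; have YWy := WYW _ Wy.
  have [e1 e2] := te _ YWy; have [e3 e4] := tc _ YWy; have [e5 e6] := ta _ Wy nYy.
  have u := uE _ Wy.
  by move=> [->|[->|->]]; rewrite !(u, e1, e2, e3, e4, e5, e6).
(* Over a point of both bases only the legs d and e are left, and the commutator
   fixes them. *)
have [[y Yy zy]|HY] := cycle_cases a b d Y z.
  have [Wy|nWy] := pselect (W y); last exact: onY zy.
  have [za zb zc] := H _ (conj Yy Wy).
  case: zy => [//|[//|->]]; have YWy := YYW _ Yy.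
  have [e3 e4] := tc _ YWy; have [e5 e6] := ub _ YWy.
  have [e7 e8] := ud _ YWy; have t := tE _ Yy; have u := uE _ Wy.
  by rewrite !(u, t, e3, e4, e5, e6, e7, e8).
have [[y Wy zy]|HW] := cycle_cases a c e W z; last exact: fin.
have [Yy|nYy] := pselect (Y y); last exact: onW zy.
have [za zb zc] := H _ (conj Yy Wy).
case: zy => [//|[//|->]]; have YWy := YYW _ Yy.
have [e1 e2] := te _ YWy; have [e3 e4] := tc _ YWy; have [e5 e6] := ub _ YWy.
have [e7 e8] := ud _ YWy; have t := tE _ Yy; have u := uE _ Wy.
by rewrite !(u, t, e1, e2, e3, e4, e5, e6, e7, e8).
Qed.

(** Conjugation by (x e e') moves the leg e of (e b c) to x. *)
Lemma cyc_replace (N : set (homeo Z)) x e e' b c Y W : is_subgroup N ->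
  clopen Y -> clopen W -> Y `<=` W -> scattered W [:: x; e; e'; b; c] ->
  N (cyc x e e' W) -> N (cyc e b c Y) -> N (cyc x b c Y).
Proof.
move=> [N1 NM NV] cY cW YW [[xe [xe' [xb [xc _]]]] [[ee' [eb [ec _]]]
  [[e'b [e'c _]] [[bc _] _]]]] Nk Nt.
have sW : scattered W [:: x; e; e'] by do !split.
have sY : scattered Y [:: e; b; c] by apply: (scattered_sub YW); do !split.
have -> : cyc x b c Y = (cyc x e e' W)^-1 * cyc e b c Y * (cyc x e e' W).
  rewrite -{2}[cyc x e e' W]invgK cyc_conj //; apply/esym/eq_cyc => //.
  + by move: sY => [[? [? _]] [[? _] _]]; do !split=> //; exact: apart_left.
  + by move=> y Yy; rewrite homeoME -(cyc_a cW sW (YW _ Yy)) hK.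
  + move=> y /YW Wy; rewrite homeoME -{1}[b y](@cyc_out x e e' W cW sW) ?hK //.
    by move=> y' Wy'; split; apply/nesym; [exact: xb | exact: eb | exact: e'b].
  + move=> y /YW Wy; rewrite homeoME -{1}[c y](@cyc_out x e e' W cW sW) ?hK //.
    by move=> y' Wy'; split; apply/nesym; [exact: xc | exact: ec | exact: e'c].
by apply: (NM _ _) => //; apply: (NM _ _) => //; exact: NV.
Qed.

Lemma cyc_fix_outside (V : set Z) a b c Y z : (forall y, Y y -> [/\ V (a y), V (b y) & V (c y)]) ->
  ~ V z -> cyc a b c Y z = z.
Proof.
move=> H nVz.
have [[cY sY]|/cyc_junk ->] := pselect (clopen Y /\ scattered Y [:: a; b; c]); last by [].
by apply: cyc_out => // y /H[Va Vb Vc]; split=> e; apply: nVz; rewrite e.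
Qed.

End Homeos.

(** * Properties of small clopen sets *)
Section Small.
Local Open Scope classical_set_scope.
Local Open Scope group_scope.
Variable Z : topologicalType.
Hypothesis compactZ : compact [set: Z].
Hypothesis zdZ : zero_dimensional Z.
Implicit Types (P Q : set Z -> Prop) (z : Z) (h : homeo Z).

(** P holds for all small clopen sets near z; such a set may miss z, which makes
    the notion stable under subdivision. *)
Definition small z P := exists O, [/\ open O, O z &
  forall Y, clopen Y -> Y `<=` O -> P Y].

Lemma smallI z P Q : small z P -> small z Q -> small z (fun Y => P Y /\ Q Y).
Proof.
move=> [O [oO Oz PO]] [U [oU Uz PU]]; exists (O `&` U); split=> //.
  exact: openI.
by move=> Y cY YOU; split; [apply: PO => // y /YOU[] | apply: PU => // y /YOU[]].
Qed.

Lemma smallW z P Q : (forall Y, clopen Y -> P Y -> Q Y) -> small z P -> small z Q.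
Proof. by move=> PQ [O [oO Oz PO]]; exists O; split=> // Y cY /(PO _ cY); exact: PQ. Qed.

Lemma small_sub z O : open O -> O z -> small z (fun Y => Y `<=` O).
Proof. by move=> oO Oz; exists O. Qed.

Lemma small_image z h P : small (h z) P -> small z (fun Y => P (h @` Y)).
Proof.
move=> [O [oO Oz PO]]; exists (h @^-1` O); split=> //.
  exact: open_preimage.
by move=> Y cY YO; apply: PO; [exact: clopen_image | move=> _ [y /YO Oy <-]].
Qed.

Lemma small_image_sub z h O : open O -> O (h z) ->
  small z (fun Y => forall y, Y y -> O (h y)).
Proof. by move=> oO Oz; exists (h @^-1` O); split=> //; exact: open_preimage. Qed.

Lemma small_ex z P : small z P -> exists Y, [/\ clopen Y, Y z & P Y].
Proof.
move=> [O [oO Oz PO]]; have [U [cU Uz UO]] := clopen_nbhd compactZ zdZ oO Oz.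
by exists U; split=> //; exact: PO.
Qed.

Lemma small_apart z h h' : h z <> h' z -> small z (fun Y => apart Y h h').
Proof.
move=> /eqP /zdZ[U [cU Uz Uz']].
apply: (@smallW _ (fun Y => (forall y, Y y -> U (h y)) /\
                            (forall y, Y y -> (~` U) (h' y)))).
  by move=> Y _ [YU YU'] y y' /YU Uy /YU' /=; congruence.
apply: smallI; apply: small_image_sub => //; first by case: cU.
by have [_] := cU; exact: closed_openC.
Qed.

Lemma small_scattered z (l : seq (homeo Z)) : uniq [seq (h : homeo Z) z | h <- l] ->
  small z (fun Y => scattered Y l).
Proof.
elim: l => [_|h l IH /= /andP[hl /IH{}IH]]; first by exists setT; split=> //; exact: openT.
apply: smallI => //; elim: l hl {IH} => [|h' l IH] /=.
  by exists setT; split=> //; exact: openT.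
rewrite inE negb_or => /andP[/eqP hh' hl].
by apply: smallI; [exact: small_apart | exact: IH].
Qed.

End Small.

(** * Full groups and local alternating groups *)
Section FullGroups.
Local Open Scope classical_set_scope.
Local Open Scope group_scope.
Variables (cG : groupType) (Z : topologicalType) (a : action cG Z).
Hypothesis homeo_a : by_homeomorphisms a.
Implicit Types (A B D O U V Y W : set Z) (z : Z) (g : cG) (b c d h k t : homeo Z).

Definition to_homeo g : homeo Z := Homeo (asboolT (homeo_a g)).
Local Notation hh := to_homeo.
Local Notation FG := (topological_full_group a).
Local Notation support := Defs.support.

Lemma to_homeoM g g' : hh (g * g') = hh g * hh g'.
Proof. by apply: homeo_ext => z; exact: actM. Qed.

Lemma to_homeo1 : hh 1 = 1.
Proof. by apply: homeo_ext => z; exact: act1. Qed.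

Lemma full_subgroup : is_subgroup FG.
Proof.
split=> [z|h k Fh Fk z|h Fh z].
- by exists setT, 1; split=> // [|y _]; [exact: clopenT | rewrite act1].
- have [U [g [cU Uz Ug]]] := Fk z; have [V [g' [cV Vz Vg]]] := Fh (k z).
  exists (U `&` k @^-1` V), (g' * g); split=> //.
    by apply: clopenI => //; exact: clopen_preimage.
  by move=> y [Uy Vy]; rewrite homeoME Vg // Ug // actM.
- have [U [g [cU Uz Ug]]] := Fh (h^-1 z).
  exists ((h^-1)%g @^-1` U), g^-1; split=> //; first exact: clopen_preimage.
  by move=> y Uy; rewrite -{2}[y](hVK h) Ug // actK.
Qed.

Lemma full1 : FG 1. Proof. by case: full_subgroup. Qed.
Lemma fullM h k : FG h -> FG k -> FG (h * k).
Proof. by case: full_subgroup => _ H _; exact: H. Qed.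
Lemma fullV h : FG h -> FG h^-1.
Proof. by case: full_subgroup => _ _; apply. Qed.

Lemma full_hh g : FG (hh g).
Proof. by move=> z; exists setT, g; split=> //; exact: clopenT. Qed.

Lemma full_germ h z : FG h -> exists g, h z = a g z /\
  small z (fun Y => forall y, Y y -> h y = a g y).
Proof.
move=> /(_ z)[U [g [[oU _] Uz Ug]]]; exists g; split; first exact: Ug.
by exists U; split=> // Y _ YU y /YU; exact: Ug.
Qed.

Lemma full_cyc b c d Y : FG b -> FG c -> FG d -> FG (cyc b c d Y).
Proof.
move=> Fb Fc Fd.
have [[cY sY]|/cyc_junk ->] := pselect (clopen Y /\ scattered Y [:: b; c; d]); last first.
  exact: full1.
have patch e f y : FG e -> FG f -> Y y -> (forall x, Y x -> cyc b c d Y (e x) = f x) ->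
    exists U g, [/\ clopen U, U (e y) & forall x, U x -> cyc b c d Y x = a g x].
  move=> Fe Ff Yy H; have [V [g [cV Vz Vg]]] := fullM Ff (fullV Fe) (e y).
  exists (e @` Y `&` V), g; split.
  - by apply: clopenI => //; exact: clopen_image.
  - by split=> //; exists y.
  - by move=> w [[x Yx <-] Vx]; rewrite H // -(Vg _ Vx) homeoME hK.
move=> z; have [[y Yy zy]|H] := cycle_cases b c d Y z.
  case: zy => [->|[->|->]].
  - by apply: (patch b c) => // x; exact: cyc_a.
  - by apply: (patch c d) => // x; exact: cyc_b.
  - by apply: (patch d b) => // x; exact: cyc_c.
exists (~` (b @` Y `|` c @` Y `|` d @` Y)), 1; split.
- apply: clopenC => //; apply: clopenU; [apply: clopenU |]; exact: clopen_image.
- by move=> [[|]|] [y Yy zy]; have [] := H _ Yy; rewrite zy.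
- move=> x nx; rewrite act1 cyc_out // => y Yy; split=> e; apply: nx.
  + by left; left; exists y.
  + by left; right; exists y.
  + by right; exists y.
Qed.

Lemma three_cycle_cyc b c d Y : FG b -> FG c -> FG d -> three_cycle a (cyc b c d Y).
Proof.
move=> Fb Fc Fd; have Ft : FG (cyc b c d Y) by exact: full_cyc.
have [[cY sY]|/cyc_junk e] := pselect (clopen Y /\ scattered Y [:: b; c; d]); last first.
  have s0 : support (1 : homeo Z) = set0 by rewrite -subset0 => z.
  rewrite e; split; [exact: full1 | | by rewrite s0; exact: clopen0|].
    by rewrite expg1n.
  exists (fun=> set0); split.
  - by move=> i; exact: clopen0.
  - by move=> i j _ _ [z []].
  - by rewrite s0 -subset0 => z [].
  - by move=> i; rewrite image_set0.
set t := cyc b c d Y in Ft *.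
have tb y : Y y -> t (b y) = c y := cyc_a cY sY (y := y).
have tc y : Y y -> t (c y) = d y := cyc_b cY sY (y := y).
have td y : Y y -> t (d y) = b y := cyc_c cY sY (y := y).
have tout := @cyc_out _ _ _ _ _ cY sY.
have suppE : support t = b @` Y `|` c @` Y `|` d @` Y.
  move: (sY) => [[bc [bd _]] [[cd _] _]].
  apply/seteqP; split=> z /=.
    move=> tz; apply: contrapT => H; apply: tz; apply: tout => y Yy.
    split=> e; apply: H.
    + by left; left; exists y.
    + by left; right; exists y.
    + by right; exists y.
  move=> [[|]|] [y Yy <-]; rewrite /support /= ?tb ?tc ?td //; apply/nesym.
  - exact: bc.
  - exact: cd.
  - by apply/nesym; exact: bd.
have t3 : t ^+ 3 = 1.
  apply: homeo_ext => z; rewrite !expgS expg0 mulg1 !homeoME homeo1E.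
  have [[y Yy zy]|H] := cycle_cases b c d Y z; last by rewrite !(tout _ H).
  by case: zy => [->|[->|->]]; rewrite ?(tb, tc, td) // ?(tb, tc, td) // ?(tb, tc, td).
split=> //.
  rewrite suppE; apply: clopenU; [apply: clopenU |]; exact: clopen_image.
pose U (i : 'I_3) := (nth b [:: b; c; d] i : homeo Z) @` Y.
exists U; split.
- by move=> i; exact: clopen_image.
- move: (sY) => [[bc [bd _]] [[cd _] _]].
  move=> [[|[|[|//]]] i3] [[|[|[|//]]] j3] _ _ [_ [/= [y Yy <-] [y' Yy' e]]];
    try exact: val_inj.
  + by case: (bc _ _ Yy Yy').
  + by case: (bd _ _ Yy Yy').
  + by case: (bc _ _ Yy' Yy).
  + by case: (cd _ _ Yy Yy').
  + by case: (bd _ _ Yy' Yy).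
  + by case: (cd _ _ Yy' Yy).
- rewrite suppE; apply/seteqP; split=> z.
    by move=> [[[|[|[|//]]] i3] _ Uz]; [left; left|left; right|right].
  move=> [[|] Uz|Uz]; [exists (inord 0)|exists (inord 1)|exists (inord 2)] => //;
    by rewrite /U inordK.
- have im e f : (forall y, Y y -> t (e y) = f y) -> t @` (e @` Y) = f @` Y.
    move=> H; apply/seteqP; split=> z.
      by move=> [_ [y Yy <-] <-]; rewrite H //; exists y.
    by move=> [y Yy <-]; exists (e y); [exists y | exact: H].
  by move=> [[|[|[|//]]] i3]; apply: im.
Qed.

(** Every 3-cycle is some cyc, with its own powers as legs, so that it can be cut
    into pieces by shrinking the base. *)
Lemma three_cycle_eq t : three_cycle a t ->
  exists U, [/\ clopen U, scattered U [:: 1; t; t * t], t = cyc 1 t (t * t) U &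
    [/\ FG t, U `<=` support t, t @` U `<=` support t & (t * t)%g @` U `<=` support t]].
Proof.
move=> [Ft t3 _ [U [cU tU UE imU]]].
have t3E z : t (t (t z)) = z.
  by have /(congr1 (fun h : homeo Z => h z)) := t3; rewrite !expgS expg0 mulg1.
pose i0 : 'I_3 := inord 0; pose i1 := ordS i0; pose i2 := ordS i1.
have v0 : val i0 = 0%N by rewrite /= inordK.
have v1 : val i1 = 1%N by rewrite /= v0.
have v2 : val i2 = 2%N by rewrite /= v0.
have dis i j z : U i z -> U j z -> i = j.
  by move=> Ui Uj; apply: (tU i j) => //; exists z.
have t0 z : U i0 z -> U i1 (t z) by move=> Uz; rewrite /i1 -imU; exists z.
have t1 z : U i1 z -> U i2 (t z) by move=> Uz; rewrite /i2 -imU; exists z.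
have sep : scattered (U i0) [:: 1; t; t * t].
  do !split=> //; move=> y y' Uy Uy'; rewrite ?homeo1E ?homeoME => e.
  - have := t0 _ Uy'; rewrite -e => /(dis _ _ _ Uy)/(congr1 val).
    by rewrite v0 v1.
  - have := t1 _ (t0 _ Uy'); rewrite -e => /(dis _ _ _ Uy)/(congr1 val).
    by rewrite v0 v2.
  - have := t1 _ (t0 _ Uy'); rewrite -e => /(dis _ _ _ (t0 _ Uy))/(congr1 val).
    by rewrite v1 v2.
have sub i : U i `<=` support t by move=> z Uz; rewrite -UE; exists i.
exists (U i0); split=> //.
- apply: cyc_eq => //; split=> [y Uy|z H]; first by rewrite !homeoME t3E.
  apply: contrapT => tz; have : support t z by [].
  rewrite -UE => -[[[|[|[|//]]] i3] _ Uz].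
  + have e : Ordinal i3 = i0 by apply: val_inj; rewrite v0.
    by rewrite e in Uz; have [] := H _ Uz.
  + have e : Ordinal i3 = i1 by apply: val_inj; rewrite v1.
    rewrite e /i1 -imU in Uz; case: Uz => y Uy yz.
    by have [_ + _] := H _ Uy; rewrite yz.
  + have e : Ordinal i3 = i2 by apply: val_inj; rewrite v2.
    rewrite e /i2 -imU /i1 -imU in Uz; case: Uz => _ [y Uy <-] yz.
    by have [_ _] := H _ Uy; rewrite homeoME yz.
- split=> //.
  + by move=> _ [y /t0 Uy <-]; exact: (sub i1).
  + by move=> _ [y /t0/t1 Uy <-]; exact: (sub i2).
Qed.

Lemma full_alternating h : alternating_full_set a h -> FG h.
Proof. by apply: subgroup_generated_min; [exact: full_subgroup | move=> t []]. Qed.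

Definition alt_on V : set (homeo Z) :=
  subgroup_generated [set h | three_cycle a h /\ support h `<=` V].

Lemma alt_on_subgroup V : is_subgroup (alt_on V).
Proof. exact: subgroup_generatedP. Qed.

Lemma alt_on1 V : alt_on V 1. Proof. by case: (alt_on_subgroup V). Qed.
Lemma alt_onM V h k : alt_on V h -> alt_on V k -> alt_on V (h * k).
Proof. by case: (alt_on_subgroup V) => _ H _; exact: H. Qed.
Lemma alt_onV V h : alt_on V h -> alt_on V h^-1.
Proof. by case: (alt_on_subgroup V) => _ _; apply. Qed.

Lemma alt_onS V W : V `<=` W -> alt_on V `<=` alt_on W.
Proof.
move=> VW; apply: subgroup_generated_min; first exact: alt_on_subgroup.
by move=> h [th /subset_trans sh]; apply: sub_subgroup_generated; split=> //; exact: sh.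
Qed.

Lemma alt_on_alternating V : alt_on V `<=` alternating_full_set a.
Proof.
apply: subgroup_generated_min; first exact: subgroup_generatedP.
by move=> h [th _]; exact: sub_subgroup_generated.
Qed.

Lemma alt_on_out V h z : alt_on V h -> ~ V z -> h z = z.
Proof.
move=> Ah nVz; suff /(_ _ Ah) : alt_on V `<=` [set h : homeo Z | h z = z] by [].
apply: subgroup_generated_min.
  split=> [//|x y /= xz yz|x /= xz].
    by have : x (y z) = z by rewrite yz.
  by have := hK x z; rewrite xz.
by move=> t [_ st] /=; apply: contrapT => /st.
Qed.

Lemma alt_on_in V h z : alt_on V h -> V z -> V (h z).
Proof.
move=> Ah Vz; apply: contrapT => nV.
have := alt_on_out (alt_onV Ah) nV; rewrite hK => e.
by apply: nV; rewrite -e.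
Qed.

Lemma three_cycle_alt_on t V : three_cycle a t -> support t `<=` V -> alt_on V t.
Proof. by move=> tt tV; exact: sub_subgroup_generated. Qed.

Lemma support_cyc b c d Y V : (forall y, Y y -> [/\ V (b y), V (c y) & V (d y)]) ->
  support (cyc b c d Y) `<=` V.
Proof. by move=> H z sz; apply: contrapT => nVz; apply: sz; exact: cyc_fix_outside nVz. Qed.

Lemma alt_on_cyc b c d Y V : FG b -> FG c -> FG d ->
  (forall y, Y y -> [/\ V (b y), V (c y) & V (d y)]) -> alt_on V (cyc b c d Y).
Proof.
move=> Fb Fc Fd H; apply: three_cycle_alt_on; first exact: three_cycle_cyc.
exact: support_cyc.
Qed.

Lemma three_cycle_conj t k : FG k -> three_cycle a t -> three_cycle a (k * t * k^-1).
Proof.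
move=> Fk /three_cycle_eq[U [cU sU tE [Ft _ _ _]]].
rewrite tE cyc_conj //; apply: three_cycle_cyc; apply: fullM => //.
- exact: full1.
- exact: fullM.
Qed.

Lemma support_conj t k : support (k * t * k^-1) = k @` support t.
Proof.
rewrite homeo_imageE; apply/seteqP; split=> z; rewrite /support /= => H e; apply: H.
  by rewrite e hVK.
by apply: (@homeo_inj _ k); rewrite e hVK.
Qed.

Lemma alt_on_conj k V h : FG k -> alt_on V h -> alt_on (k @` V) (k * h * k^-1).
Proof.
move=> Fk; have [A1 AM AV] := alt_on_subgroup (k @` V).
move=> Ah; suff /(_ _ Ah) : alt_on V `<=` [set h | alt_on (k @` V) (k * h * k^-1)] by [].
apply: subgroup_generated_min.
  split=> [|x y /= xA yA|x /= xA]; first by rewrite /= mulg1 mulgV.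
    by have := AM _ _ xA yA; rewrite -!mulgA mulKg.
  by have := AV _ xA; rewrite !invgM invgK mulgA.
move=> t [tt st]; apply: three_cycle_alt_on; first exact: three_cycle_conj.
by rewrite support_conj => _ [z /st Vz <-]; exists z.
Qed.

Lemma commute_disjoint h k U V : (forall z, ~ U z -> h z = z) ->
  (forall z, ~ V z -> k z = z) -> U `&` V = set0 -> h * k = k * h.
Proof.
move=> hU kV UV; apply: homeo_ext => z; rewrite !homeoME.
have stab (f : homeo Z) W y : (forall z, ~ W z -> f z = z) -> W y -> W (f y).
  move=> fW Wy; apply: contrapT => nW.
  by have /homeo_inj e := fW _ nW; apply: nW; rewrite e.
have [Uz|nUz] := pselect (U z).
  have nV y : U y -> ~ V y by move=> Uy Vy; have : set0 y by rewrite -UV.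
  rewrite (kV z); last exact: nV.
  by rewrite kV //; apply: nV; exact: stab.
rewrite (hU z) //; have [Vz|nVz] := pselect (V z); last by rewrite !(kV z) ?hU.
rewrite hU // => Ukz; have : set0 (k z) by rewrite -UV; split=> //; exact: stab.
by [].
Qed.

Lemma alt_on_commute h k U V : alt_on U h -> alt_on V k -> U `&` V = set0 ->
  h * k = k * h.
Proof.
move=> Ah Ak; apply: commute_disjoint => z; exact: alt_on_out.
Qed.

Section Minimal.
Hypothesis compactZ : compact [set: Z].
Hypothesis zdZ : zero_dimensional Z.
Hypothesis hsZ : hausdorff_space Z.
Hypothesis perfectZ : perfect_set [set: Z].
Hypothesis minimal_a : minimal_action a.

Lemma open_minus_seq O (l : seq Z) : open O -> open [set z | O z /\ z \notin l].
Proof.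
move=> oO; elim: l => [|x l IH].
  suff -> : [set z | O z /\ z \notin [::]] = O by [].
  by apply/seteqP; split=> z // [].
suff -> : [set z | O z /\ z \notin x :: l] = [set z | O z /\ z \notin l] `&` ~` [set x].
  apply: openI => //; apply: closed_openC; exact: (accessible_closed_set1 (hausdorff_accessible hsZ)).
apply/seteqP; split=> z /=; rewrite inE negb_or.
  by move=> [Oz /andP[/eqP zx zl]].
by move=> [[Oz zl] zx]; split=> //; rewrite zl andbT; apply/eqP.
Qed.

Lemma open_infinite O z (l : seq Z) : open O -> O z -> exists2 z', O z' & z' \notin l.
Proof.
move=> oO Oz; have [zl|nzl] := boolP (z \in l); last by exists z.
have : limit_point [set: Z] z by have [_ ->] := perfectZ.
set O' := [set x | O x /\ x \notin [seq y <- l | y != z]].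
have oO' : open O' by exact: open_minus_seq.
have O'z : O' z by split=> //; rewrite mem_filter eqxx.
move=> /(_ O' (open_nbhs_nbhs (conj oO' O'z)))[x [xz _ [Ox]]].
by rewrite mem_filter xz /= => xl; exists x.
Qed.

(** A dense orbit in a perfect space meets an open set in infinitely many
    points. *)
Lemma orbit_meets z O z0 (l : seq Z) : open O -> O z0 ->
  exists2 g, O (a g z) & a g z \notin l.
Proof.
move=> oO Oz0; have [z' Oz' z'l] := open_infinite l oO Oz0.
have [|x [[Ox xl] [g _ gx]]] := minimal_a z _ (open_minus_seq l oO).
  by exists z'.
by exists g; rewrite gx.
Qed.

(** A 3-cycle (1 g g') over a small neighbourhood of q, where g q is in O and both
    g q and g' q are away from E. *)
Lemma move_point V q O z0 (E : seq Z) : clopen V -> V q -> q \notin E ->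
  open O -> O z0 -> O `<=` V ->
  exists h, [/\ alt_on V h, O (h q) & forall e, e \in E -> h e = e].
Proof.
move=> cV Vq qE oO Oz0 OV; have [oV _] := cV.
have [g Og] := orbit_meets q (q :: E) oO Oz0.
rewrite inE negb_or => /andP[gq gE].
have [g' Vg'] := orbit_meets q [:: q, a g q & E] oV Vq.
rewrite !inE !negb_or => /andP[g'q /andP[g'g g'E]].
have oE : open [set z | V z /\ z \notin E] by exact: open_minus_seq.
have [Y [cY Yq [sY [Y1 [Yg Yg']]]]] : exists Y, [/\ clopen Y, Y q &
    scattered Y [:: 1; hh g; hh g'] /\ (forall y, Y y -> V ((1 : homeo Z) y) /\ (1 : homeo Z) y \notin E) /\
    (forall y, Y y -> V (hh g y) /\ hh g y \notin E) /\
    (forall y, Y y -> V (hh g' y) /\ hh g' y \notin E)].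
  apply: small_ex => //; apply: smallI.
    apply: small_scattered => //=.
    by rewrite !inE negb_or ![q == _]eq_sym gq g'q eq_sym g'g.
  apply: smallI; first exact: (@small_image_sub _ _ 1 _ oE).
  by apply: smallI; apply: (small_image_sub oE); split=> //; exact: OV.
exists (cyc 1 (hh g) (hh g') Y); split.
- apply: alt_on_cyc; [exact: full1|exact: full_hh|exact: full_hh|].
  by move=> y Yy; split; [exact: (Y1 _ Yy).1|exact: (Yg _ Yy).1|exact: (Yg' _ Yy).1].
- by rewrite -[q]homeo1E cyc_a.
- move=> e eE; apply: cyc_out => // y Yy; split=> ee.
  + by have [_] := Y1 _ Yy; rewrite -ee eE.
  + by have [_] := Yg _ Yy; rewrite -ee eE.
  + by have [_] := Yg' _ Yy; rewrite -ee eE.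
Qed.

(** Points are moved to their targets one after the other, each move fixing the
    points already placed and those still to be moved. *)
Lemma transport V (l : seq (Z * set Z)) (E : seq Z) : clopen V ->
  uniq (map fst l ++ E) ->
  (forall p, p \in l -> [/\ V p.1, open p.2, p.2 `<=` V & exists z, p.2 z]) ->
  exists h, [/\ alt_on V h, forall p, p \in l -> p.2 (h p.1) &
                forall e, e \in E -> h e = e].
Proof.
move=> cV; elim: l E => [|[q O] l IH] E /=.
  by move=> _ _; exists 1; split=> //; exact: alt_on1.
move=> /andP[qlE ulE] H.
have [|p pl|h [Ah hl hE]] := IH (q :: E).
- move: ulE qlE; rewrite !cat_uniq mem_cat negb_or /= => /and3P[-> hlE ->] /andP[ql qE].
  by rewrite negb_or ql hlE qE.
- by apply: H; rewrite inE pl orbT.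
have [/= Vq oO OV [z0 Oz0]] := H _ (mem_head _ _).
have hq : h q = q by apply: hE; rewrite mem_head.
have [|k [Ak Okq kE]] := @move_point V q O z0 (E ++ [seq h p.1 | p <- l]) cV Vq _ oO Oz0 OV.
  move: qlE; rewrite !mem_cat !negb_or => /andP[ql ->] /=.
  apply: contra ql => /mapP[p pl]; rewrite -{1}hq => /homeo_inj ->.
  exact: map_f.
exists (k * h); split.
- exact: alt_onM.
- move=> p; rewrite inE => /predU1P[->|pl] /=; first by rewrite hq.
  by rewrite kE; [exact: hl | rewrite mem_cat (map_f (fun p => h p.1)) ?orbT].
- move=> e eE; rewrite homeoME hE ?inE ?eE ?orbT //.
  by apply: kE; rewrite mem_cat eE.
Qed.

(** Inside D, the alternating group realizes every germ of the action, also at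
    the points that the germ fixes: there a detour through a third point is
    needed, whence the two 3-cycles. *)
Lemma realize_germ D g z : clopen D -> D z -> D (a g z) ->
  exists h, alt_on D h /\ small z (fun Y => forall y, Y y -> h y = a g y).
Proof.
move=> cD Dz Dgz; have [oD _] := cD.
have [f Df] := orbit_meets z [:: z; a g z] oD Dz.
rewrite !inE !negb_or => /andP[fz fgz].
have [f' Df'] := orbit_meets z [:: z; a g z; a f z] oD Dz.
rewrite !inE !negb_or => /and3P[f'z f'gz f'f].
have [Y [cY Yz [s1 [s2 [D1 [D2 [D3 D4]]]]]]] : exists Y, [/\ clopen Y, Y z &
    scattered Y [:: 1; hh f; hh f'] /\ scattered Y [:: hh f; hh g; hh f'] /\
    (forall y, Y y -> D ((1 : homeo Z) y)) /\ (forall y, Y y -> D (hh g y)) /\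
    (forall y, Y y -> D (hh f y)) /\ (forall y, Y y -> D (hh f' y))].
  apply: small_ex => //; apply: smallI.
    apply: small_scattered => //=.
    by rewrite !inE negb_or ![z == _]eq_sym fz f'z eq_sym f'f.
  apply: smallI.
    apply: small_scattered => //=.
    by rewrite !inE negb_or fgz ![_ == a f' z]eq_sym f'f f'gz.
  by do 3 (apply: smallI; first by apply: small_image_sub); exact: small_image_sub.
exists (cyc (hh f) (hh g) (hh f') Y * cyc 1 (hh f) (hh f') Y); split.
  apply: alt_onM; apply: alt_on_cyc;
    by [exact: full_hh | exact: full1 | move=> y Yy; split; auto].
exists Y; split=> //; first by case: cY.
by move=> W _ WY y /WY Yy; rewrite homeoME -{1}[y]homeo1E cyc_a // cyc_a.
Qed.

End Minimal.
End FullGroups.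

(** * Finite generation of the alternating full group *)
Ltac split_ands := repeat match goal with
  | H : is_true (_ && _) |- _ =>
    let H1 := fresh in let H2 := fresh in case/andP: H => H1 H2
  end.

Ltac solve_uniq := rewrite /= ?inE ?negb_or ?andbT;
  repeat (apply/andP; split); first [assumption | by rewrite eq_sym].

Section FiniteGeneration.
Local Open Scope classical_set_scope.
Local Open Scope group_scope.
Local Notation ball := Defs.ball.

Section SubgroupTools.
Variables (Z : topologicalType) (N : set (homeo Z)).
Hypothesis sN : is_subgroup N.
Implicit Types (x e b c d : homeo Z) (Y W : set Z).

(** Moving the three legs one after the other, with the spare leg e4. *)
Lemma cyc_replace3 x1 x2 x3 e1 e2 e3 e4 Y W : clopen Y -> clopen W -> Y `<=` W ->
  scattered W [:: e1; e2; e3; e4] -> scattered W [:: x1; x2; x3] ->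
  apart_from W x1 [:: e1; e2; e3; e4] -> apart_from W x2 [:: e1; e2; e3; e4] ->
  apart_from W x3 [:: e1; e2; e3; e4] ->
  N (cyc x1 e1 e4 W) -> N (cyc x2 e2 e4 W) -> N (cyc x3 e3 e4 W) ->
  N (cyc e1 e2 e3 Y) -> N (cyc x1 x2 x3 Y).
Proof.
move=> cY cW YW [[e12 [e13 [e14 _]]] [[e23 [e24 _]] [[e34 _] _]]]
  [[x12 [x13 _]] [[x23 _] _]] [x1e1 [x1e2 [x1e3 [x1e4 _]]]]
  [x2e1 [x2e2 [x2e3 [x2e4 _]]]] [x3e1 [x3e2 [x3e3 [x3e4 _]]]] N1 N2 N3 N0.
have {}N0 : N (cyc x1 e2 e3 Y).
  apply: (@cyc_replace _ N x1 e1 e4 e2 e3 Y W) => //.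
  by do !split=> //; exact: apart_sym.
rewrite -cyc_rot // in N0; last by apply: (scattered_sub YW); do !split.
have {}N0 : N (cyc x2 e3 x1 Y).
  apply: (@cyc_replace _ N x2 e2 e4 e3 x1 Y W) => //.
  by do !split=> //; exact: apart_sym.
rewrite -cyc_rot // in N0; last first.
  by apply: (scattered_sub YW); do !split=> //; exact: apart_sym.
have {}N0 : N (cyc x3 x1 x2 Y).
  apply: (@cyc_replace _ N x3 e3 e4 x1 x2 Y W) => //.
  by do !split=> //; exact: apart_sym.
rewrite (@cyc_rot _ x3) //.
by apply: (scattered_sub YW); do !split=> //; exact: apart_sym.
Qed.

Lemma cyc_partition b c d U k (u : Z -> nat) : clopen U -> scattered U [:: b; c; d] ->
  (forall z, u z < k)%N -> (forall i, clopen (u @^-1` [set i])) ->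
  (forall i, N (cyc b c d (U `&` u @^-1` [set i]))) -> N (cyc b c d U).
Proof.
have [N1 NM NV] := sN; move=> cU sU uk cu Nu.
have H n : clopen (U `&` [set z | u z < n]%N) /\ N (cyc b c d (U `&` [set z | u z < n]%N)).
  elim: n => [|n [cn Nn]].
    have -> : U `&` [set z | u z < 0]%N = set0 by rewrite -subset0 => z [].
    by rewrite cyc0; split=> //; exact: clopen0.
  have -> : U `&` [set z | u z < n.+1]%N =
      (U `&` [set z | u z < n]%N) `|` (U `&` u @^-1` [set n]).
    rewrite -setIUr; congr (_ `&` _); apply/seteqP; split=> z /=.
      by rewrite ltnS leq_eqVlt => /predU1P[|]; auto.
    by move=> [/ltnW|->]; rewrite ltnS.
  have cUn : clopen (U `&` u @^-1` [set n]) by exact: clopenI.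
  split; first exact: clopenU.
  rewrite cyc_union //; first exact: NM.
    by rewrite -subset0 => z [[_ /= un] [_ /= e]]; move: un; rewrite e ltnn.
  by apply: (scattered_sub _ sU) => z [[]|[]].
suff -> : U = U `&` [set z | u z < k]%N by have [] := H k.
by apply/seteqP; split=> [z Uz|z []//]; split=> //; exact: uk.
Qed.

End SubgroupTools.

Variables (cG : groupType) (Z : topologicalType) (a : action cG Z) (S : seq cG).
Hypothesis genS : symmetric_generating_set S.
Hypothesis homeo_a : by_homeomorphisms a.
Hypothesis compactZ : compact [set: Z].
Hypothesis zdZ : zero_dimensional Z.
Hypothesis hsZ : hausdorff_space Z.
Hypothesis perfectZ : perfect_set [set: Z].
Hypothesis minimal_a : minimal_action a.
Hypothesis expansive_a : expansive_action a.
Variable z0 : Z.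
Local Notation hh := (to_homeo homeo_a).
Local Notation FG := (topological_full_group a).
Implicit Types (A B D O U V Y W : set Z) (z : Z) (g e q : cG) (h : homeo Z).

Lemma small_all (T : eqType) (l : seq T) (P : T -> set Z -> Prop) z :
  (forall x, x \in l -> small z (P x)) -> small z (fun Y => forall x, x \in l -> P x Y).
Proof.
elim: l => [_|x l IH H]; first by exists setT; split=> //; exact: openT.
have sl : small z (fun Y => forall x, x \in l -> P x Y).
  by apply: IH => y yl; apply: H; rewrite inE yl orbT.
have sx : small z (P x) by apply: H; rewrite mem_head.
apply: smallW (smallI sx sl) => Y _ [Px Pl] y.
by rewrite inE => /predU1P[->|/Pl].
Qed.

(** The partition of a subshift by the letter at 1: since the translates of a
    configuration carry each of its letters to 1, the partition separates points
    along orbits. *)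
Lemma generating_partition : exists k (c : Z -> nat), [/\ forall z, (c z < k)%N,
  forall i, clopen (c @^-1` [set i]) &
  forall z z', z <> z' -> exists g, c (a g z) <> c (a g z')].
Proof.
have [d [Y [_ _ [phi [psi [[cphi _] _ [phiK _] phiE]]]]]] := expansive_a.
exists d, (fun z => val (phi z 1 : 'I_d)); split.
- by move=> z; exact: ltn_ord.
- move=> i.
  have -> : (fun z => val (phi z 1 : 'I_d)) @^-1` [set i] =
      (fun z => phi z 1 : discrete_topology 'I_d) @^-1` [set x : 'I_d | val x = i].
    by apply/seteqP; split.
  apply: preimage_clopen.
    by split; [exact: discrete_open | exact: discrete_closed].
  move=> z.
  apply: (@continuous_comp _ _ _ phi (fun x : full_shift cG d => x 1)).
    exact: cphi.
  exact: (@proj_continuous cG (fun=> discrete_topology 'I_d) 1).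
- move=> z z' zz'; apply: contrapT => H; apply: zz'; rewrite -(phiK z) -(phiK z').
  congr psi; apply/funext => h; apply: val_inj => /=; apply: contrapT => e.
  apply: H; exists h^-1; rewrite !phiE /shift invgK mulg1; exact: e.
Qed.

(** Every point has at least 8 translates by E. The largest demand below is for 5
    translates that differ from 3 given points. *)
Definition rich (E : seq cG) := forall z (Q : seq Z), (size Q < 8)%N ->
  exists2 g, g \in E & a g z \notin Q.

Lemma rich_exists : exists E, [/\ rich E, 1 \in E & {subset S <= E}].
Proof.
suff [E rE] : exists E, rich E.
  exists (1 :: S ++ E); split=> [z Q /(rE z)[g gE gQ]||x xS].
  - by exists g => //; rewrite inE mem_cat gE !orbT.
  - by rewrite mem_head.
  - by rewrite inE mem_cat xS !orbT.
pose P (Y : set Z) := exists E : seq cG, forall z, Y z -> forall Q : seq Z,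
  (size Q < 8)%N -> exists2 g, g \in E & a g z \notin Q.
suff [E rE] : P setT by exists E => z; exact: rE.
apply: (clopen_ind compactZ zdZ (P := P)).
- by exists [::].
- move=> A B _ _ _ _ _ [E HE] [E' HE']; exists (E ++ E').
  by move=> z [Az|Bz] Q sQ; [have [g gE gQ] := HE _ Az _ sQ | have [g gE gQ] := HE' _ Bz _ sQ];
    exists g => //; rewrite mem_cat gE ?orbT.
- move=> z _.
  have [l [ul sl]] : exists l, uniq [seq a g z | g <- l] /\ size l = 8.
    elim: 8 => [|n [l [ul sl]]]; first by exists [::].
    have [g _ gl] := orbit_meets hsZ perfectZ minimal_a z [seq a g z | g <- l]
      (@openT Z) (I : [set: Z] z).
    by exists (g :: l); rewrite /= gl sl.
  have : small z (fun Y => scattered Y [seq hh g | g <- l]).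
    by apply: small_scattered => //; rewrite -map_comp.
  move=> [O [oO Oz sO]]; exists O; split=> // A cA AO _; exists l => y Ay Q sQ.
  have {}ul : uniq [seq a g y | g <- l].
    move: (sO _ cA AO); elim: l {ul sl sO} => //= g l IH [gl /IH ->]; rewrite andbT.
    elim: l gl {IH} => //= g' l IH [gg' /IH gl]; rewrite inE negb_or gl andbT.
    by apply/eqP; exact: gg'.
  (* Otherwise the 8 distinct translates of y all lie in Q. *)
  apply: contrapT => H.
  have : (size [seq a g y | g <- l] <= size Q)%N.
    apply: uniq_leq_size => // x /mapP[g gl ->]; apply/negPn/negP => gQ; apply: H.
    by exists g.
  by rewrite size_map sl leqNgt sQ.
- exact: clopenT.
Qed.

Lemma rich_pick E : rich E -> forall m z (Q : seq Z), (size Q + m <= 8)%N ->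
  exists l, [/\ size l = m, {subset l <= E}, uniq [seq a g z | g <- l] &
                forall g, g \in l -> a g z \notin Q].
Proof.
move=> rE; elim=> [|m IH] z Q sQ; first by exists [::].
have [|l [sl lE ul lQ]] := IH z Q; first by apply: leq_trans sQ; rewrite leq_add2l.
have [|g gE] := rE z (Q ++ [seq a g z | g <- l]).
  by rewrite size_cat size_map sl; rewrite addnS in sQ.
rewrite mem_cat negb_or => /andP[gQ gl]; exists (g :: l); split=> /=.
- by rewrite sl.
- by move=> x; rewrite inE => /predU1P[->|/lE].
- by rewrite gl.
- by move=> x; rewrite inE => /predU1P[->|/lQ].
Qed.

(** The generators are the 3-cycles with legs in E S over the sets that W_i and a
    translate of W_j have in common. Let N be the group that they generate. The
    3-cycles with legs in E over a clopen set are in N, for good sets; good sets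
    are stable under translation by generators, because the cells make it
    possible to cut a 3-cycle down and then to move its legs. *)
Section Generators.
Variables (E : seq cG).
Hypotheses (richE : rich E) (E1 : 1 \in E) (SE : {subset S <= E}).

Definition right_translates := [seq x * s | x <- E, s <- 1 :: S].

Lemma leg_mul_right_translate x s : x \in E -> s \in S -> x * s \in right_translates.
Proof. by move=> xE sS; apply: allpairs_f => //; rewrite inE sS orbT. Qed.

Lemma leg_right_translate x : x \in E -> x \in right_translates.
Proof. by move=> xE; rewrite -[x]mulg1; apply: allpairs_f => //; rewrite mem_head. Qed.

(** Five legs with disjoint translates of W, also disjoint from three given ones:
    three for a 3-cycle, and two spare ones for cyc_commutator, where the two
    3-cycles use five legs together; one of the spare legs also serves in
    cyc_replace3. *)
Definition roomy W := forall q1 q2 q3, q1 \in right_translates -> q2 \in right_translates -> q3 \in right_translates ->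
  exists l, [/\ size l = 5, {subset l <= E}, scattered W [seq hh e | e <- l] &
    [/\ apart_from W (hh q1) [seq hh e | e <- l],
        apart_from W (hh q2) [seq hh e | e <- l] &
        apart_from W (hh q3) [seq hh e | e <- l]]].

Lemma small_apart_from z q l : (forall e, e \in l -> a e z <> a q z) ->
  small z (fun Y => apart_from Y (hh q) [seq hh e | e <- l]).
Proof.
elim: l => [_|e l IH H] /=; first by exists setT; split=> //; exact: openT.
apply: smallI; last by apply: IH => x xl; apply: H; rewrite inE xl orbT.
by apply: small_apart => //; apply/nesym/H; rewrite mem_head.
Qed.

Lemma small_roomy z : small z roomy.
Proof.
suff : small z (fun Y => forall q : (cG * cG * cG)%type, q \in [seq (x, y) | x <- [seq (x, y) | x <- right_translates, y <- right_translates], y <- right_translates] ->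
    exists l, [/\ size l = 5, {subset l <= E}, scattered Y [seq hh e | e <- l] &
    [/\ apart_from Y (hh q.1.1) [seq hh e | e <- l],
        apart_from Y (hh q.1.2) [seq hh e | e <- l] &
        apart_from Y (hh q.2) [seq hh e | e <- l]]]).
  apply: smallW => Y _ H q1 q2 q3 h1 h2 h3.
  by apply: (H (q1, q2, q3)); apply: allpairs_f => //; exact: allpairs_f.
apply: small_all => -[[q1 q2] q3] _ /=.
have [//|l [sl lE ul lQ]] := @rich_pick E richE 5 z [:: a q1 z; a q2 z; a q3 z].
have s0 : small z (fun Y => scattered Y [seq hh e | e <- l]).
  by apply: small_scattered => //; rewrite -map_comp.
have sq q : q \in [:: q1; q2; q3] ->
    small z (fun Y => apart_from Y (hh q) [seq hh e | e <- l]).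
  move=> qq; apply: small_apart_from => e el eq; move: (lQ _ el); rewrite eq.
  by rewrite (map_f (fun q => a q z) qq).
have s1 := sq q1 ltac:(by rewrite !inE eqxx).
have s2 := sq q2 ltac:(by rewrite !inE eqxx orbT).
have s3 := sq q3 ltac:(by rewrite !inE eqxx !orbT).
apply: smallW (smallI s0 (smallI s1 (smallI s2 s3))) => Y _ [? [? [? ?]]].
by exists l.
Qed.

Variables (kW : nat) (cW : Z -> nat).
Local Notation W i := (cW @^-1` [set i]).
Hypotheses (cWk : forall z, (cW z < kW)%N) (clW : forall i, clopen (W i))
  (roomyW : forall i, roomy (W i))
  (genW : forall z z', z <> z' -> exists g, cW (a g z) <> cW (a g z')).

(** The sets W_i `&` s^-1 W_j; s = 1 gives W_i itself. *)
Definition cells : seq (set Z) :=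
  [seq W ij.1.1 `&` (hh ij.2 : Z -> Z) @^-1` W ij.1.2 |
    ij <- [seq (x, s) | x <- [seq (i, j) | i <- iota 0 kW, j <- iota 0 kW], s <- 1 :: S]].

Definition cell_cycles : seq (homeo Z) :=
  [seq cyc (hh t.1.1) (hh t.1.2) (hh t.2) V |
    t <- [seq (x, d) | x <- [seq (b, c) | b <- right_translates, c <- right_translates], d <- right_translates], V <- cells].

Definition cell_cycle_group := subgroup_generated [set` cell_cycles].
Local Notation N := cell_cycle_group.

Let sN : is_subgroup N := subgroup_generatedP _.

Lemma cell_cycles_alternating h : h \in cell_cycles -> alternating_full_set a h.
Proof.
move=> /allpairsP[[t V] /= [_ _ ->]]; apply: sub_subgroup_generated.
by apply: three_cycle_cyc; exact: full_hh.
Qed.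

Lemma cell_cycle_in_group b c d i j s : b \in right_translates -> c \in right_translates -> d \in right_translates -> s \in 1 :: S ->
  N (cyc (hh b) (hh c) (hh d) (W i `&` (hh s : Z -> Z) @^-1` W j)).
Proof.
move=> bE cE dE sS.
have N1 : N 1 by case: sN.
have [ik|ki] := ltnP i kW; last first.
  rewrite (_ : _ `&` _ = set0) ?cyc0 // -subset0 => z [/= e].
  by have := cWk z; rewrite e ltnNge ki.
have [jk|kj] := ltnP j kW; last first.
  rewrite (_ : _ `&` _ = set0) ?cyc0 // -subset0 => z [_ /= e].
  by have := cWk (a s z); rewrite e ltnNge kj.
apply: sub_subgroup_generated => /=.
apply/allpairsP; exists ((b, c, d), W i `&` (hh s : Z -> Z) @^-1` W j) => /=; split=> //.
  by apply: allpairs_f => //; exact: allpairs_f.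
apply/mapP; exists ((i, j), s) => //.
by apply: allpairs_f => //; apply: allpairs_f; rewrite mem_iota.
Qed.

(** Disjointness of the legs is asked of the whole cell W_i, not only of its part
    in Y, so that the condition does not change with Y. *)
Definition good Y := forall b c d i, b \in E -> c \in E -> d \in E ->
  scattered (W i) [:: hh b; hh c; hh d] ->
  N (cyc (hh b) (hh c) (hh d) (Y `&` W i)).

Lemma goodT : good setT.
Proof.
move=> b c d i bE cE dE _; rewrite setTI.
rewrite (_ : W i = W i `&` (hh 1 : Z -> Z) @^-1` W i).
  by apply: cell_cycle_in_group; rewrite ?leg_right_translate ?mem_head.
by apply/seteqP; split=> [z|z []//]; split=> //=; rewrite act1.
Qed.

(** Over a piece s(Y1 `&` W1) with Y1 = Y `&` W_i and W1 = W_i `&` s^-1 W_j, a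
    3-cycle with legs b, c, d is one over Y1 `&` W1 with legs b s, c s, d s. Take
    roomy legs e1, ..., e5 of W_i. The commutator of (e1 e2 e4) over Y1, available
    as Y is good, and (e1 e3 e5) over W1, a generator, is (e1 e2 e3) over
    Y1 `&` W1; generators over W1 then move its legs to b s, c s and d s. *)
Lemma good_image s Y : s \in S -> clopen Y -> good Y -> good (hh s @` Y).
Proof.
move=> sS cY gY b c d j bE cE dE sW.
have cU : clopen ((hh s @` Y) `&` W j) by apply: clopenI => //; exact: clopen_image.
have cV i : clopen ((hh s @` Y) `&` W j `&` hh s @` W i).
  by apply: clopenI => //; exact: clopen_image.
apply: (@cyc_partition _ N sN _ _ _ _ kW (fun z => cW (hh s^-1 z))) => //.
- by apply: scattered_sub sW => z [].
- by move=> i; exact: (@clopen_preimage _ (hh s^-1) (W i)).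
move=> i; pose Y1 := Y `&` W i; pose W1 := W i `&` (hh s : Z -> Z) @^-1` W j.
have -> : (hh s @` Y) `&` W j `&` (fun z => cW (hh s^-1 z)) @^-1` [set i] =
    hh s @` (Y1 `&` W1).
  apply/seteqP; split=> z.
    by move=> [[[y Yy <-] Wy]]; rewrite /= actK => yi; exists y.
  by move=> [y [[Yy yi] [_ yj]] <-] /=; rewrite actK; do !split=> //; exists y.
have cY1 : clopen Y1 by exact: clopenI.
have cW1 : clopen W1 by apply: clopenI => //; exact: clopen_preimage.
have sW1 : scattered W1 [:: hh (b * s); hh (c * s); hh (d * s)].
  have sub : hh s @` W1 `<=` W j by move=> _ [y [_ yj] <-].
  have [[bc [bd _]] [[cd _] _]] := scattered_sub sub sW.
  by rewrite !to_homeoM; do !split=> //; exact/apart_image.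
rewrite cyc_image; last first.
  - by apply: scattered_sub sW => _ [y [_ [_ yj]] <-].
  - exact: clopenI.
rewrite -!to_homeoM.
have [l [sl lE sl' [bl cl dl]]] := @roomyW i _ _ _ (leg_mul_right_translate bE sS) (leg_mul_right_translate cE sS) (leg_mul_right_translate dE sS).
case: l sl lE sl' bl cl dl => [|e1 [|e2 [|e3 [|e4 [|e5 [|//]]]]]] // _ lE sl bl cl dl.
have [e1E e2E e3E e4E e5E] : [/\ e1 \in E, e2 \in E, e3 \in E, e4 \in E & e5 \in E].
  by split; apply: lE; rewrite !inE eqxx ?orbT.
have W1W : W1 `<=` W i by move=> z [].
have sN' : s \in 1 :: S by rewrite inE sS orbT.
have cellN x y w : x \in right_translates -> y \in right_translates -> w \in right_translates -> N (cyc (hh x) (hh y) (hh w) W1).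
  by move=> xE yE wE; exact: cell_cycle_in_group.
have four V l' : apart_from V l' [seq hh e | e <- [:: e1; e2; e3; e4; e5]] ->
    apart_from V l' [seq hh e | e <- [:: e1; e2; e3; e4]].
  by move=> [? [? [? [? [? _]]]]].
apply: (@cyc_replace3 _ N sN _ _ _ (hh e1) (hh e2) (hh e3) (hh e4) _ W1) => //.
- exact: clopenI.
- by move: (scattered_sub W1W sl) => [[? [? [? [? _]]]] [[? [? [? _]]] [[? [? _]] [[? _] _]]]].
- exact/four/(apart_from_sub W1W).
- exact/four/(apart_from_sub W1W).
- exact/four/(apart_from_sub W1W).
- by apply: cellN; [exact: leg_mul_right_translate | exact: leg_right_translate | exact: leg_right_translate].
- by apply: cellN; [exact: leg_mul_right_translate | exact: leg_right_translate | exact: leg_right_translate].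
- by apply: cellN; [exact: leg_mul_right_translate | exact: leg_right_translate | exact: leg_right_translate].
have [N1 NM NV] := sN.
have Ny : N (cyc (hh e1) (hh e2) (hh e4) Y1).
  apply: gY => //.
  by move: sl => [[? [? [? [? _]]]] [[? [? [? _]]] [[? [? _]] [[? _] _]]]].
have Nw : N (cyc (hh e1) (hh e3) (hh e5) W1) by apply: cellN; exact: leg_right_translate.
rewrite -(@cyc_commutator _ _ _ _ (hh e4) (hh e5)) //.
  apply: (NM _ _); last exact: NV.
  by apply: (NM _ _); [exact: NM | exact: NV].
by apply: (scattered_sub _ sl) => z [[]|[]].
Qed.

Lemma good_translate g Y : clopen Y -> good Y -> good (hh g @` Y).
Proof.
have [n] := gen_ball genS g; elim: n g => [|n IH] g.
  move=> /ball0 -> _ gY.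
  suff -> : hh 1 @` Y = Y by [].
  by rewrite to_homeo1 image_id.
move=> /ballS[|[s [h [sS /IH{}IH ->]]]]; first exact: IH.
move=> cY gY; rewrite to_homeoM image_homeoM; apply: good_image => //.
  exact: clopen_image.
exact: IH.
Qed.

Lemma goodI Y i : good Y -> good (Y `&` W i).
Proof.
move=> gY b c d j bE cE dE sW.
have [ij|/eqP ij] := eqVneq i j.
  by rewrite -setIA -ij setIid; apply: gY; rewrite ?ij.
rewrite (_ : _ `&` _ = set0); first by rewrite cyc0; case: sN.
by rewrite -subset0 => z [[_ /= zi] /= zj]; apply: ij; rewrite -zi.
Qed.

(** Sets whose intersection with every good set is good form an algebra that
    contains the translates of the W_i, which separate points. *)
Lemma clopen_good Y : clopen Y -> good Y.
Proof.
move=> cY; have [N1 NM NV] := sN.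
suff /(_ _ clopenT goodT) : forall V, clopen V -> good V -> good (V `&` Y).
  by rewrite setTI.
pose P Y := clopen Y /\ forall V, clopen V -> good V -> good (V `&` Y).
suff [] : P Y by [].
apply: (clopen_algebra compactZ (P := P)) => //.
- by split=> [|V _]; [exact: clopenT | rewrite setIT].
- move=> A B [cA PA] [cB PB]; split; first exact: clopenI.
  move=> V cV gV; rewrite setIA; apply: PB; [exact: clopenI | exact: PA].
- move=> A [cA PA]; split; first exact: clopenC.
  move=> V cV gV b c d i bE cE dE sW.
  have VE : V `&` W i = (V `&` A `&` W i) `|` (V `&` ~` A `&` W i).
    by rewrite -setIUl -setIUr setUCr setIT.
  have sub X : X `&` W i `<=` W i by move=> z [].
  have NVi := gV _ _ _ _ bE cE dE sW.
  have NVA := PA _ cV gV _ _ _ _ bE cE dE sW.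
  move: NVi; rewrite {1}VE cyc_union.
  + by move=> /(NM _ _ (NV _ NVA)); rewrite mulKg.
  + by apply: clopenI => //; exact: clopenI.
  + by apply: clopenI => //; apply: clopenI => //; exact: clopenC.
  + by rewrite -subset0 => z [[[_ Az] _] [[_ nAz] _]].
  + by rewrite -VE; exact: scattered_sub sW.
- by move=> A [].
- move=> z z' /genW[g gz]; exists (hh g^-1 @` W (cW (a g z))); split.
  + have cA : clopen (hh g^-1 @` W (cW (a g z))) by exact: clopen_image.
    split=> // V cV gV.
    have -> : V `&` hh g^-1 @` W (cW (a g z)) =
              hh g^-1 @` (hh g @` V `&` W (cW (a g z))).
      apply/seteqP; split=> x.
        by move=> [Vx [y Wy yx]]; exists y => //; split=> //; exists x => //=; rewrite -yx /= actVK.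
      by move=> [y [[v Vv <-] Wy] <-]; split; [rewrite /= actK | exists (a g v)].
    apply: good_translate.
      by apply: clopenI => //; exact: clopen_image.
    by apply: goodI; exact: good_translate.
  + by exists (a g z) => //=; rewrite actK.
  + by move=> [y /= Wy yz']; apply: gz; rewrite -Wy -yz' actVK.
Qed.

(** Legs with distinct values at z need not have disjoint translates of the whole
    cell of z, so the 3-cycle is obtained from one with roomy legs. *)
Lemma small_N_E z b c d : b \in E -> c \in E -> d \in E ->
  uniq [:: a b z; a c z; a d z] -> small z (fun Y => N (cyc (hh b) (hh c) (hh d) Y)).
Proof.
move=> bE cE dE u.
have [l [sl lE sl' [bl cl dl]]] := @roomyW (cW z) _ _ _ (leg_right_translate bE) (leg_right_translate cE) (leg_right_translate dE).
case: l sl lE sl' bl cl dl => [|e1 [|e2 [|e3 [|e4 [|e5 [|//]]]]]] // _ lE sl bl cl dl.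
have [e1E e2E e3E e4E] : [/\ e1 \in E, e2 \in E, e3 \in E & e4 \in E].
  by split; apply: lE; rewrite !inE eqxx ?orbT.
have s1 : small z (fun Y => scattered Y [:: hh b; hh c; hh d]) by exact: small_scattered.
have s2 : small z (fun Y => Y `<=` W (cW z)) by apply: small_sub => //; case: (clW (cW z)).
apply: smallW (smallI s1 s2) => Y cY [sY YW].
have NY x y w : x \in E -> y \in E -> w \in E ->
    scattered (W (cW z)) [:: hh x; hh y; hh w] -> N (cyc (hh x) (hh y) (hh w) Y).
  by move=> xE yE wE s; have := clopen_good cY xE yE wE s; rewrite (setIidl YW).
move: sl => [[? [? [? [? _]]]] [[? [? [? _]]] [[? [? _]] [[? _] _]]]].
move: bl cl dl => [? [? [? [? _]]]] [? [? [? [? _]]]] [? [? [? [? _]]]].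
by apply: (@cyc_replace3 _ N sN _ _ _ (hh e1) (hh e2) (hh e3) (hh e4) _ Y) => //;
  first (by apply: (scattered_sub YW)); try (by apply: (apart_from_sub YW));
  apply: NY.
Qed.

(** Induction on the length of g = s g': at the point g' z, the elements s and 1
    are both in E, so short 3-cycles move the leg g' to s g'. *)
Lemma small_N_leg g z e e' : e \in E -> e' \in E ->
  uniq [:: a g z; a e z; a e' z] -> small z (fun Y => N (cyc (hh g) (hh e) (hh e') Y)).
Proof.
have [n] := gen_ball genS g; elim: n g z e e' => [|n IH] g z e e'.
  move=> /ball0 ->; exact: small_N_E.
move=> /ballS[|[s [g' [sS Bg' ->]]]]; first exact: IH.
rewrite actM => eE e'E u.
have [//|l [sl lE ul lQ]] := @rich_pick E richE 3 z
  [:: a g' z; a s (a g' z); a e z; a e' z].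
case: l sl lE ul lQ => [|e1 [|e2 [|e3 [|//]]]] // _ lE ul lQ.
have [e1E e2E e3E] : [/\ e1 \in E, e2 \in E & e3 \in E].
  by split; apply: lE; rewrite !inE eqxx ?orbT.
have [Q1 Q2 Q3] : [/\ a e1 z \notin [:: a g' z; a s (a g' z); a e z; a e' z],
    a e2 z \notin [:: a g' z; a s (a g' z); a e z; a e' z] &
    a e3 z \notin [:: a g' z; a s (a g' z); a e z; a e' z]].
  by split; apply: lQ; rewrite !inE eqxx ?orbT.
have [//|l [sl {}lE uf {}lQ]] := @rich_pick E richE 2 (a g' z)
  [:: a g' z; a s (a g' z); a e1 z; a e2 z].
case: l sl lE uf lQ => [|f [|f' [|//]]] // _ lE uf lQ.
have [fE f'E] : f \in E /\ f' \in E.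
  by split; apply: lE; rewrite !inE eqxx ?orbT.
have [F1 F2] : a f (a g' z) \notin [:: a g' z; a s (a g' z); a e1 z; a e2 z] /\
    a f' (a g' z) \notin [:: a g' z; a s (a g' z); a e1 z; a e2 z].
  by split; apply: lQ; rewrite !inE eqxx ?orbT.
have sE : s \in E by exact: SE.
move: u ul uf Q1 Q2 Q3 F1 F2; rewrite /= !inE !negb_or !andbT => u ul uf Q1 Q2 Q3 F1 F2.
split_ands.
(* Move the first leg from g' to s g' by way of f g', then the two other legs
   from e1 and e2 to e and e'. *)
have s1 : small z (fun Y => N (cyc (hh g') (hh e1) (hh e2) Y)) by apply: IH => //; solve_uniq.
have t2 : small z (fun Y => scattered Y [:: hh f * hh g'; hh g'; hh f' * hh g'; hh e1; hh e2]).
  by apply: small_scattered => //=; solve_uniq.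
have t3 : small z (fun Y => scattered Y
    [:: hh s * hh g'; hh f * hh g'; hh f' * hh g'; hh e1; hh e2]).
  by apply: small_scattered => //=; solve_uniq.
have t4 : small z (fun Y => scattered Y [:: hh e; hh e1; hh e3; hh e2; hh s * hh g']).
  by apply: small_scattered => //=; solve_uniq.
have t5 : small z (fun Y => scattered Y [:: hh e'; hh e2; hh e3; hh s * hh g'; hh e]).
  by apply: small_scattered => //=; solve_uniq.
have s2 : small z (fun Y => N (cyc (hh f) (hh 1) (hh f') (hh g' @` Y))).
  apply: (@small_image _ z (hh g') (fun Y => N (cyc (hh f) (hh 1) (hh f') Y))).
  by apply: small_N_E => //; rewrite act1; solve_uniq.
have s3 : small z (fun Y => N (cyc (hh s) (hh f) (hh f') (hh g' @` Y))).
  apply: (@small_image _ z (hh g') (fun Y => N (cyc (hh s) (hh f) (hh f') Y))).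
  by apply: small_N_E => //; solve_uniq.
have s4 : small z (fun Y => N (cyc (hh e) (hh e1) (hh e3) Y)).
  by apply: small_N_E => //; solve_uniq.
have s5 : small z (fun Y => N (cyc (hh e') (hh e2) (hh e3) Y)).
  by apply: small_N_E => //; solve_uniq.
apply: smallW (smallI s1 (smallI s2 (smallI s3 (smallI s4 (smallI s5
  (smallI t2 (smallI t3 (smallI t4 t5)))))))) => Y cY
  [N1 [N2 [N3 [N4 [N5 [T2 [T3 [T4 T5]]]]]]]].
rewrite to_homeoM.
have first3 x y w l' : scattered Y [:: x, y, w & l'] -> scattered Y [:: x; y; w].
  by move=> [[? [? _]] [[? _] _]].
have im x y w : scattered Y [:: x * hh g'; y * hh g'; w * hh g'] ->
    scattered (hh g' @` Y) [:: x; y; w].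
  by move=> [[? [? _]] [[? _] _]]; do !split=> //; exact/apart_image.
have {}N2 : N (cyc (hh f * hh g') (hh e1) (hh e2) Y).
  apply: (@cyc_replace _ N _ (hh g') (hh f' * hh g') _ _ Y Y) => //.
  move: N2; rewrite cyc_image // to_homeo1 ?mul1g //.
  by apply: im; rewrite mul1g; exact: first3 T2.
have {}N3 : N (cyc (hh s * hh g') (hh e1) (hh e2) Y).
  apply: (@cyc_replace _ N _ (hh f * hh g') (hh f' * hh g') _ _ Y Y) => //.
  by move: N3; rewrite cyc_image //; apply: im; exact: first3 T3.
have {}N3 : N (cyc (hh e1) (hh e2) (hh s * hh g') Y).
  by rewrite cyc_rot //; move: T3 => [[? [? [? [? _]]]] [_ [_ [[? _] _]]]]; do !split.
have {}N4 : N (cyc (hh e) (hh e2) (hh s * hh g') Y).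
  exact: (@cyc_replace _ N _ (hh e1) (hh e3) _ _ Y Y).
have {}N4 : N (cyc (hh e2) (hh s * hh g') (hh e) Y).
  by rewrite cyc_rot //; move: T4 => [[? [? [? [? _]]]] [_ [_ [[? _] _]]]]; do !split.
have {}N5 : N (cyc (hh e') (hh s * hh g') (hh e) Y).
  exact: (@cyc_replace _ N _ (hh e2) (hh e3) _ _ Y Y).
rewrite (@cyc_rot _ (hh e')) //.
by move: T5 => [[? [? [? [? _]]]] [_ [_ [[? _] _]]]]; do !split.
Qed.

Lemma small_N z b c d : uniq [:: a b z; a c z; a d z] ->
  small z (fun Y => N (cyc (hh b) (hh c) (hh d) Y)).
Proof.
move=> u.
have [//|l [sl lE ul lQ]] := @rich_pick E richE 4 z [:: a b z; a c z; a d z].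
case: l sl lE ul lQ => [|e1 [|e2 [|e3 [|e4 [|//]]]]] // _ lE ul lQ.
have [e1E e2E e3E e4E] : [/\ e1 \in E, e2 \in E, e3 \in E & e4 \in E].
  by split; apply: lE; rewrite !inE eqxx ?orbT.
have [Q1 Q2 Q3 Q4] : [/\ a e1 z \notin [:: a b z; a c z; a d z],
    a e2 z \notin [:: a b z; a c z; a d z], a e3 z \notin [:: a b z; a c z; a d z] &
    a e4 z \notin [:: a b z; a c z; a d z]].
  by split; apply: lQ; rewrite !inE eqxx ?orbT.
move: u ul Q1 Q2 Q3 Q4; rewrite /= !inE !negb_or !andbT => u ul Q1 Q2 Q3 Q4.
split_ands.
have sc x : x \in [:: b; c; d] -> uniq [:: a x z; a e1 z; a e2 z; a e3 z; a e4 z] ->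
    small z (fun Y => apart_from Y (hh x) [:: hh e1; hh e2; hh e3; hh e4]).
  move=> _ ux.
  have : small z (fun Y => scattered Y [:: hh x; hh e1; hh e2; hh e3; hh e4]).
    exact: small_scattered.
  by apply: smallW => Y _ [].
have s1 : small z (fun Y => scattered Y [:: hh e1; hh e2; hh e3; hh e4]).
  by apply: small_scattered => //=; solve_uniq.
have s2 : small z (fun Y => scattered Y [:: hh b; hh c; hh d]).
  by apply: small_scattered => //=; solve_uniq.
have t1 := sc b ltac:(by rewrite !inE eqxx) ltac:(solve_uniq).
have t2 := sc c ltac:(by rewrite !inE eqxx orbT) ltac:(solve_uniq).
have t3 := sc d ltac:(by rewrite !inE eqxx !orbT) ltac:(solve_uniq).
have n1 := @small_N_leg b z e1 e4 e1E e4E ltac:(solve_uniq).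
have n2 := @small_N_leg c z e2 e4 e2E e4E ltac:(solve_uniq).
have n3 := @small_N_leg d z e3 e4 e3E e4E ltac:(solve_uniq).
have n0 := @small_N_E z e1 e2 e3 e1E e2E e3E ltac:(solve_uniq).
apply: smallW (smallI s1 (smallI s2 (smallI t1 (smallI t2 (smallI t3
  (smallI n1 (smallI n2 (smallI n3 n0)))))))) => Y cY [? [? [? [? [? [? [? [? ?]]]]]]]].
exact: (@cyc_replace3 _ N sN _ _ _ (hh e1) (hh e2) (hh e3) (hh e4) Y Y).
Qed.

(** Near each point the legs of a 3-cycle are elements of the acting group. *)
Lemma three_cycle_N t : three_cycle a t -> N t.
Proof.
move=> /three_cycle_eq[U [cU sU tE [Ft _ _ _]]]; rewrite tE.
have [N1 NM NV] := sN.
apply: (clopen_ind compactZ zdZ (P := fun U => N (cyc 1 t (t * t) U))) => //.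
- by rewrite cyc0.
- move=> A B cA cB AU BU AB NA NB; rewrite cyc_union //; first exact: NM.
  by apply: scattered_sub sU => z [/AU|/BU].
move=> z Uz; have [g [tz sg]] := full_germ z Ft.
have [g' [ttz sg']] := full_germ z (fullM Ft Ft).
have u : uniq [:: a 1 z; a g z; a g' z].
  move: sU => [[ab [ac _]] [[bc _] _]].
  rewrite act1 -tz -ttz /= !inE negb_or andbT -andbA.
  by apply/and3P; split; apply/eqP; [exact: ab | exact: ac | exact: bc].
have [O [oO Oz H]] := smallI sg (smallI sg' (small_N u)).
exists O; split=> // A cA AO AU; have [e [e']] := H _ cA AO.
rewrite to_homeo1 (@eq_cyc _ 1 t (t * t) 1 (hh g) (hh g')) //.
exact: scattered_sub sU.
Qed.

Lemma alternating_N : alternating_full_set a `<=` N.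
Proof. by apply: subgroup_generated_min => // t /three_cycle_N. Qed.

End Generators.

(** Junk value 1 outside the alternating full group. *)
Definition to_alt (h : homeo Z) : alternating_full_group a := insubd 1 h.

Lemma to_altK h : alternating_full_set a h -> to_alt h = h :> homeo Z.
Proof. by move=> Ah; rewrite /to_alt insubdK //; exact/asboolP. Qed.

Lemma alt_valK (x : alternating_full_group a) : to_alt x = x.
Proof. by rewrite /to_alt valKd. Qed.

Lemma alt_valM (x y : alternating_full_group a) : (x * y) = (x : homeo Z) * y :> homeo Z.
Proof. by []. Qed.

Lemma alt_val1 : (1 : alternating_full_group a) = 1 :> homeo Z.
Proof. by []. Qed.

Lemma alt_valV (x : alternating_full_group a) : x^-1 = (x : homeo Z)^-1 :> homeo Z.
Proof. by []. Qed.

Theorem alternating_finitely_generated :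
  finitely_generated (alternating_full_group a).
Proof.
have [E [rE E1 SE]] := rich_exists.
have [k0 [c0 [ck0 cl0 gen0]]] := generating_partition.
have [k1 [c1 [ck1 H1]]] : exists k (c : Z -> nat), (forall z, c z < k)%N /\
    forall i, clopen (c @^-1` [set i]) /\ (roomy E (c @^-1` [set i]) /\
      (forall z z', c z = i -> c z' = i -> c0 z = c0 z')).
  apply: (finite_clopen_partition compactZ zdZ (P := fun W => roomy E W /\
    forall z z', W z -> W z' -> c0 z = c0 z')).
    split=> // q1 q2 q3 _ _ _; have [//|l [sl lE _ _]] := @rich_pick E rE 5 z0 [::].
    have e0 (l' : seq (homeo Z)) : scattered set0 l' /\ forall q : homeo Z, apart_from set0 q l'.
      elim: l' => //= x l' [IH1 IH2]; split=> [|q]; do !split=> //; move=> ? ? [].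
    exists l; split=> //; first by case: (e0 [seq hh e | e <- l]).
    by split; case: (e0 [seq hh e | e <- l]).
  move=> z; have : small z (fun Y => Y `<=` c0 @^-1` [set c0 z]).
    by apply: small_sub => //; case: (cl0 (c0 z)).
  move=> sc; have [O [oO Oz HO]] := smallI (small_roomy rE z) sc.
  exists O; split=> // A cA AO; have [rA Ac] := HO A cA AO.
  by split=> // x x' /Ac /= -> /Ac /= ->.
have cl1 i := proj1 (H1 i); have rW i := proj1 (proj2 (H1 i)).
have gen1 z z' : z <> z' -> exists g, c1 (a g z) <> c1 (a g z').
  move=> /gen0[g gz]; exists g => e; apply: gz.
  by have [_ [_]] := H1 (c1 (a g z)); apply; rewrite //= -e.
have AN := alternating_N rE E1 SE ck1 cl1 rW gen1.
pose L := [seq to_alt h | h <- cell_cycles E k1 c1].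
exists (L ++ [seq x^-1 | x <- L]); split.
  move=> x; rewrite !mem_cat => /orP[xL|/mapP[y yL ->]].
    by rewrite (map_f (fun x => x^-1) xL) orbT.
  by rewrite invgK yL.
rewrite -subTset => x _.
have [K1 KM KV] := subgroup_generatedP [set` L ++ [seq x^-1 | x <- L]].
set K := subgroup_generated _ in K1 KM KV *.
have [A1 AM AV] := subgroup_generatedP [set h | three_cycle a h].
suff /(_ (x : homeo Z)) : cell_cycle_group E k1 c1 `<=` [set h | alternating_full_set a h /\ K (to_alt h)].
  case; last by rewrite alt_valK.
  by apply: AN; case: x => /= h /asboolP.
apply: subgroup_generated_min.
  split=> [|g h [Ag Kg] [Ah Kh]|h [Ah Kh]].
  - by split=> //; rewrite -alt_val1 alt_valK.
  - split; first exact: AM.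
    by rewrite -[g]to_altK // -[h]to_altK // -alt_valM alt_valK; exact: KM.
  - split; first exact: AV.
    by rewrite -[h]to_altK // -alt_valV alt_valK; exact: KV.
move=> h /= hg; split; first exact: cell_cycles_alternating hg.
by apply: sub_subgroup_generated => /=; rewrite mem_cat map_f.
Qed.

End FiniteGeneration.

(** * Counting the points of a ball *)
Section Counting.
Local Open Scope classical_set_scope.
Local Notation ball := Defs.ball.

Lemma ncard_ge (X : Type) (A : set X) (I : finType) (f : I -> X) :
  finite_set A -> injective f -> (forall i, A (f i)) -> (#|I| <= ncard A)%N.
Proof.
move=> fA fi Af; pose l : seq {classic X} := [seq f i | i <- enum I].
have ul : uniq l by rewrite map_inj_uniq ?enum_uniq.
rewrite cardE -(size_map (f : I -> {classic X})) -/l /ncard.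
apply: uniq_leq_size => // x /mapP[i _ ->].
by rewrite in_fset_set //; exact/mem_set.
Qed.

Lemma ncard_sub (X : Type) (A B : set X) : finite_set B -> A `<=` B ->
  (ncard A <= ncard B)%N.
Proof.
move=> fB AB; have fA : finite_set A by exact: sub_finite_set fB.
apply: uniq_leq_size => [|x]; first exact: fset_uniq.
by rewrite !in_fset_set // => /set_mem/AB/mem_set.
Qed.

Lemma ncard_enum (X : Type) (A : set X) : finite_set A ->
  exists f : 'I_(ncard A) -> X, injective f /\ forall i, A (f i).
Proof.
move=> fA.
have enum_seq (l : seq {classic X}) : uniq l -> (forall x, x \in l -> A x) ->
    exists f : 'I_(size l) -> X, injective f /\ forall i, A (f i).
  case: l => [|x0 l] ul lA; first by exists (fun i : 'I_0 => match notF (ltn_ord i) with end); split=> -[].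
  exists (fun i => nth x0 (x0 :: l) i); split=> [i j e|i]; last first.
    by apply: lA; exact: mem_nth.
  by apply/val_inj/eqP; rewrite -(nth_uniq x0 _ _ ul) ?ltn_ord //; exact/eqP.
apply: enum_seq; first exact: fset_uniq.
by move=> x; rewrite in_fset_set // => /set_mem.
Qed.

Lemma ball_orbit_finite (G : groupType) (S : seq G) (X : Type) (b : action G X) n x :
  finite_set [set b g x | g in ball S n].
Proof. by apply: finite_image; exact: ball_finite. Qed.

Lemma vol_ge (G : groupType) (S : seq G) (X : Type) (b : action G X) n x
    (I : finType) (f : I -> X) : injective f ->
  (forall i, exists2 g, ball S n g & f i = b g x) -> (#|I| <= vol S b n)%N.
Proof.
move=> fi fb; have [_ /(_ x)] := volP S b n (ex_intro _ x Logic.I).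
apply: leq_trans; apply: (ncard_ge (f := f)) => //.
  exact: ball_orbit_finite.
by move=> i; have [g Bg ->] := fb i; exists g.
Qed.

Lemma vol_le (G : groupType) (S : seq G) (X : Type) (b : action G X) m n :
  (m <= n)%N -> (vol S b m <= vol S b n)%N.
Proof.
move=> mn; have [[x _]|nX] := pselect (exists x : X, True).
  have [[y ->] _] := volP S b m (ex_intro _ x Logic.I).
  have [_ /(_ y)] := volP S b n (ex_intro _ x Logic.I).
  apply: leq_trans; apply: ncard_sub; first exact: ball_orbit_finite.
  by move=> _ [g Bg <-]; exists g => //; exact: ball_le Bg.
have {}nX : forall x : X, False by move=> x; apply: nX; exists x.
rewrite {1}/vol xgetPN // => k [[x _] _]; exact: nX.
Qed.

Lemma vol_attained (G : groupType) (S : seq G) (X : Type) (b : action G X) n (x0 : X) :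
  exists x (g : 'I_(vol S b n) -> G),
    (forall i, ball S n (g i)) /\ injective (fun i => b (g i) x).
Proof.
have [[x e] _] := volP S b n (ex_intro _ x0 Logic.I); exists x.
have [f [fi fb]] := ncard_enum (@ball_orbit_finite G S X b n x).
have /choice[g gP] : forall i, exists g, ball S n g /\ b g x = f i.
  by move=> i; have [g Bg gx] := fb i; exists g.
rewrite e; exists g; split=> [i|i j /=]; first by case: (gP i).
by rewrite !(gP _).2; exact: fi.
Qed.

End Counting.

(** * Growth of the alternating full group on Z *)
Section FullGroupGrowth.
Local Open Scope classical_set_scope.
Local Open Scope group_scope.
Local Notation ball := Defs.ball.
Variables (cG : groupType) (Z : topologicalType) (a : action cG Z) (S : seq cG).
Hypothesis genS : symmetric_generating_set S.
Hypothesis homeo_a : by_homeomorphisms a.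
Hypothesis compactZ : compact [set: Z].
Hypothesis zdZ : zero_dimensional Z.
Hypothesis hsZ : hausdorff_space Z.
Hypothesis perfectZ : perfect_set [set: Z].
Hypothesis minimal_a : minimal_action a.
Local Notation hh := (to_homeo homeo_a).
Local Notation FG := (topological_full_group a).
Local Notation G := (alternating_full_group a).
Implicit Types (A B D O U V Y W : set Z) (z : Z) (g e q : cG) (x : G).

Definition alternating_action : action G Z :=
  @Action G Z (fun x z => x z) (fun z => erefl) (fun x y z => erefl).

Lemma alternating_action_faithful : faithful alternating_action.
Proof. by move=> x xz; apply: val_inj; exact: homeo_ext. Qed.

Lemma alt_full x : FG x.
Proof. by case: x => h /= /asboolP; exact: full_alternating. Qed.

(** An element of the full group acts at each point as one of finitely many
    elements of the acting group, by compactness. *)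
Lemma alt_word_length (l : seq G) : exists C, forall x, x \in l -> forall z,
  exists2 g, ball S C g & x z = a g z.
Proof.
elim: l => [|x l [C HC]]; first by exists 0%N.
pose P Y := exists C, forall z, Y z -> exists2 g, ball S C g & x z = a g z.
suff [D HD] : P setT.
  exists (D + C)%N => y; rewrite inE => /predU1P[->|yl] z.
    by have [g Bg e] := HD z I; exists g => //; apply: ball_le Bg; exact: leq_addr.
  by have [g Bg e] := HC _ yl z; exists g => //; apply: ball_le Bg; exact: leq_addl.
apply: (clopen_ind compactZ zdZ (P := P)).
- by exists 0%N.
- move=> A B _ _ _ _ _ [m Hm] [n Hn]; exists (m + n)%N => z [/Hm|/Hn] [g Bg e];
    exists g => //; apply: ball_le Bg; [exact: leq_addr | exact: leq_addl].
- move=> z _; have [g [_ [O [oO Oz Og]]]] := full_germ z (alt_full x).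
  have [n Bg] := gen_ball genS g.
  by exists O; split=> // A cA AO _; exists n => y Ay; exists g => //; exact: (Og A).
- exact: clopenT.
Qed.

Lemma growth_upper_bound (T : seq G) : symmetric_generating_set T ->
  growth_le (vol T alternating_action) (vol S a).
Proof.
move=> _; have [C HC] := alt_word_length T.
have word n x : ball T n x -> forall z, exists2 g, ball S (C * n) g & x z = a g z.
  elim: n x => [|n IH] x.
    by move=> /ball0 -> z; exists 1; [exact: ball1 | rewrite act1].
  move=> /ballS[|[t [y [tT /IH{}IH ->]]] z].
    move=> /IH{}IH z; have [g Bg e] := IH z; exists g => //.
    by apply: ball_le Bg; rewrite leq_mul.
  have [g Bg e] := IH z; have [g' Bg' e'] := HC _ tT (a g z).
  exists (g' * g); first by rewrite mulnS; exact: ballM.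
  by rewrite actM -e' -e.
exists C.+1; split=> // n _; apply: (@leq_trans (vol S a (C * n))); last first.
  apply: (@leq_trans (vol S a (C.+1 * n))); last exact: leq_pmull.
  by apply: vol_le; rewrite leq_mul.
have [[z0 _]|nZ] := pselect (exists z : Z, True); last first.
  have {}nZ : forall z : Z, False by move=> z; apply: nZ; exists z.
  by rewrite {1}/vol xgetPN // => k [[z _] _]; exact: nZ.
have [[z ->] _] := volP T alternating_action n (ex_intro _ z0 Logic.I).
have [_ /(_ z)] := volP S a (C * n) (ex_intro _ z0 Logic.I).
apply: leq_trans; apply: ncard_sub; first exact: ball_orbit_finite.
by move=> _ [x Bx <-]; have [g Bg e] := word _ _ Bx z; exists g.
Qed.

(** The local realizations of realize_germ, made finite in number by
    compactness. *)
Lemma realize_list D (l : seq cG) : clopen D -> exists F : seq G,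
  (forall x, x \in F -> alt_on a D x) /\
  forall g z, g \in l -> D z -> D (a g z) -> exists2 x, x \in F & x z = a g z.
Proof.
move=> cD; elim: l => [|g l [F [FD HF]]]; first by exists [::].
pose P Y := exists F : seq G, (forall x, x \in F -> alt_on a D x) /\
  forall z, Y z -> exists2 x, x \in F & x z = a g z.
suff [E [ED HE]] : P (D `&` (hh g : Z -> Z) @^-1` D).
  exists (E ++ F); split=> [x|h z]; first by rewrite mem_cat => /orP[/ED|/FD].
  rewrite inE => /predU1P[->|hl] Dz Dhz.
    by have [x xE e] := HE z (conj Dz Dhz); exists x; rewrite // mem_cat xE.
  by have [x xF e] := HF _ _ hl Dz Dhz; exists x; rewrite // mem_cat xF orbT.
apply: (clopen_ind compactZ zdZ (P := P)).
- by exists [::].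
- move=> A B _ _ _ _ _ [E [ED HE]] [E' [ED' HE']]; exists (E ++ E'); split=> [x|z].
    by rewrite mem_cat => /orP[/ED|/ED'].
  move=> [/HE|/HE'] [x xE e]; exists x => //; rewrite mem_cat xE ?orbT //.
- move=> z [Dz Dgz].
  have [h [Ah [O [oO Oz HO]]]] :=
    realize_germ homeo_a compactZ zdZ hsZ perfectZ minimal_a cD Dz Dgz.
  exists O; split=> // A cA AO _.
  exists [:: to_alt a h]; split.
    by move=> x; rewrite inE => /eqP ->; rewrite to_altK //; exact: alt_on_alternating Ah.
  move=> y Ay; exists (to_alt a h); rewrite ?mem_head // to_altK.
    exact: (HO A).
  exact: alt_on_alternating Ah.
- by apply: clopenI => //; exact: clopen_preimage.
Qed.

(** At each point, each generator of the acting group is realized by one of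
    finitely many elements, so the length of words is preserved. *)
Lemma realize_words : exists F : seq G, forall n g z, ball S n g ->
  exists2 x, ball F n x & x z = a g z.
Proof.
have [F [_ HF]] := realize_list S (@clopenT Z); exists F.
elim=> [|n IH] g z.
  by move=> /ball0 ->; exists 1; [exact: ball1 | rewrite act1].
move=> /ballS[/IH|[s [h [sS Bh ->]]]].
  by move=> /(_ z)[x Bx e]; exists x => //; exact: ball_le Bx.
have [x Bx e] := IH h z Bh; have [y yF e'] := HF s (a h z) sS I I.
exists (y * x); first by rewrite -add1n; apply: ballM => //; exact: ball_mem.
by rewrite actM -e' -e.
Qed.

(** Some finite set Del of elements brings every point into D. If a step s of a
    walk is replaced by d s e^-1, with e and d in Del, the walk stays in D, and
    there its finitely many possible steps are realized by elements supported in
    D. A finite set of points stable under them would therefore meet, up to Del,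
    the whole infinite orbit; so the balls keep growing. *)
Lemma linear_growth_inside D z1 : clopen D -> D z1 ->
  exists F : seq G, (forall x, x \in F -> alt_on a D x) /\
  forall n, exists l : seq G, [/\ size l = n.+1, uniq [seq x z1 | x <- l],
    1 \in l & forall x, x \in l -> ball F n x].
Proof.
move=> cD Dz1; have [oD _] := cD.
pose P Y := exists l : seq cG, forall z, Y z -> exists2 g, g \in l & D (a g z).
have [Del HDel] : P setT.
  apply: (clopen_ind compactZ zdZ (P := P)).
  - by exists [::].
  - move=> A B _ _ _ _ _ [l Hl] [l' Hl']; exists (l ++ l').
    by move=> z [/Hl|/Hl'] [g gl Dg]; exists g => //; rewrite mem_cat gl ?orbT.
  - move=> z _; have [g Dg _] := orbit_meets hsZ perfectZ minimal_a z [::] oD Dz1.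
    exists ((hh g : Z -> Z) @^-1` D); split=> //; first exact: open_preimage.
    by move=> A _ AD _; exists [:: g] => y Ay; exists g; [rewrite mem_head | exact: AD].
  - exact: clopenT.
pose ret := [seq p * e^-1 | p <- [seq d * s | d <- Del, s <- S], e <- 1 :: Del].
have [F [FD HF]] := realize_list ret cD; exists F; split=> //.
elim=> [|n [l [sl ul l1 lB]]].
  exists [:: 1]; split=> //; first exact: mem_head.
  by move=> x; rewrite inE => /eqP ->; exact: ball1.
have [x [y [xl yF yx]]] : exists x y, [/\ x \in l, y \in F &
    y (x z1) \notin [seq x z1 | x <- l]].
  apply: contrapT => H.
  have closed x y : x \in l -> y \in F -> y (x z1) \in [seq x z1 | x <- l].
    by move=> xl yF; apply/negPn/negP => yx; apply: H; exists x, y.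
  have inD x : x \in l -> D (x z1).
    move=> /lB; elim: n x {sl lB} => [|n IH] x; first by move=> /ball0 ->.
    move=> /ballS[/IH//|[t [h [tF /IH Dh ->]]]].
    by apply: alt_on_in Dh; exact: FD.
  have reach g : exists2 d, d \in 1 :: Del & a d (a g z1) \in [seq x z1 | x <- l].
    have [k] := gen_ball genS g; elim: k g => [|k IH] g.
      move=> /ball0 ->; exists 1; first by rewrite mem_head.
      rewrite !act1 -[z1]/((1 : G) z1); exact: (map_f (fun x : G => x z1)).
    move=> /ballS[/IH//|[s [h [sS /IH[e eD /mapP[x xl ex]] ->]]]].
    have [d dD Dd] := HDel (a (s * h) z1) I.
    exists d; first by rewrite inE dD orbT.
    have mem : d * s * e^-1 \in ret.
      by apply: allpairs_f => //; exact: allpairs_f.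
    have e1 : a (d * s * e^-1) (x z1) = a d (a (s * h) z1).
      by rewrite -ex !actM actK.
    have [y yF <-] : exists2 y, y \in F & y (x z1) = a d (a (s * h) z1).
      by rewrite -e1; apply: HF => //; [exact: inD | rewrite e1].
    exact: closed.
  have [g _] := orbit_meets hsZ perfectZ minimal_a z1
    [seq a d^-1 p | d <- 1 :: Del, p <- [seq x z1 | x <- l]] (@openT Z) (I : setT z1).
  have [d dD dg] := reach g.
  rewrite -(actK a d (a g z1)) => /negP; apply; exact: allpairs_f.
exists (y * x :: l); split=> /=.
- by rewrite sl.
- by rewrite yx.
- by rewrite inE l1 orbT.
- move=> w; rewrite inE => /predU1P[->|/lB Bw]; last exact: ball_le Bw.
  by rewrite -add1n; apply: ballM; [exact: ball_mem | exact: lB].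
Qed.

End FullGroupGrowth.

(** * Free products *)
Section FreeProducts.
Local Open Scope classical_set_scope.
Local Open Scope group_scope.
Variables G H : groupType.
Local Notation L := (free_product G H).
Implicit Types (g : G) (h : H).

Definition fp_letter (l : G + H) : L := FreeProduct (reduced_consP l (fp_reduced (fp1 G H))).
Definition fp_left g : L := fp_letter (inl g).
Definition fp_right h : L := fp_letter (inr h).

Lemma fp_mulE (u v : L) : u * v = foldr (@reduced_cons G H) v u :> seq _.
Proof. by []. Qed.

Lemma fp_letter_mul l (v : L) : fp_letter l * v = reduced_cons l v :> seq _.
Proof.
rewrite fp_mulE foldr_reduced_cons //; exact: fp_reduced.
Qed.

Lemma fp_leftM g g' : fp_left (g * g') = fp_left g * fp_left g'.
Proof.
apply: val_inj; transitivity (reduced_cons (inl g) (fp_left g')); last first.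
  by rewrite -fp_letter_mul.
by apply/esym/(@reduced_consMl G H g g' [::]).
Qed.

Lemma fp_rightM h h' : fp_right (h * h') = fp_right h * fp_right h'.
Proof.
apply: val_inj; transitivity (reduced_cons (inr h) (fp_right h')); last first.
  by rewrite -fp_letter_mul.
by apply/esym/(@reduced_consMr G H h h' [::]).
Qed.

Lemma fp_left1 : fp_left 1 = 1.
Proof. by apply: val_inj; rewrite /= /cons_nontrivial /= eqxx. Qed.

Lemma fp_right1 : fp_right 1 = 1.
Proof. by apply: val_inj; rewrite /= /cons_nontrivial /= eqxx. Qed.

Lemma fp_leftV g : fp_left g^-1 = (fp_left g)^-1.
Proof. by apply: (mulIg (fp_left g)); rewrite -fp_leftM !mulVg fp_left1. Qed.

Lemma fp_rightV h : fp_right h^-1 = (fp_right h)^-1.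
Proof. by apply: (mulIg (fp_right h)); rewrite -fp_rightM !mulVg fp_right1. Qed.

Lemma free_product_ind (K : set L) : is_subgroup K -> (forall g, K (fp_left g)) ->
  (forall h, K (fp_right h)) -> forall u, K u.
Proof.
move=> [K1 KM KV] Kl Kr [w rw]; elim: w rw => [|l w IH] rw.
  by rewrite (_ : FreeProduct rw = 1) //; exact: val_inj.
have -> : FreeProduct rw = fp_letter l * FreeProduct (reduced_tl rw).
  apply: val_inj; transitivity (reduced_cons l w); last first.
    exact/esym/(@fp_letter_mul l (FreeProduct (reduced_tl rw))).
  by rewrite reduced_cons_reduced.
by apply: (KM _ _); last exact: IH; case: (l) => [g|h]; [exact: Kl | exact: Kr].
Qed.

Lemma free_product_finitely_generated :
  finitely_generated G -> finitely_generated H -> finitely_generated L.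
Proof.
move=> [S [symS genS]] [T [symT genT]].
pose U := [seq fp_left g | g <- S] ++ [seq fp_right h | h <- T].
exists U; split.
  move=> u; rewrite !mem_cat => /orP[] /mapP[x xS ->]; apply/orP; [left|right].
    by rewrite -fp_leftV map_f // symS.
  by rewrite -fp_rightV map_f // symT.
have [K1 KM KV] := subgroup_generatedP [set` U].
rewrite -subTset => u _; move: u; apply: free_product_ind => //.
- move=> g; have : subgroup_generated [set` S] g by rewrite genS.
  apply: (subgroup_generated_min (N := [set g | subgroup_generated [set` U] (fp_left g)])).
    split=> [|x y Kx Ky|x Kx] /=; first by rewrite fp_left1.
      by rewrite fp_leftM; exact: KM.
    by rewrite fp_leftV; exact: KV.
  by move=> s sS /=; apply: sub_subgroup_generated; rewrite /= mem_cat map_f.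
- move=> h; have : subgroup_generated [set` T] h by rewrite genT.
  apply: (subgroup_generated_min (N := [set h | subgroup_generated [set` U] (fp_right h)])).
    split=> [|x y Kx Ky|x Kx] /=; first by rewrite fp_right1.
      by rewrite fp_rightM; exact: KM.
    by rewrite fp_rightV; exact: KV.
  by move=> s sS /=; apply: sub_subgroup_generated; rewrite /= mem_cat map_f ?orbT.
Qed.

(** The k-th power is the concatenation of k copies of a reduced word that starts
    and ends in different factors. *)
Lemma fp_infinite_order g h k : g <> 1 -> h <> 1 -> (0 < k)%N ->
  (fp_left g * fp_right h^-1 * fp_left g * fp_right h) ^+ k <> 1.
Proof.
move=> /eqP g1 /eqP h1 k0.
have hV1 : h^-1 != 1 by rewrite invg_eq1.
pose w : seq (G + H) := [:: inl g; inr h^-1; inl g; inr h].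
have red v : reduced v -> (if v is inr _ :: _ then false else true) -> reduced (w ++ v).
  case: v => [|[x|//] v] /=; rewrite /reduced /= ?g1 ?hV1 ?h1 //= => /andP[/= /andP[-> ->] ->] //.
have mul (v : L) : (if (v : seq (G + H)) is inr _ :: _ then false else true) ->
    fp_left g * fp_right h^-1 * fp_left g * fp_right h * v = w ++ v :> seq _.
  move=> vl; have rv := red _ (fp_reduced v) vl.
  rewrite -!mulgA !fp_letter_mul.
  have r1 := reduced_tl rv; have r2 := reduced_tl r1; have r3 := reduced_tl r2.
  by rewrite !(reduced_cons_reduced r3, reduced_cons_reduced r2, reduced_cons_reduced r1,
    reduced_cons_reduced rv).
set u := (_ * _ * _ * _).
have powE n : fp_word (u ^+ n) = flatten (nseq n w).
  elim: n => [|n IH] //; rewrite expgS mul IH //.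
  by case: n {IH}.
by move=> e; have := powE k; rewrite e; case: k k0 {e}.
Qed.

End FreeProducts.

(** * Simplicity of the local alternating groups, and the places where a point is moved *)
Section AlternatingActions.
Local Open Scope classical_set_scope.
Local Open Scope group_scope.
Local Notation ball := Defs.ball.
Local Notation support := Defs.support.
Variables (cG : groupType) (Z : topologicalType) (a : action cG Z).
Hypothesis homeo_a : by_homeomorphisms a.
Hypothesis compactZ : compact [set: Z].
Hypothesis zdZ : zero_dimensional Z.
Hypothesis hsZ : hausdorff_space Z.
Hypothesis perfectZ : perfect_set [set: Z].
Hypothesis minimal_a : minimal_action a.
Local Notation hh := (to_homeo homeo_a).
Local Notation FG := (topological_full_group a).
Local Notation G := (alternating_full_group a).
Local Notation to_alt := (to_alt a).
Implicit Types (A B D O U V Y W : set Z) (z : Z) (x : G) (h k q t : homeo Z).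

Section Simplicity.
Variables (V : set Z) (z0 : Z).
Hypotheses (cV : clopen V) (Vz0 : V z0).

(** The double commutator trick: if q moves Y off itself and h, k are supported in
    Y, then [h, q] acts on Y as h, so [[h, q], k] = [h, k]. *)
Lemma alt_on_commutators (K : set (homeo Z)) q z : is_subgroup K ->
  K `<=` alt_on a V -> (forall c n, alt_on a V c -> K n -> K (c * n * c^-1)) ->
  K q -> q z <> z -> exists Y, [/\ clopen Y, Y z, Y `<=` V &
    forall h k, alt_on a Y h -> alt_on a Y k -> K (h * k * h^-1 * k^-1)].
Proof.
move=> [K1 KM KV] KVs nK Kq qz.
have Vz : V z by apply: contrapT => nVz; apply: qz; exact: alt_on_out (KVs _ Kq) nVz.
have [Y [cY Yz [YV apY]]] : exists Y, [/\ clopen Y, Y z & Y `<=` V /\ apart Y q 1].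
  apply: small_ex => //; apply: smallI; first by apply: small_sub => //; case: cV.
  exact: small_apart.
exists Y; split=> // h k Ah Ak.
have Vh := alt_onS YV Ah; have Vk := alt_onS YV Ak.
have Aq : alt_on a (q @` Y) (q * h^-1 * q^-1).
  apply: alt_on_conj; last exact: alt_onV.
  by apply: full_alternating; exact: alt_on_alternating (KVs _ Kq).
have [w wE] : exists w, w = q * h^-1 * q^-1 by eexists.
rewrite -wE in Aq.
have comm : w * k = k * w.
  apply: alt_on_commute Aq Ak _; rewrite -subset0 => _ [[y Yy <-] Yq].
  exact: (apY _ _ Yy Yq).
have cE : h * q * h^-1 * q^-1 = h * w by rewrite wE !mulgA.
have Kc : K (h * w) by rewrite -cE; apply: KM; [exact: nK | exact: KV].
have -> : h * k * h^-1 * k^-1 = (h * w) * (k * (h * w)^-1 * k^-1).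
  by rewrite invgM !mulgA -(mulgA h w k) comm mulgA mulgK.
by apply: (KM _ _) => //; apply: nK => //; exact: KV.
Qed.

(** A small piece (1 t t^2) of a 3-cycle is the commutator of (1 t g4) and
    (1 t^2 g5). Conjugation by an element of alt_on V that brings the five legs
    into Y reduces it to a commutator of elements supported in Y. *)
Lemma alt_on_simple (K : set (homeo Z)) : is_subgroup K ->
  K `<=` alt_on a V -> (forall c n, alt_on a V c -> K n -> K (c * n * c^-1)) ->
  (exists2 q, K q & q <> 1) -> alt_on a V `<=` K.
Proof.
move=> sK KVs nK [q Kq q1]; have [K1 KM KV] := sK.
have [z qz] : exists z, q z <> z.
  apply: contrapT => H; apply: q1; apply: homeo_ext => z; apply: contrapT => qz.
  by apply: H; exists z.
have [Y [cY Yz YV commK]] := alt_on_commutators sK KVs nK Kq qz.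
have [oV _] := cV; have [oY _] := cY.
apply: subgroup_generated_min => // t [tt st].
have [U [cU sU tE [Ft s1 s2 s3]]] := three_cycle_eq tt; rewrite tE.
apply: (clopen_ind compactZ zdZ (P := fun A => K (cyc 1 t (t * t) A))) => //.
- by rewrite cyc0.
- move=> A B cA cB AU BU AB KA KB; rewrite cyc_union //; first exact: KM.
  by apply: scattered_sub sU => y [/AU|/BU].
move=> x Ux.
have Vx : V x by exact/st/s1.
have Vtx : V (t x) by apply/st/s2; exists x.
have Vttx : V (t (t x)) by apply/st/s3; exists x.
have [g4 Vg4] := orbit_meets hsZ perfectZ minimal_a x [:: x; t x; t (t x)] oV Vx.
rewrite !inE !negb_or => u4.
have [g5 Vg5] := orbit_meets hsZ perfectZ minimal_a x [:: x; t x; t (t x); a g4 x] oV Vx.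
rewrite !inE !negb_or => u5.
have [xt xtt ttt] : [/\ x != t x, x != t (t x) & t x != t (t x)].
  move: sU => [[ab [ac _]] [[bc _] _]].
  by split; apply/eqP; [exact: ab | exact: ac | exact: bc].
split_ands.
have u : uniq [:: x; t x; t (t x); a g4 x; a g5 x] by solve_uniq.
have [||c [Ac cO _]] := @transport _ _ _ homeo_a compactZ zdZ hsZ perfectZ minimal_a V
  [seq (p, Y) | p <- [:: x; t x; t (t x); a g4 x; a g5 x]] [::] cV.
- by rewrite cats0 -map_comp map_id.
- move=> p /mapP[p' pl ->] /=; split=> //; last by exists z.
  by move: pl; rewrite !inE; do !(case/predU1P=> [->//|]); move/eqP=> ->.
have cY' p : p \in [:: x; t x; t (t x); a g4 x; a g5 x] -> Y (c p).
  by move=> pl; apply: (cO (p, Y)); apply/mapP; exists p.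
have sc : small x (fun A => scattered A [:: 1; t; t * t; hh g4; hh g5]).
  exact: small_scattered.
have sY h : Y (c (h x)) -> small x (fun A => forall y, A y -> Y ((c * h) y)).
  by move=> Yh; exact: (@small_image_sub _ x (c * h) Y).
have n1 := sY 1 (cY' x ltac:(by rewrite !inE eqxx)).
have n2 := sY t (cY' (t x) ltac:(by rewrite !inE eqxx ?orbT)).
have n3 := sY (t * t) (cY' (t (t x)) ltac:(by rewrite !inE eqxx ?orbT)).
have n4 := sY (hh g4) (cY' (a g4 x) ltac:(by rewrite !inE eqxx ?orbT)).
have n5 := sY (hh g5) (cY' (a g5 x) ltac:(by rewrite !inE eqxx ?orbT)).
have [O [oO Ox HO]] := smallI sc (smallI n1 (smallI n2 (smallI n3 (smallI n4 n5)))).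
exists O; split=> // A cA AO AU.
have [sA [m1 [m2 [m3 [m4 m5]]]]] := HO A cA AO.
have [[ab [ac [ad [ae _]]]] [[bc [bd [be _]]] [[cd [ce _]] [[de _] _]]]] := sA.
have scbd : scattered A [:: 1; t; hh g4] by do !split.
have scce : scattered A [:: 1; t * t; hh g5] by do !split.
have Fc : FG c by apply: full_alternating; exact: alt_on_alternating Ac.
have Ftt := fullM Ft Ft.
have F1 := full1 a.
have F4 := full_hh homeo_a g4; have F5 := full_hh homeo_a g5.
pose u1 := cyc 1 t (hh g4) A; pose u2 := cyc 1 (t * t) (hh g5) A.
have A1 : alt_on a Y (c * u1 * c^-1).
  rewrite /u1 cyc_conj //; apply: alt_on_cyc; try exact: fullM.
  by move=> y Ay; split; [exact: m1 | exact: m2 | exact: m4].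
have A2 : alt_on a Y (c * u2 * c^-1).
  rewrite /u2 cyc_conj //; apply: alt_on_cyc; try exact: fullM.
  by move=> y Ay; split; [exact: m1 | exact: m3 | exact: m5].
have := nK _ _ (alt_onV Ac) (commK _ _ A1 A2).
suff -> : c^-1 * (c * u1 * c^-1 * (c * u2 * c^-1) * (c * u1 * c^-1)^-1 *
    (c * u2 * c^-1)^-1) * c^-1^-1 = cyc 1 t (t * t) A by [].
rewrite -[in RHS](setIid A) -(@cyc_commutator _ _ _ _ (hh g4) (hh g5)) ?setUid //.
by rewrite -/u1 -/u2 !invgM !invgK !mulgA mulVg mul1g !mulgVK.
Qed.

Definition alt_elts : set G := [set x | alt_on a V x].

Lemma alt_elts_subgroup : is_subgroup alt_elts.
Proof.
split=> [|x y|x]; [exact: alt_on1 | exact: alt_onM | exact: alt_onV].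
Qed.

Lemma to_altM h k : alternating_full_set a h -> alternating_full_set a k ->
  to_alt (h * k) = to_alt h * to_alt k.
Proof.
move=> Ah Ak; have [_ AM _] := subgroup_generatedP [set h | three_cycle a h].
apply: val_inj; change (to_alt (h * k) = to_alt h * to_alt k :> homeo Z).
by rewrite alt_valM !to_altK //; exact: AM.
Qed.

Lemma alt_elts_simple (N : set G) : is_subgroup N -> N `<=` alt_elts ->
  (forall c n, alt_elts c -> N n -> N (c * n * c^-1)) ->
  (exists2 q, N q & q <> 1) -> alt_elts `<=` N.
Proof.
move=> [N1 NM NV] NA nN [q Nq q1].
pose K : set (homeo Z) := [set h : homeo Z | exists2 x : G, N x & h = x :> homeo Z].
suff AK : alt_on a V `<=` K.
  by move=> x /AK[y Ny /val_inj ->].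
apply: alt_on_simple.
- split.
  + by exists 1.
  + by move=> _ _ [x Nx ->] [y Ny ->]; exists (x * y) => //; exact: NM.
  + by move=> _ [x Nx ->]; exists x^-1 => //; exact: NV.
- by move=> _ [x /NA Ax ->].
- move=> c _ Ac [x Nx ->]; have Ac' := alt_on_alternating Ac.
  exists (to_alt c * x * (to_alt c)^-1).
    by apply: nN => //; rewrite /alt_elts /= to_altK.
  by rewrite !alt_valM alt_valV to_altK.
- by exists q; [exists q | move=> e; apply: q1; exact: val_inj].
Qed.

Lemma alt_elts_infinite (l : seq G) : exists2 x, alt_elts x & x \notin l.
Proof.
have [oV _] := cV; pose l' := [seq (x : G) z0 | x <- l].
have [z1 Vz1 z1l] := open_infinite hsZ perfectZ l' oV Vz0.
have [//||//||h [Ah [Vh hl] _]] := @move_point _ _ _ homeo_a compactZ zdZ hsZ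
    perfectZ minimal_a V z0 [set z | V z /\ z \notin l'] z1 [::] cV Vz0.
- exact: open_minus_seq.
- by move=> z [].
have Ah' := alt_on_alternating Ah.
exists (to_alt h); first by rewrite /alt_elts /= to_altK.
apply: contra hl => hl; apply/mapP; exists (to_alt h) => //.
by rewrite to_altK.
Qed.

(** With h z0 different from z0 and k fixing z0 but not h z0, the elements h and k
    do not commute at z0. *)
Lemma alt_elts_nonabelian : exists x y, [/\ alt_elts x, alt_elts y & x * y <> y * x].
Proof.
have [oV _] := cV.
have [z1 Vz1] := open_infinite hsZ perfectZ [:: z0] oV Vz0.
rewrite inE => z10.
have [||h [Ah [Vh]]] := @move_point _ _ _ homeo_a compactZ zdZ hsZ
    perfectZ minimal_a V z0 [set z | V z /\ z \notin [:: z0]] z1 [::] cV Vz0 isT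
    (open_minus_seq hsZ _ oV).
- by rewrite /= inE.
- by move=> z [].
rewrite inE => hz _.
have [z2 Vz2] := open_infinite hsZ perfectZ [:: h z0] oV Vz0.
rewrite inE => z2h.
have [|||k [Ak [Vk]]] := @move_point _ _ _ homeo_a compactZ zdZ hsZ
    perfectZ minimal_a V (h z0) [set z | V z /\ z \notin [:: h z0]] z2 [:: z0] cV Vh _
    (open_minus_seq hsZ _ oV).
- by rewrite inE.
- by rewrite /= inE.
- by move=> z [].
rewrite inE => khz kz.
have Ah' := alt_on_alternating Ah; have Ak' := alt_on_alternating Ak.
exists (to_alt k), (to_alt h); split.
- by rewrite /alt_elts /= to_altK.
- by rewrite /alt_elts /= to_altK.
move=> /(congr1 (fun x : G => x z0)).
rewrite !alt_valM !homeoME !to_altK // (kz z0) ?mem_head // => e.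
by move: khz; rewrite e eqxx.
Qed.

End Simplicity.

Section Moves.
Variables (X : Type) (b : action G X).
Implicit Types (y : X).

(** For the action on Z itself, this says that y lies in V, if V is open. *)
Definition moves V y := exists x : G, [/\ three_cycle a x, support x `<=` V & b x y <> y].

(** Then y has at most one place in Z, as if there were an equivariant map from
    the points of X that are not fixed to Z. *)
Definition coherent := forall V V' y, V `&` V' = set0 -> moves V y -> moves V' y -> False.

Lemma movesS V W y : V `<=` W -> moves V y -> moves W y.
Proof. by move=> VW [x [tx sx xy]]; exists x; split=> //; exact: subset_trans VW. Qed.

Lemma moves_conj x V y : moves V y -> moves (x @` V) (b x y).
Proof.
move=> [t [tt st ty]]; exists (x * t * x^-1); split.
- exact: (three_cycle_conj (alt_full x) tt).
- by rewrite (support_conj t x) => _ [z /st Vz <-]; exists z.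
- by rewrite !actM actK => e; apply: ty; exact: (act_inj (g := x) e).
Qed.

Lemma alternating_cyc h k q Y : FG h -> FG k -> FG q -> alternating_full_set a (cyc h k q Y).
Proof. by move=> Fh Fk Fq; apply: sub_subgroup_generated; exact: three_cycle_cyc. Qed.

(** A 3-cycle is the product of its pieces over any finite partition of its base,
    so one of arbitrarily small pieces moves y. *)
Lemma moves_point x y : three_cycle a x -> b x y <> y ->
  exists U z, [/\ clopen U, scattered U [:: 1; x : homeo Z; (x : homeo Z) * x],
    [/\ support x z, support x (x z) & support x (x (x z))] & U z /\
    forall O, open O -> O z -> exists A, [/\ clopen A, A `<=` O, A `<=` U &
      b (to_alt (cyc 1 x ((x : homeo Z) * x) A)) y <> y]].
Proof.
move=> tx xy; have [U [cU sU xE [Fx s1 s2 s3]]] := three_cycle_eq tx.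
have F1 := full1 a; have Fxx := fullM Fx Fx.
have [||||z Uz H] := @clopen_point Z compactZ zdZ
    (fun A => b (to_alt (cyc 1 x ((x : homeo Z) * x) A)) y = y) U.
- rewrite cyc0 (_ : to_alt 1 = 1) ?act1 //.
  exact: (alt_valK (1 : G)).
- move=> A B cA cB AU BU AB eA eB; rewrite cyc_union //.
    by rewrite to_altM ?actM ?eB //; exact: alternating_cyc.
  by apply: scattered_sub sU => w [/AU|/BU].
- exact: cU.
- by rewrite -xE alt_valK.
exists U, z; split=> //; split; [exact: s1 | by apply: s2; exists z | by apply: s3; exists z].
Qed.

Lemma moves_small k x A V y : FG k -> FG x -> clopen A ->
  scattered A [:: 1; x : homeo Z; (x : homeo Z) * x] ->
  (forall w, A w -> [/\ V (k w), V (k (x w)) & V (k (x (x w)))]) ->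
  alternating_full_set a k ->
  b (to_alt (cyc 1 x ((x : homeo Z) * x) A)) y <> y -> moves V (b (to_alt k) y).
Proof.
move=> Fk Fx cA sA AV Ak ty.
have F1 := full1 a; have Fxx := fullM Fx Fx.
set t := to_alt _ in ty.
have tE : to_alt k * t * (to_alt k)^-1 =
    cyc (k * 1) (k * x) (k * ((x : homeo Z) * x)) A :> homeo Z.
  rewrite -cyc_conj // !alt_valM alt_valV /t !to_altK //.
  exact: alternating_cyc.
exists (to_alt k * t * (to_alt k)^-1); split.
- by rewrite tE; apply: three_cycle_cyc; exact: fullM.
- by rewrite tE; apply: support_cyc => w /AV[].
- by rewrite !actM actK => e; apply: ty; exact: (act_inj (g := to_alt k) e).
Qed.

(** The two 3-cycles that move y can be taken over small neighbourhoods of points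
    z and z'; transport brings the three points of each cycle into V1 and V2. *)
Lemma moves_place V V' V1 V2 z1 z2 y : V `&` V' = set0 -> moves V y -> moves V' y ->
  clopen V1 -> clopen V2 -> V1 z1 -> V2 z2 ->
  exists x, moves V1 (b x y) /\ moves V2 (b x y).
Proof.
move=> VV' [t [tt st ty]] [s [ts ss sy]] cV1 cV2 Vz1 Vz2.
have [U [z [cU sU [zs tzs ttzs] [Uz H]]]] := moves_point tt ty.
have [U' [z' [cU' sU' [zs' tzs' ttzs'] [Uz' H']]]] := moves_point ts sy.
have dis w w' : support t w -> support s w' -> w != w'.
  move=> /st Vw /ss Vw'; apply/eqP => e.
  by have : set0 w by rewrite -VV'; split=> //; rewrite e.
have [d1 d2 d3] : [/\ z != t z, z != t (t z) & t z != t (t z)].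
  move: sU => [[ab [ac _]] [[bc _] _]].
  by split; apply/eqP; [exact: ab | exact: ac | exact: bc].
have [d1' d2' d3'] : [/\ z' != s z', z' != s (s z') & s z' != s (s z')].
  move: sU' => [[ab [ac _]] [[bc _] _]].
  by split; apply/eqP; [exact: ab | exact: ac | exact: bc].
have u : uniq [:: z; t z; t (t z); z'; s z'; s (s z')].
  by rewrite /= !inE !negb_or d1 d2 d3 d1' d2' d3' !dis.
have [oV1 _] := cV1; have [oV2 _] := cV2.
have [||k [Ak kO _]] := @transport _ _ _ homeo_a compactZ zdZ hsZ perfectZ minimal_a setT
  [:: (z, V1); (t z, V1); (t (t z), V1); (z', V2); (s z', V2); (s (s z'), V2)]
  [::] (@clopenT Z).
- by rewrite cats0.
- move=> p; rewrite !inE; do !(case/predU1P=> [->|]); last move/eqP=> ->;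
    split=> //; by [exists z1 | exists z2].
have Ak' := alt_on_alternating Ak; have Fk := full_alternating Ak'.
have piece (r : G) w W O : (forall v, v \in [:: w; r w; r (r w)] -> O (k v)) -> clopen O ->
    clopen W -> scattered W [:: 1; r : homeo Z; (r : homeo Z) * r] ->
    (forall O, open O -> O w -> exists A, [/\ clopen A, A `<=` O, A `<=` W &
      b (to_alt (cyc 1 r ((r : homeo Z) * r) A)) y <> y]) -> moves O (b (to_alt k) y).
  move=> kvO cO cW sW HW; have [oO _] := cO.
  pose Ok (h : homeo Z) := (k * h)%g @^-1` O.
  have oOk h : open (Ok h) by exact: open_preimage.
  have [||A [cA AO AW ry]] := HW (Ok 1 `&` Ok r `&` Ok ((r : homeo Z) * r)).
  + by apply: openI => //; exact: openI.
  + by split; first split; apply: kvO; rewrite !inE eqxx ?orbT.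
  apply: (moves_small Fk _ cA _ _ Ak' ry); first exact: alt_full.
    exact: scattered_sub sW.
  by move=> v /AO[[? ?] ?].
exists (to_alt k); split.
- apply: (piece t z U) => // v vl.
  by move: vl (kO (v, V1)); rewrite !inE => vl /=; apply; move: vl;
    do 2 (case/orP=> [/eqP ->|]; first by rewrite eqxx ?orbT); move=> /eqP ->; rewrite eqxx ?orbT.
- apply: (piece s z' U') => // v vl.
  by move: vl (kO (v, V2)); rewrite !inE => vl /=; apply; move: vl;
    do 2 (case/orP=> [/eqP ->|]; first by rewrite eqxx ?orbT); move=> /eqP ->; rewrite eqxx ?orbT.
Qed.

End Moves.
End AlternatingActions.

(** * Words in subgroups and images, and large fibres *)
Section Words.
Local Open Scope group_scope.
Local Open Scope classical_set_scope.
Local Notation ball := Defs.ball.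

Lemma ball_subgroup (G : groupType) (F : seq G) (K : set G) n : is_subgroup K ->
  (forall x, x \in F -> K x) -> ball F n `<=` K.
Proof.
move=> [K1 KM _] FK x [w [_ wF ->]]; elim: w wF => [|y w IH] wF.
  by rewrite big_nil.
rewrite big_cons; apply: (KM _ _); first by apply/FK/wF; rewrite mem_head.
by apply: IH => z zw; apply: wF; rewrite inE zw orbT.
Qed.

Lemma ball_hom (G L : groupType) (f : G -> L) (F : seq G) n x : f 1 = 1 ->
  (forall x y, f (x * y) = f x * f y) -> ball F n x -> ball [seq f x | x <- F] n (f x).
Proof.
move=> f1 fM [w [sw wF ->]]; exists (map f w); split.
- by rewrite size_map.
- by move=> _ /mapP[y /wF yF ->]; exact: map_f.
- by rewrite big_map; elim/big_rec2: _ => // i y z _ <-; rewrite fM.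
Qed.

Lemma ball_expand (G : groupType) (F T : seq G) C n :
  (forall x, x \in F -> ball T C x) -> ball F n `<=` ball T (C * n).
Proof.
move=> FT; elim: n => [|n IH] x; first by move=> /ball0 ->; exact: ball1.
move=> /ballS[/IH|[s [y [sF /IH By ->]]]].
  by apply: ball_le; rewrite leq_mul.
by rewrite mulnS; apply: ballM => //; exact: FT.
Qed.

Lemma ball_subset (G : groupType) (F T : seq G) n :
  {subset F <= T} -> ball F n `<=` ball T n.
Proof. by move=> FT x [w [sw wF ->]]; exists w; split=> // y /wF/FT. Qed.

Lemma scattered_apart (Z : topologicalType) (Y : set Z) (I : eqType)
    (f : I -> homeo Z) (l : seq I) i j : scattered Y [seq f i | i <- l] ->
  i \in l -> j \in l -> i <> j -> apart Y (f i) (f j).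
Proof.
elim: l => //= k l IH [kl /IH{}IH].
have kf m : m \in l -> apart Y (f k) (f m).
  elim: l kl {IH} => //= n l IH [kn /IH{}IH].
  by rewrite inE => /predU1P[->|/IH].
rewrite !inE => /predU1P[->|il] /predU1P[->|jl] ij //; first exact: kf.
  by apply/apart_sym/kf.
exact: IH.
Qed.

Lemma large_fibre (m n : nat) (O : finType) (f : 'I_(m * n) -> O) : (#|O| <= m)%N ->
  (0 < m)%N -> (0 < n)%N ->
  exists o (phi : 'I_n -> 'I_(m * n)), injective phi /\ forall i, f (phi i) = o.
Proof.
move=> Om m0 n0; have [o no] : exists o, (n <= #|[pred j | f j == o]|)%N.
  apply: contrapT => H.
  have small o : (#|[pred j | f j == o]| <= n.-1)%N.
    by rewrite -ltnS prednK // ltnNge; apply/negP => no; apply: H; exists o.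
  have : (m * n <= m * n.-1)%N.
    rewrite -{1}[(m * n)%N]card_ord -sum1_card (partition_big f predT) //=.
    apply: (@leq_trans (\sum_(o : O) n.-1)).
      by apply: leq_sum => o _; rewrite sum1_card; exact: small.
    by rewrite sum_nat_const leq_mul2r Om orbT.
  by rewrite leq_pmul2l // -ltnS prednK // ltnn.
exists o, (fun i => enum_val (widen_ord no i)); split=> [i j /enum_val_inj e|i].
  by apply: val_inj; exact: (congr1 val e).
by have := enum_valP (widen_ord no i); rewrite inE => /eqP.
Qed.

End Words.

(** * Growth of actions of the alternating full group *)
Section Gap.
Local Open Scope classical_set_scope.
Local Open Scope group_scope.
Local Notation ball := Defs.ball.
Local Notation support := Defs.support.
Variables (cG : groupType) (Z : topologicalType) (a : action cG Z) (S : seq cG).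
Hypothesis genS : symmetric_generating_set S.
Hypothesis homeo_a : by_homeomorphisms a.
Hypothesis compactZ : compact [set: Z].
Hypothesis zdZ : zero_dimensional Z.
Hypothesis hsZ : hausdorff_space Z.
Hypothesis perfectZ : perfect_set [set: Z].
Hypothesis minimal_a : minimal_action a.
Local Notation hh := (to_homeo homeo_a).
Local Notation FG := (topological_full_group a).
Local Notation G := (alternating_full_group a).
Local Notation to_alt := (to_alt a).
Implicit Types (A B D O U V Y W : set Z) (z : Z) (x r q : G).

Section Incoherent.
Variables (X : Type) (b : action G X).

Lemma apart_disjoint V x r : apart V x r -> (x @` V) `&` (r @` V) = set0.
Proof. by move=> H; rewrite -subset0 => _ [[v Vv <-] [w Vw /esym]]; exact: H. Qed.

(** Elements that move V off itself conjugate alt_on V to a group that commutes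
    with it, so avoid_fixed_points applies. *)
Lemma moves_avoid V z y (P : seq G) : clopen V -> V z -> moves b V y ->
  (forall p, p \in P -> apart V p 1) ->
  exists2 s : G, alt_on a V s & forall p, p \in P -> b p (b s y) <> b s y.
Proof.
move=> cV Vz [t [tt st ty]] PV.
suff [s As sP] : exists2 s, @alt_elts _ _ a V s & forall p, p \in P -> b p (b s y) <> b s y.
  by exists s.
apply: avoid_fixed_points.
- exact: alt_elts_subgroup.
- exact: (alt_elts_infinite homeo_a compactZ zdZ hsZ perfectZ minimal_a cV Vz).
- exact: (alt_elts_simple homeo_a compactZ zdZ hsZ perfectZ minimal_a cV).
- exact: (alt_elts_nonabelian homeo_a compactZ zdZ hsZ perfectZ minimal_a cV Vz).
- move=> p x r pP Ax Ar; apply: val_inj.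
  have Ap : alt_on a (p @` V) ((p : homeo Z) * r * (p : homeo Z)^-1).
    by apply: alt_on_conj => //; exact: alt_full.
  apply: (alt_on_commute Ax Ap); rewrite -subset0 => w [Vw [v Vv e]].
  exact: (PV _ pP v w Vv Vw).
- by exists t => //; exact: three_cycle_alt_on.
Qed.

(** The points are r q y, with f(n) words r that separate a point zc where f(n) is
    attained, and n words q supported in a clopen set D that omits zc. By
    moves_place, y may be chosen to be moved over V1 near zc and over V2 in D. If
    two of the points coincide, y is fixed by some (r' q')^-1 (r q). When r and r'
    differ, this element moves V1 off itself, as q and q' fix V1 pointwise; when
    r = r', it is q'^-1 q, which moves V2 off itself. So replace y by s1 s2 y,
    where s2, supported in V2, avoids the fixed points of the elements q'^-1 q,
    and then s1, supported in V1, those of the others; s1 does not spoil the first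
    choice, because it commutes with the words q. *)
Lemma incoherent_growth : ~ coherent b -> Z -> exists F : seq G, forall n,
  exists y (f : 'I_(vol S a n) * 'I_n -> G),
    (forall p, ball F (n + n) (f p)) /\ injective (fun p => b (f p) y).
Proof.
move=> incoh z0.
have [W [W' [y0 [WW' yW yW']]]] : exists W W' y, [/\ W `&` W' = set0, moves b W y & moves b W' y].
  by apply: contrapT => H; apply: incoh => V V' y *; apply: H; exists V, V', y.
(* Every point is outside one of two fixed clopen sets, in which a factor n of
   growth is available. *)
have [z1 _ ] := open_infinite hsZ perfectZ [:: z0] (@openT Z) (I : setT z0).
rewrite inE => z10.
have [D1 [cD1 D1z1 nD1z0]] := zdZ z10.
have cD0 : clopen (~` D1) by exact: clopenC.
have [F0 [F0D HF0]] := linear_growth_inside genS homeo_a compactZ zdZ hsZ perfectZ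
  minimal_a cD0 nD1z0.
have [F1 [F1D HF1]] := linear_growth_inside genS homeo_a compactZ zdZ hsZ perfectZ
  minimal_a cD1 D1z1.
have [FZ HFZ] := realize_words S homeo_a compactZ zdZ hsZ perfectZ minimal_a.
exists (FZ ++ F0 ++ F1) => n.
have [zc [g [Bg gi]]] := vol_attained S a n z0.
have /choice[r rP] : forall i, exists x : G, ball FZ n x /\ x zc = a (g i) zc.
  by move=> i; have [x Bx e] := HFZ n (g i) zc (Bg i); exists x.
have [D [zd [FD [cD Dzd nDzc [FDD FDs HFD]]]]] : exists D zd FD,
    [/\ clopen D, D zd, ~ D zc & [/\ (forall x, x \in FD -> alt_on a D x),
      {subset FD <= F0 ++ F1} &
      forall n, exists l : seq G, [/\ size l = n.+1, uniq [seq (x : G) zd | x <- l],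
        1 \in l & forall x, x \in l -> ball FD n x]]].
  have [D1zc|nD1zc] := pselect (D1 zc).
    exists (~` D1), z0, F0; split; [exact: cD0 | exact: nD1z0 | by move=> /(_ D1zc) |].
    by split; [exact: F0D | move=> x xF; rewrite mem_cat xF | exact: HF0].
  exists D1, z1, F1; split=> //; split; [exact: F1D | | exact: HF1].
  by move=> x xF; rewrite mem_cat xF orbT.
have [l [sl ul _ lB]] := HFD n.
have lD q : q \in l -> alt_on a D q.
  move=> /lB; apply: (@ball_subgroup _ _ [set q : G | alt_on a D q]) => //.
  exact: alt_elts_subgroup.
have [V1 [cV1 V1zc [V1D V1s]]] : exists V, [/\ clopen V, V zc &
    V `<=` ~` D /\ scattered V [seq (r i : homeo Z) | i <- enum 'I_(vol S a n)]].
  apply: small_ex => //; apply: smallI.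
    by apply: small_sub => //; have [_] := cD; exact: closed_openC.
  apply: small_scattered => //; rewrite -map_comp map_inj_uniq ?enum_uniq //.
  by move=> i j /=; rewrite !(rP _).2; exact: gi.
have [V2 [cV2 V2zd [V2D V2s]]] : exists V, [/\ clopen V, V zd &
    V `<=` D /\ scattered V [seq (x : homeo Z) | x <- l]].
  apply: small_ex => //; apply: smallI.
    by apply: small_sub => //; case: cD.
  by apply: small_scattered => //; rewrite -map_comp.
have V12 : V1 `&` V2 = set0 by rewrite -subset0 => w [/V1D + /V2D].
have [s [y1V1 y1V2]] := moves_place homeo_a compactZ zdZ hsZ perfectZ minimal_a
  WW' yW yW' cV1 cV2 V1zc V2zd.
set y1 := b s y0 in y1V1 y1V2.
pose P2 := [seq p : G <- [seq q'^-1 * q | q' <- l, q <- l] | `[< apart V2 p 1 >]].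
have [|s2 As2 y2P] := @moves_avoid V2 zd y1 P2 cV2 V2zd y1V2.
  by move=> p; rewrite mem_filter => /andP[/asboolP].
have y2V1 : moves b V1 (b s2 y1).
  have [t [tt st ty]] := y1V1; exists t; split=> //.
  have comm : t * s2 = s2 * t.
    apply: val_inj; apply: (alt_on_commute (three_cycle_alt_on tt st) As2) => //.
  by rewrite -actM comm actM => e; apply: ty; exact: (act_inj (g := s2) e).
set y2 := b s2 y1 in y2P y2V1.
have le_n j : (j < n -> j < size l)%N by rewrite sl => /ltnW.
pose f (p : 'I_(vol S a n) * 'I_n) : G := r p.1 * nth 1 l p.2.
pose P1 := [seq p : G <- [seq (f p')^-1 * f p | p' <- enum {: 'I_(vol S a n) * 'I_n},
  p <- enum {: 'I_(vol S a n) * 'I_n}] | `[< apart V1 p 1 >]].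
have [|s1 As1 y3P] := @moves_avoid V1 zc y2 P1 cV1 V1zc y2V1.
  by move=> p; rewrite mem_filter => /andP[/asboolP].
have nl (j : 'I_n) : nth 1 l j \in l by apply/mem_nth/le_n.
have fixV1 q v : q \in l -> V1 v -> q v = v.
  by move=> /lD Aq /V1D nDv; exact: alt_on_out Aq nDv.
exists (b s1 y2), f; split.
  move=> p; apply: ballM.
    apply: (@ball_subset _ FZ) => [x xF|]; first by rewrite mem_cat xF.
    by case: (rP p.1).
  apply: (@ball_subset _ FD) => [x /FDs xF|]; first by rewrite mem_cat xF orbT.
  by apply: lB; exact: nl.
move=> [i j] [i' j'] e.
have e' : b ((f (i', j'))^-1 * f (i, j)) (b s1 y2) = b s1 y2 by rewrite actM e actK.
have [ii'|/eqP ii'] := eqVneq i i'; last first.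
  case: (y3P ((f (i', j'))^-1 * f (i, j))) => //.
  rewrite mem_filter; apply/andP; split; last by apply: allpairs_f; rewrite mem_enum.
  apply/asboolP => v w Vv Vw; rewrite alt_valM alt_valV !homeoME homeo1E => ew.
  have : f (i, j) v = f (i', j') w by rewrite -ew hVK.
  rewrite /f /= (fixV1 _ _ (nl j) Vv) (fixV1 _ _ (nl j') Vw) => ev.
  apply: (scattered_apart V1s _ _ ii' Vv Vw ev); exact: mem_enum.
subst i'; congr (_, _); apply: contrapT => jj'.
have nn : nth 1 l j <> nth 1 l j'.
  move=> /eqP; rewrite nth_uniq ?le_n //; last exact: map_uniq ul.
  by move=> /eqP ej; apply: jj'; exact: val_inj.
have fE : (f (i, j'))^-1 * f (i, j) = (nth 1 l j')^-1 * nth 1 l j.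
  by rewrite /f /= invgM -!mulgA mulKg.
case: (y2P ((nth 1 l j')^-1 * nth 1 l j)).
  rewrite mem_filter; apply/andP; split; last by apply: allpairs_f.
  apply/asboolP => v w Vv Vw; rewrite alt_valM alt_valV !homeoME homeo1E => ew.
  apply: (scattered_apart V2s (nl j) (nl j') nn Vv Vw).
  by rewrite -ew hVK.
have comm : ((nth 1 l j')^-1 * nth 1 l j) * s1 = s1 * ((nth 1 l j')^-1 * nth 1 l j).
  apply: val_inj; apply: (alt_on_commute (U := D) (V := V1)); last 2 first.
    exact: As1.
    by rewrite -subset0 => w [Dw /V1D].
  by apply: alt_onM; [apply: alt_onV |]; apply: lD.
by apply: (act_inj (a := b) (g := s1)); rewrite -actM -comm actM -fE.
Qed.

End Incoherent.
Section Coherent.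
Variables (X : Type) (b : action G X).
Hypothesis coh : coherent b.
Local Notation cyc3 g g' V := (to_alt (cyc 1 (hh g) (hh g') V)).
Implicit Types (g : cG).

Definition legs g g' V := V `|` hh g @` V `|` hh g' @` V.

Lemma alternating_cyc3 g g' V : alternating_full_set a (cyc 1 (hh g) (hh g') V).
Proof. by apply: alternating_cyc; [exact: full1 | exact: full_hh | exact: full_hh]. Qed.

Lemma cyc3_moves g g' V y : b (cyc3 g g' V) y <> y -> moves b (legs g g' V) y.
Proof.
move=> ty; exists (cyc3 g g' V); rewrite to_altK; last exact: alternating_cyc3.
split=> //.
  by apply: three_cycle_cyc; [exact: full1 | exact: full_hh | exact: full_hh].
apply: support_cyc => v Vv; split.
- by left; left.
- by left; right; exists v.
- by right; exists v.
Qed.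

Lemma legs_disjoint g g' W V V' : scattered W [:: 1; hh g; hh g'] -> V `<=` W ->
  V' `<=` W -> V `&` V' = set0 -> legs g g' V `&` legs g g' V' = set0.
Proof.
move=> [[ab [ac _]] [[bc _] _]] VW VW' VV'; rewrite -subset0 => z.
have nV v : V v -> V' v -> False by move=> ? ?; have : set0 v by rewrite -VV'.
move=> [[[Vz|[v Vv vz]]|[v Vv vz]] [[Vz'|[v' Vv' vz']]|[v' Vv' vz']]].
- exact: nV Vz'.
- by apply: (ab z v'); auto.
- by apply: (ac z v'); auto.
- by apply: (ab z v); auto.
- by apply: (nV v) => //; rewrite (_ : v = v') //; apply: (@homeo_inj _ (hh g)); rewrite vz.
- by apply: (bc v v'); auto; rewrite vz.
- by apply: (ac z v); auto.
- by apply: (bc v' v); auto; rewrite vz.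
- by apply: (nV v) => //; rewrite (_ : v = v') //; apply: (@homeo_inj _ (hh g')); rewrite vz.
Qed.

(** Suppose that y is fixed by everything supported in one of V, gV and g'V. Let k
    be a 3-cycle in V that moves a small set A off itself. Then y is fixed by
    c = k (g k g^-1) (g' k g'^-1), which conjugates the piece over A to the piece
    over k(A). If the piece over A moves y, so does the disjoint one over k(A),
    against coherence. So no small piece moves y. *)
Lemma coherent_leg g g' V y : clopen V -> scattered V [:: 1; hh g; hh g'] ->
  b (cyc3 g g' V) y <> y ->
  [\/ moves b V y, moves b (hh g @` V) y | moves b (hh g' @` V) y].
Proof.
move=> cV sV ty; apply: contrapT => nm; apply: ty.
have [oV _] := cV.
have [[ab [ac _]] [[bc _] _]] := sV.
have n1 (t : G) : three_cycle a t -> support t `<=` V -> b t y = y.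
  by move=> tt st; apply: contrapT => e; apply: nm; apply: Or31; exists t.
have n2 (t : G) : three_cycle a t -> support t `<=` hh g @` V -> b t y = y.
  by move=> tt st; apply: contrapT => e; apply: nm; apply: Or32; exists t.
have n3 (t : G) : three_cycle a t -> support t `<=` hh g' @` V -> b t y = y.
  by move=> tt st; apply: contrapT => e; apply: nm; apply: Or33; exists t.
apply: (clopen_ind compactZ zdZ (P := fun A => b (cyc3 g g' A) y = y)) => //.
- rewrite cyc0 (_ : to_alt 1 = 1) ?act1 //; exact: (alt_valK (1 : G)).
- move=> A B cA cB AV BV AB eA eB; rewrite cyc_union //.
    by rewrite to_altM ?actM ?eB //; exact: alternating_cyc3.
  by apply: scattered_sub sV => w [/AV|/BV].
move=> z Vz.
have [g1 Vg1] := orbit_meets hsZ perfectZ minimal_a z [:: z] oV Vz.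
rewrite inE => u1.
have [g2 Vg2] := orbit_meets hsZ perfectZ minimal_a z [:: z; a g1 z] oV Vz.
rewrite !inE negb_or => /andP[u2 u3].
have [B [cB Bz [sB [BV [B1 B2]]]]] : exists B, [/\ clopen B, B z &
    scattered B [:: 1; hh g1; hh g2] /\ B `<=` V /\
    (forall w, B w -> V (hh g1 w)) /\ (forall w, B w -> V (hh g2 w))].
  apply: small_ex => //; apply: smallI.
    by apply: small_scattered => //=; rewrite !inE negb_or ![z == _]eq_sym u1 u2 eq_sym u3.
  apply: smallI; first exact: small_sub.
  by apply: smallI; exact: small_image_sub.
pose k := cyc 1 (hh g1) (hh g2) B.
have Fk : FG k by apply: full_cyc; [exact: full1 | exact: full_hh | exact: full_hh].
have tk : three_cycle a k.
  by apply: three_cycle_cyc; [exact: full1 | exact: full_hh | exact: full_hh].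
have sk : support k `<=` V.
  by apply: support_cyc => w Bw; split; [exact: BV | exact: B1 | exact: B2].
have kout w : ~ V w -> k w = w by move=> nVw; apply: contrapT => kw; exact/nVw/sk.
have kin w : V w -> V (k w) by apply: (alt_on_in (three_cycle_alt_on tk sk)).
have kz : k z <> (1 : homeo Z) z.
  by rewrite /k -[in k z](homeo1E z) cyc_a //; exact/eqP.
have [O [oO Oz HO]] := smallI (small_sub oV Vz) (small_apart zdZ kz).
exists O; split=> // A cA AO AV; have [_ apA] := HO A cA AO.
apply: contrapT => sy.
have [kk kkE] : exists kk : cG -> homeo Z, forall p, kk p = hh p * k * (hh p)^-1.
  by exists (fun p => hh p * k * (hh p)^-1).
have tkk p : three_cycle a (kk p).
  by rewrite kkE; apply: three_cycle_conj => //; exact: full_hh.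
have skk p : support (kk p) `<=` hh p @` V.
  by rewrite kkE support_conj => _ [w /sk Vw <-]; exists w.
have kkout p w : ~ (hh p @` V) w -> kk p w = w.
  by move=> nw; apply: contrapT => kw; exact/nw/skk.
have alt3 t : three_cycle a t -> alternating_full_set a t.
  by move=> tt; exact: sub_subgroup_generated.
have [_ AM _] := subgroup_generatedP [set h | three_cycle a h].
pose c := k * kk g * kk g'.
have Ac : alternating_full_set a c.
  have Ac := AM _ _ (AM _ _ (alt3 _ tk) (alt3 _ (tkk g))) (alt3 _ (tkk g')).
  exact Ac.
have cy : b (to_alt c) y = y.
  have e1 := alt3 _ tk; have e2 := alt3 _ (tkk g); have e3 := alt3 _ (tkk g').
  rewrite /c !to_altM //; last by have e12 := AM _ _ e1 e2; exact e12.
  have f1 : b (to_alt k) y = y by apply: n1; rewrite to_altK.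
  have f2 : b (to_alt (kk g)) y = y by apply: n2; rewrite to_altK.
  have f3 : b (to_alt (kk g')) y = y by apply: n3; rewrite to_altK.
  by rewrite !actM f3 f2.
have disV p w : V w -> apart V 1 (hh p) -> ~ (hh p @` V) w.
  by move=> Vw ap [v Vv e]; apply: (ap w v) => //; rewrite e.
have disg w : V w -> ~ V (hh g w) by move=> Vw Vgw; exact: (ab _ _ Vgw Vw).
have disg' w : V w -> ~ V (hh g' w) by move=> Vw Vgw; exact: (ac _ _ Vgw Vw).
have disgg w : V w -> ~ (hh g' @` V) (hh g w).
  by move=> Vw [v Vv e]; exact: (bc _ _ Vw Vv (esym e)).
have disgg' w : V w -> ~ (hh g @` V) (hh g' w).
  by move=> Vw [v Vv e]; exact: (bc _ _ Vv Vw e).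
have c1 w : A w -> (c * 1) w = (1 * k) w.
  move=> /AV Vw; rewrite mulg1 mul1g /c !homeoME.
  rewrite (kkout g'); last exact: disV.
  by rewrite kkout //; exact: disV.
have c2 w : A w -> (c * hh g) w = (hh g * k) w.
  move=> /AV Vw; rewrite /c !homeoME (kkout g'); last exact: disgg.
  by rewrite kkE !homeoME hK kout //; apply: disg; exact: kin.
have c3 w : A w -> (c * hh g') w = (hh g' * k) w.
  move=> /AV Vw; rewrite /c !homeoME (kkE g') !homeoME hK kkout; last first.
    by apply: disgg'; exact: kin.
  by rewrite kout //; apply: disg'; exact: kin.
have sA : scattered A [:: 1; hh g; hh g'] by exact: scattered_sub sV.
have skA : scattered (k @` A) [:: 1; hh g; hh g'].
  by apply: scattered_sub sV => _ [w /AV Vw <-]; exact: kin.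
have conjE : c * cyc 1 (hh g) (hh g') A * c^-1 = cyc 1 (hh g) (hh g') (k @` A).
  rewrite cyc_conj // cyc_image //; apply: eq_cyc => //.
  by move: sA => [[? [? _]] [[? _] _]]; do !split=> //; exact: apart_left.
have sy' : b (cyc3 g g' (k @` A)) y <> y.
  have -> : cyc3 g g' (k @` A) = to_alt c * cyc3 g g' A * (to_alt c)^-1.
    apply: val_inj; change (cyc3 g g' (k @` A) =
      to_alt c * cyc3 g g' A * (to_alt c)^-1 :> homeo Z).
    by rewrite !alt_valM alt_valV !to_altK // ?conjE //; exact: alternating_cyc3.
  rewrite !actM -{1}cy actK => e; apply: sy.
  by apply: (act_inj (a := b) (g := to_alt c)); rewrite e cy.
apply: (coh (V := legs g g' A) (V' := legs g g' (k @` A)) (y := y)).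
- apply: (legs_disjoint sV AV) => [_ [w /AV Vw <-]|]; first exact: kin.
  by rewrite -subset0 => w [Aw [v Av vw]]; apply: (apA v w).
- exact: cyc3_moves.
- exact: cyc3_moves.
Qed.

(** The 3-cycle over W is the one over V times a disjoint one, which fixes y. *)
Lemma coherent_enlarge g g' V W y : clopen V -> clopen W -> V `<=` W ->
  scattered W [:: 1; hh g; hh g'] -> b (cyc3 g g' V) y <> y ->
  b (cyc3 g g' W) y = b (cyc3 g g' V) y.
Proof.
move=> cV cW VW sW ty.
have cD : clopen (W `\` V) by apply: clopenI => //; exact: clopenC.
have VD : V `&` (W `\` V) = set0 by rewrite setDE setICA setICr setI0.
have -> : cyc 1 (hh g) (hh g') W =
    cyc 1 (hh g) (hh g') V * cyc 1 (hh g) (hh g') (W `\` V).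
  by rewrite -cyc_union ?setDUK.
rewrite to_altM; try exact: alternating_cyc3.
rewrite actM; congr (b _ _); apply: contrapT => ty'.
apply: (coh (V := legs g g' V) (V' := legs g g' (W `\` V)) (y := y)).
- by apply: (legs_disjoint sW) => // w [].
- exact: cyc3_moves.
- exact: cyc3_moves.
Qed.

(** The 3-cycle over W permutes the three legs of V, and V is the first one. *)
Lemma coherent_shift g g' V W y : clopen V -> clopen W -> V `<=` W ->
  scattered W [:: 1; hh g; hh g'] -> b (cyc3 g g' V) y <> y ->
  exists i : 'I_3, moves b V (b (cyc3 g g' W ^+ i) y).
Proof.
move=> cV cW VW sW ty; have sV := scattered_sub VW sW.
set t := cyc3 g g' W.
have tE : t = cyc 1 (hh g) (hh g') W :> homeo Z by rewrite to_altK //; exact: alternating_cyc3.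
have t2 : t @` (hh g @` V) `<=` hh g' @` V.
  by move=> _ [_ [v Vv <-] <-]; exists v => //; rewrite tE cyc_b //; exact: VW.
have t3 : t @` (hh g' @` V) `<=` V.
  by move=> _ [_ [v Vv <-] <-]; rewrite tE cyc_c //; exact: VW.
have [m|m|m] := coherent_leg cV sV ty.
- by exists (inord 0); rewrite inordK // expg0 act1.
- exists (inord 2); rewrite inordK // !expgS expg0 mulg1 actM.
  apply: (movesS t3); apply: moves_conj => //; apply: (movesS t2); exact: moves_conj.
- by exists (inord 1); rewrite inordK // expg1; apply: (movesS t3); exact: moves_conj.
Qed.

End Coherent.

Lemma disjoint_leg_cover : exists l : seq (set Z * cG * cG),
  (forall e, e \in l -> clopen e.1.1 /\ scattered e.1.1 [:: 1; hh e.1.2; hh e.2]) /\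
  forall z, exists2 e, e \in l & e.1.1 z.
Proof.
pose P Y := exists l : seq (set Z * cG * cG),
  (forall e, e \in l -> clopen e.1.1 /\ scattered e.1.1 [:: 1; hh e.1.2; hh e.2]) /\
  forall z, Y z -> exists2 e, e \in l & e.1.1 z.
suff [l [lP lc]] : P setT by exists l; split=> // z; exact: lc.
apply: (clopen_ind compactZ zdZ (P := P)).
- by exists [::].
- move=> A B _ _ _ _ _ [l [lP lA]] [l' [lP' lB]]; exists (l ++ l'); split.
    by move=> e; rewrite mem_cat => /orP[/lP|/lP'].
  by move=> z [/lA|/lB] [e el ez]; exists e => //; rewrite mem_cat el ?orbT.
- move=> z _.
  have [g _] := orbit_meets hsZ perfectZ minimal_a z [:: z] (@openT Z) (I : setT z).
  rewrite inE => u1.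
  have [g' _] := orbit_meets hsZ perfectZ minimal_a z [:: z; a g z] (@openT Z) (I : setT z).
  rewrite !inE negb_or => /andP[u2 u3].
  have [W [cW Wz sW]] : exists W, [/\ clopen W, W z & scattered W [:: 1; hh g; hh g']].
    apply: small_ex => //; apply: small_scattered => //=.
    by rewrite !inE negb_or ![z == _]eq_sym u1 u2 eq_sym u3.
  exists W; split=> //; first by case: cW.
  move=> A _ AW _; exists [:: (W, g, g')]; split.
    by move=> e; rewrite inE => /eqP ->.
  by move=> w /AW Ww; exists (W, g, g') => //; rewrite mem_head.
- exact: clopenT.
Qed.

End Gap.

(** * Coherent actions of a free product *)
Section FreeProductGap.
Local Open Scope classical_set_scope.
Local Open Scope group_scope.
Local Notation ball := Defs.ball.
Variables (cG : groupType) (Z : topologicalType) (a : action cG Z) (S : seq cG).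
Hypothesis genS : symmetric_generating_set S.
Hypothesis homeo_a : by_homeomorphisms a.
Hypothesis compactZ : compact [set: Z].
Hypothesis zdZ : zero_dimensional Z.
Hypothesis hsZ : hausdorff_space Z.
Hypothesis perfectZ : perfect_set [set: Z].
Hypothesis minimal_a : minimal_action a.
Variable z0 : Z.
Local Notation hh := (to_homeo homeo_a).
Local Notation G := (alternating_full_group a).
Local Notation to_alt := (to_alt a).
Local Notation cyc3 g g' V := (to_alt (cyc 1 (hh g) (hh g') V)).

Variables (L : groupType) (X : Type) (c : action L X) (emb : G -> L) (h : L).
Hypotheses (emb1 : emb 1 = 1) (embM : forall x y, emb (x * y) = emb x * emb y).
Hypothesis faithful_c : faithful c.
Hypothesis emb_h : forall t, t <> 1 -> forall k, (0 < k)%N ->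
  (emb t * h^-1 * emb t * h) ^+ k <> 1.

Lemma restricted_act1 y : c (emb 1) y = y.
Proof. by rewrite emb1 act1. Qed.

Lemma restricted_actM x x' y : c (emb (x * x')) y = c (emb x) (c (emb x') y).
Proof. by rewrite embM actM. Qed.

Definition restricted_action : action G X :=
  @Action G X (fun x => c (emb x)) restricted_act1 restricted_actM.
Local Notation b := restricted_action.

Lemma fixed_power u x k : c u x = x -> c (u ^+ k) x = x.
Proof. by move=> ux; elim: k => [|k IH]; rewrite ?expg0 ?act1 // expgS actM IH. Qed.

(** If the points u^0 x, ..., u^M x are not distinct then x has period at most M,
    hence is fixed by u ^+ M`!. *)
Lemma long_orbit u M : (forall k, (0 < k)%N -> u ^+ k <> 1) ->
  exists x, forall i j, (i < j <= M)%N -> c (u ^+ i) x <> c (u ^+ j) x.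
Proof.
move=> u_inf; have [x ux] : exists x, c (u ^+ M`!) x <> x.
  apply: contrapT => H; apply: (u_inf _ (fact_gt0 M)); apply: faithful_c => x.
  by apply: contrapT => ux; apply: H; exists x.
exists x => i j /andP[ij jM] e; apply: ux.
have ud : c (u ^+ (j - i)) x = x.
  apply: (act_inj (a := c) (g := u ^+ i)).
  by rewrite -actM -expgnDr subnKC ?(ltnW ij).
have /dvdnP[k ->] : (j - i %| M`!)%N.
  by apply: dvdn_fact; rewrite subn_gt0 ij (leq_trans (leq_subr _ _) jM).
by rewrite mulnC expgnA; exact: fixed_power.
Qed.

(** Let f(n) be attained at zc, with words r, and let t = (1 q q') over a small
    neighbourhood V of zc. The element u = t h^-1 t h has orbits of more than 6 n
    points. Although t is a long word, on each point it is trivial or equal to the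
    3-cycle tW over a set W from a finite list, so u^j x is at distance O(j) from
    x. As u does not fix x_j = u^j x, the element t moves x_j or h x_j, and then V
    moves the image of this point by a power of tW: there are 6 cases, one of
    which occurs for n of the indices j. The resulting points p are distinct and
    moved by V. Finally the points r p are distinct: r p = r' p' with r and r'
    different would be moved by the disjoint sets r(V) and r'(V).

    In radius 28 n: n letters for r, 3 for the passage from x_j to p, and 4 for
    each of the at most 6 n factors u. *)
Lemma coherent_growth : coherent b -> exists F : seq L, forall n, (0 < n)%N ->
  exists x (f : 'I_(vol S a n) * 'I_n -> L),
    (forall p, ball F (28 * n) (f p)) /\ injective (fun p => c (f p) x).
Proof.
move=> coh.
have [cover [coverP coverZ]] := disjoint_leg_cover homeo_a compactZ zdZ hsZ perfectZ minimal_a.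
have [FZ HFZ] := realize_words S homeo_a compactZ zdZ hsZ perfectZ minimal_a.
pose F := [seq emb (cyc3 e.1.2 e.2 e.1.1) | e <- cover] ++ [:: h; h^-1] ++ [seq emb x | x <- FZ].
exists F => n n0.
have [zc [g [Bg gi]]] := vol_attained S a n z0.
have /choice[r rP] : forall i, exists x : G, ball FZ n x /\ x zc = a (g i) zc.
  by move=> i; have [x Bx e] := HFZ n (g i) zc (Bg i); exists x.
have [[[W q] q'] el Wzc] := coverZ zc.
have [cW sW] : clopen W /\ scattered W [:: 1; hh q; hh q'] := coverP _ el.
have [oW _] := cW.
have [V [cV Vzc [VW Vs]]] : exists V, [/\ clopen V, V zc &
    V `<=` W /\ scattered V [seq (r i : homeo Z) | i <- enum 'I_(vol S a n)]].
  apply: small_ex => //; apply: smallI; first exact: small_sub.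
  apply: small_scattered => //; rewrite -map_comp map_inj_uniq ?enum_uniq //.
  by move=> i j /=; rewrite !(rP _).2; exact: gi.
have sV := scattered_sub VW sW.
pose t := cyc3 q q' V; pose tW := cyc3 q q' W.
have t1 : t <> 1.
  move=> /(congr1 (fun x : G => x zc)); rewrite /t to_altK; last exact: alternating_cyc3.
  rewrite -{1}[zc]homeo1E cyc_a // => e.
  by have [[ab _] _] := sV; exact: (ab _ _ Vzc Vzc (esym e)).
have [u uE] : exists u, u = emb t * h^-1 * emb t * h by eexists.
have [x xP] := @long_orbit u (6 * n) ltac:(by rewrite uE; exact: emb_h).
have FtW : emb tW \in F.
  rewrite !mem_cat; apply/orP; left; apply/mapP; exists (W, q, q') => //.
have Fh : h \in F by rewrite !mem_cat mem_head orbT.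
have FhV : h^-1 \in F by rewrite !mem_cat !inE eqxx !orbT.
have tstep y : exists2 l, ball F 1 l & c (emb t) y = c l y.
  have [e|ty] := pselect (b t y = y); first by exists 1; [exact: ball1 | rewrite act1].
  exists (emb tW); first exact: ball_mem.
  by symmetry; apply: (coherent_enlarge coh cV cW VW sW ty).
have ustep y : exists2 l, ball F 4 l & c u y = c l y.
  have [l1 B1 e1] := tstep (c h y).
  have [l2 B2 e2] := tstep (c h^-1 (c l1 (c h y))).
  exists (l2 * (h^-1 * (l1 * h))).
    apply: (ballM (m := 1) (n := 3)) => //; apply: (ballM (m := 1) (n := 2)).
      exact: ball_mem.
    by apply: (ballM (m := 1) (n := 1)) => //; exact: ball_mem.
  by rewrite uE !actM e1 e2.
have /choice[l lP] : forall j, exists l, ball F (4 * j) l /\ c (u ^+ j) x = c l x.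
  elim=> [|j [l [Bl e]]]; first by exists 1; split=> //; exact: ball1.
  have [l' Bl' e'] := ustep (c l x); exists (l' * l); split.
    by rewrite mulnS; exact: ballM.
  by rewrite expgS !actM e e'.
pose wd (o : bool * 'I_3) : L := emb tW ^+ o.2 * (if o.1 then h else 1).
have Bwd o : ball F 3 (wd o).
  apply: (@ball_le _ _ (o.2 + 1)); first by rewrite addn1 ltn_ord.
  apply: ballM; last by case: o.1; [exact: ball_mem | exact: ball1].
  elim: (nat_of_ord o.2) => [|k IH]; first exact: ball1.
  by rewrite expgS -add1n; apply: ballM => //; exact: ball_mem.
have embX k : emb tW ^+ k = emb (tW ^+ k).
  by elim: k => [|k IH]; [rewrite !expg0 emb1 | rewrite !expgS embM IH].
have /choice[o oP] : forall j : 'I_(6 * n), exists o, moves b V (c (wd o) (c (u ^+ j) x)).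
  move=> j; have shift y : b t y <> y -> exists i : 'I_3, moves b V (c (emb tW ^+ i) y).
    move=> ty.
    have [i m] := coherent_shift compactZ zdZ hsZ perfectZ minimal_a coh cV cW VW sW ty.
    by exists i; rewrite embX.
  have [ty|/shift[i m]] := pselect (b t (c (u ^+ j) x) = c (u ^+ j) x); last first.
    by exists (false, i); rewrite /wd /= mulg1.
  have [thy|/shift[i m]] := pselect (b t (c h (c (u ^+ j) x)) = c h (c (u ^+ j) x)); last first.
    by exists (true, i); rewrite /wd /= actM.
  case: (xP j j.+1); first by rewrite ltnSn ltn_ord.
  rewrite expgS actM; set y := c (u ^+ j) x in ty thy *.
  rewrite uE !actM; rewrite /= in thy ty.
  by rewrite thy actK ty.
have [||//|o0 [phi [phi_inj phiP]]] := @large_fibre 6 n _ o.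
- by rewrite card_prod card_bool card_ord.
- by [].
exists x, (fun p => emb (r p.1) * (wd o0 * l (phi p.2))); split.
  move=> p; apply: (@ball_le _ _ (n + (3 + 4 * phi p.2))).
    apply: (@leq_trans (n + (3 + 4 * (6 * n)))).
      by rewrite leq_add2l leq_add2l leq_mul2l ltnW ?orbT.
    have -> : (28 * n = n + (3 * n + 4 * (6 * n)))%N.
      by rewrite mulnA -mulnDl -mulSn.
    by rewrite leq_add2l leq_add2r leq_pmulr.
  apply: ballM; last by apply: ballM => //; case: (lP (phi p.2)).
  apply: (@ball_subset _ [seq emb x | x <- FZ]) => [y yF|].
    by rewrite !mem_cat yF !orbT.
  by apply: ball_hom => //; case: (rP p.1).
have mv k : moves b V (c (wd o0 * l (phi k)) x).
  by rewrite actM -(lP _).2 -(phiP k); exact: oP.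
move=> [i k] [i' k'] /=; rewrite !(actM _ (emb _)) => e.
have [ii'|/eqP ii'] := eqVneq i i'; last first.
  exfalso; apply: (coh (r i @` V) (r i' @` V) (b (r i) (c (wd o0 * l (phi k)) x))).
  - apply: apart_disjoint; apply: (scattered_apart Vs _ _ ii'); exact: mem_enum.
  - exact: moves_conj.
  - by rewrite /b /= e; exact: (moves_conj (b := b)).
subst i'; congr (_, _); apply: phi_inj; apply: val_inj.
have {e} : c (u ^+ phi k) x = c (u ^+ phi k') x.
  apply: (act_inj (a := c) (g := wd o0)); rewrite !(lP _).2 -!actM.
  exact: (act_inj (a := c) e).
case: (ltngtP (phi k) (phi k')) => // kk e.
- by case: (xP (phi k) (phi k')); rewrite // kk ltnW.
- by case: (xP (phi k') (phi k)); rewrite // kk ltnW.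
Qed.

End FreeProductGap.

(** * The growth gap *)
Section CantorSpaces.
Local Open Scope classical_set_scope.

Lemma homeomorphic_cantor_like (Z : topologicalType) : homeomorphic Z cantor_space ->
  [/\ compact [set: Z], zero_dimensional Z, hausdorff_space Z,
      perfect_set [set: Z] & exists z : Z, True].
Proof.
move=> [f [g [cf cg fK gK]]].
have zd : zero_dimensional Z.
  move=> x y xy; have fxy : f x != f y by rewrite (inj_eq (can_inj fK)).
  have [U [cU Ux Uy]] := cantor_zero_dimensional fxy.
  by exists (f @^-1` U); split=> //; exact: preimage_clopen.
split=> //.
- have -> : [set: Z] = g @` [set: cantor_space].
    by apply/esym; rewrite -subTset => z _; exists (f z).
  apply: continuous_compact cantor_space_compact.
  exact: continuous_subspaceT.
- rewrite open_hausdorff => x y /zd[U [[oU clU] Ux Uy]].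
  exists (U, ~` U); first by split; [exact/mem_set | exact/mem_set].
  by split=> //=; [exact: closed_openC | rewrite setICr].
- split; first exact: closedT.
  rewrite -subTset => z _ U nU.
  have [_ lim] := cantor_perfect.
  have : limit_point [set: cantor_space] (f z) by rewrite lim.
  have nV : nbhs (f z) (g @^-1` U) by apply: cg; rewrite fK.
  move=> /(_ _ nV)[y [yf _ Uy]]; exists (g y); split=> //.
  by apply: contra yf => /eqP <-; rewrite gK.
- by exists (g point).
Qed.

End CantorSpaces.

Section GrowthGap.
Local Notation ball := Defs.ball.

Lemma growth_le_of_words (L : groupType) (T F : seq L) (X : Type) (c : action L X)
    (v : nat -> nat) K : symmetric_generating_set T ->
  (forall n, (0 < n)%N -> exists x (f : 'I_(v n) * 'I_n -> L),
    (forall p, ball F (K * n) (f p)) /\ injective (fun p => c (f p) x)) ->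
  growth_le (fun n => n * v n)%N (vol T c).
Proof.
move=> genT H; have [C FT] := gen_ball_seq F genT.
exists (C * K).+1; split=> // n n0; have [x [f [fB finj]]] := H _ n0.
apply: (@leq_trans (vol T c ((C * K).+1 * n))); last exact: leq_pmull.
have -> : (n * v n)%N = #|{: 'I_(v n) * 'I_n}| by rewrite card_prod !card_ord mulnC.
apply: (@vol_ge _ T _ c _ x _ (fun p => c (f p) x)) => // p.
exists (f p) => //; apply: (@ball_le _ _ (C * (K * n))).
  by rewrite mulnA leq_mul.
exact: ball_expand (fB p).
Qed.

End GrowthGap.

Theorem theorem1p4 (cG : groupType) (Z : topologicalType) (a : action cG Z)
    (S : seq cG) (genS : symmetric_generating_set S)
    (cantorZ : homeomorphic Z cantor_space)
    (homeo_a : by_homeomorphisms a)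
    (minimal_a : minimal_action a)
    (expansive_a : expansive_action a) :
  growth_class (vol S a) (alternating_full_group a) /\
  forall H : groupType, finitely_generated H -> (exists h : H, h <> 1%g) ->
    Schreier_growth_gap (free_product (alternating_full_group a) H)
      (fun n : nat => n * vol S a n)%N.
Proof.
have [cptZ zdZ hsZ pfZ [z0 _]] := homeomorphic_cantor_like cantorZ.
have fgA := alternating_finitely_generated genS homeo_a cptZ zdZ hsZ pfZ minimal_a
  expansive_a z0.
split.
  split=> //; exists Z, (alternating_action a); split.
    exact: alternating_action_faithful.
  by move=> T genT; exact: growth_upper_bound.
move=> H fgH [h h1]; split; first exact: free_product_finitely_generated.
move=> X c faithful_c T genT.
pose emb : alternating_full_group a -> free_product _ H := @fp_left _ H.
pose b := restricted_action c (fp_left1 _ H : emb 1%g = 1%g) (@fp_leftM _ H).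
have [coh|incoh] := pselect (coherent b).
  have emb_h t : t <> 1%g -> forall k, (0 < k)%N ->
      ((emb t * (fp_right _ h)^-1 * emb t * fp_right _ h) ^+ k <> 1)%g.
    by move=> t1 k k0; rewrite -fp_rightV; exact: fp_infinite_order.
  have [F HF] := coherent_growth S homeo_a cptZ zdZ hsZ pfZ minimal_a z0 faithful_c
    emb_h coh.
  exact: growth_le_of_words HF.
have [F HF] := incoherent_growth genS homeo_a cptZ zdZ hsZ pfZ minimal_a incoh z0.
apply: (@growth_le_of_words _ T (map emb F) _ c _ 2 genT) => n _.
have [y [f [fB finj]]] := HF n; exists y, (emb \o f); split=> // p.
rewrite mulSn mul1n; apply: ball_hom => //; [exact: fp_left1 | exact: fp_leftM].
Qed.
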